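(* Let $\boldsymbol{\alpha}\in\mathbb{N}^d$ with $|\boldsymbol{\alpha}|_1\le p$, put $s_{\boldsymbol{\alpha}}=d+2|\boldsymbol{\alpha}|_1$, and let $$D_1=\{s\in\mathbb{C}:0<\mathrm{Re}(s)<s_{\boldsymbol{\alpha}}\},\qquad D_3=\{s\in\mathbb{C}:s_{\boldsymbol{\alpha}}<\mathrm{Re}(s)<s_{\boldsymbol{\alpha}}+1\}.$$ For $s\in D_1$ let $$b_{\boldsymbol{\alpha}}^{D_1}(s)=\lim_{N\to\infty}\left(\int_{\mathbb{R}^d} g\!\left(\boldsymbol{x}\tfrac{a}{N}\right)\frac{\boldsymbol{x}^{2\boldsymbol{\alpha}}}{|\boldsymbol{x}|^s}\,\mathrm{d}\boldsymbol{x}-\sum_{\boldsymbol{i}\in\mathbb{Z}^d\setminus\{\boldsymbol{0}\}} g\!\left(\boldsymbol{i}\tfrac{a}{N}\right)\frac{\boldsymbol{i}^{2\boldsymbol{\alpha}}}{|\boldsymbol{i}|^s}\right).$$ Then for $s\in D_1$, $b_{\boldsymbol{\alpha}}^{D_1}(s)$ equals the analytic continuation from $D_3$ to $D_1$ of $b^{D_3}_{\boldsymbol{\alpha}}$ (the restriction to $D_3$ of the analytic continuation of $b_{\boldsymbol{\alpha}}^{D_1}$), that is, $$b_{\boldsymbol{\alpha}}^{D_1}(s)=\mathcal{A}_{D_3}^{D_1}\left[b_{\boldsymbol{\alpha}}^{D_3}\right](s)=\mathcal{A}_{D_3}^{D_1}\left[-\sum_{\boldsymbol{i}\in\mathbb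{Z}^d\setminus\{\boldsymbol{0}\}}\frac{\boldsymbol{i}^{2\boldsymbol{\alpha}}}{|\boldsymbol{i}|^{s}}\right](s).$$
   Context: $\mathbb{N}$ includes $0$; $d\ge1$, $p\in\mathbb{N}$, $a>0$. $|\cdot|$ is the Euclidean norm, $|\boldsymbol{\alpha}|_1=\sum_j\alpha_j$, $\boldsymbol{x}^{\boldsymbol{\alpha}}=\prod_jx_j^{\alpha_j}$. The function $g\in C_c^\infty(\mathbb{R}^d)$ is radial ($g(\boldsymbol{x})=g(|\boldsymbol{x}|)$), supported in $[-a,a]^d$, with $g(\boldsymbol{0})=1$ and $\partial^{\boldsymbol{\beta}}g(\boldsymbol{0})=0$ for $1\le|\boldsymbol{\beta}|_1\le 2p+1$. Analytic continuation operator: if $f$ is analytic on a set $D$ and there are a connected open set $\Omega\supset D\cup D'$ and an analytic function $F$ on $\Omega$ with $F=f$ on $D$, then $\mathcal{A}_{D}^{D'}[f]:=F|_{D'}$. Here the continuation is performed through the connected open set $\Omega=\{s\in\mathbb{C}:0<\mathrm{Re}(s)<s_{\boldsymbol{\alpha}}+1\}\setminus\{s_{\boldsymbol{\alpha}}\}$. *)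

(* Defs.v *)
From HB Require Import structures.
From mathcomp Require Import all_boot all_order all_algebra complex.
From mathcomp Require Import all_classical all_reals all_analysis.

Set Implicit Arguments.
Unset Strict Implicit.
Unset Printing Implicit Defensive.
Import Order.TTheory GRing.Theory Num.Theory numFieldNormedType.Exports.
Local Open Scope classical_set_scope.
Local Open Scope ring_scope.

Section PowerMeasure.
Context d (T : measurableType d) (R : realType).
Variable mu : {sigma_finite_measure set T -> \bar R}.

Definition tuple_cons n (z : T * n.-tuple T) : n.+1.-tuple T :=
  [tuple of z.1 :: z.2].

Definition power_succ n (m : set (n.-tuple T) -> \bar R) :
    set (n.+1.-tuple T) -> \bar R :=
  pushforward (mu \x m)%E (@tuple_cons n).

Fixpoint power_measure n : set (n.-tuple T) -> \bar R :=
  match n with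
  | 0 => dirac [tuple]
  | k.+1 => power_succ (@power_measure k)
  end.

Let tuple_uncons n (t : n.+1.-tuple T) : T * n.-tuple T :=
  (thead t, [tuple of behead t]).

Let tuple_consK n : cancel (@tuple_cons n) (@tuple_uncons n).
Proof.
by case=> x t; rewrite /tuple_uncons/= theadE; congr pair; apply: val_inj.
Qed.

Let measurable_tuple_cons n : measurable_fun [set: _] (@tuple_cons n).
Proof. exact: measurable_cons. Qed.

Let measurable_tuple_uncons n : measurable_fun [set: _] (@tuple_uncons n).
Proof.
apply: measurable_fun_pair; last exact: measurable_behead.
exact: measurable_tnth.
Qed.

Section step.
Variables (n : nat) (m : {sigma_finite_measure set (n.-tuple T) -> \bar R}).
Let M : {measure set _ -> \bar R} :=
  measure_function_pushforward__canonical__measure_function_Measure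
    (mu \x m)%E (@measurable_tuple_cons n).

Let ps0 : power_succ m set0 = 0%E. Proof. exact: (@measure0 _ _ _ M). Qed.
Let ps_ge0 A : (0 <= power_succ m A)%E.
Proof. exact: (@measure_ge0 _ _ _ M). Qed.
Let ps_sigma : semi_sigma_additive (power_succ m).
Proof. exact: (@measure_semi_sigma_additive _ _ _ M). Qed.

Let ps_sigma_finite : sigma_finite setT (power_succ m).
Proof.
have /sigma_finiteP[F [TF ndF Foo]] := sigma_finiteT mu.
have /sigma_finiteP[G [TG ndG Goo]] := sigma_finiteT m.
exists (fun k => @tuple_uncons n @^-1` (F k `*` G k)).
  rewrite -preimage_bigcup -[LHS](preimage_setT (@tuple_uncons n)).
  congr preimage; rewrite -setXTT TF TG predeqE => -[x y]; split.
    move=> [/= [i _ Fx] [k _ Gy]]; exists (maxn i k) => //; split.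
    - by move: x Fx; exact/subsetPset/ndF/leq_maxl.
    - by move: y Gy; exact/subsetPset/ndG/leq_maxr.
  by move=> [i _ []/= ? ?]; split; exists i.
move=> k; have [mF Fk] := Foo k; have [mG Gk] := Goo k; split.
  rewrite -[X in measurable X]setTI; apply: measurable_tuple_uncons => //.
  exact: measurableX.
rewrite /power_succ /pushforward -comp_preimage.
rewrite (_ : @tuple_uncons n \o _ = id); last first.
  by apply/funext => z; exact: tuple_consK.
by rewrite preimage_id product_measure1E// lte_mul_pinfty// ge0_fin_numE.
Qed.

HB.instance Definition _ :=
  isMeasure.Build _ _ _ (power_succ m) ps0 ps_ge0 ps_sigma.
HB.instance Definition _ :=
  Measure_isSigmaFinite.Build _ _ _ (power_succ m) ps_sigma_finite.
End step.

Let power_measure_sf n :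
  exists m : {sigma_finite_measure set (n.-tuple T) -> \bar R},
    m = @power_measure n :> (_ -> _).
Proof.
elim: n => [|n [m Hm]] /=; first by exists (dirac [tuple]).
by rewrite -Hm; exists (power_succ m).
Qed.

Let pm0 n : @power_measure n set0 = 0%E.
Proof. by have [m <-] := power_measure_sf n; exact: measure0. Qed.
Let pm_ge0 n A : (0 <= @power_measure n A)%E.
Proof. by have [m <-] := power_measure_sf n; exact: measure_ge0. Qed.
Let pm_sigma n : semi_sigma_additive (@power_measure n).
Proof.
by have [m <-] := power_measure_sf n; exact: measure_semi_sigma_additive.
Qed.
Let pm_sigma_finite n : sigma_finite setT (@power_measure n).
Proof. by have [m <-] := power_measure_sf n; exact: sigma_finiteT. Qed.

HB.instance Definition _ n :=
  isMeasure.Build _ _ _ (@power_measure n) (pm0 n) (@pm_ge0 n) (@pm_sigma n).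
HB.instance Definition _ n :=
  Measure_isSigmaFinite.Build _ _ _ (@power_measure n) (@pm_sigma_finite n).
End PowerMeasure.

(* R[i] carries its metric topology through its regular module. *)
Notation Cplx R := (R[i]^o).

Section ComplexAnalysis.
Variable R : realType.
Implicit Types (D Omega : set (Cplx R)) (f F : Cplx R -> Cplx R).

(* The intended use is r > 0, where cpow r s = exp (s * ln r). *)
Definition cpow (r : R) (s : Cplx R) : Cplx R :=
  ((r `^ complex.Re s * cos (complex.Im s * ln r))
   +i* (r `^ complex.Re s * sin (complex.Im s * ln r)))%C.

Definition analytic_on D f := forall s0, D s0 ->
  exists c : nat -> Cplx R,
    \forall s \near s0, series (fun n => c n * (s - s0) ^+ n) @ \oo --> f s.

Definition is_continuation Omega D f F :=
  analytic_on Omega F /\ (forall s, D s -> F s = f s).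

Definition continuable Omega D D' f :=
  [/\ open Omega, connected Omega, D `|` D' `<=` Omega,
      analytic_on D f & exists F, is_continuation Omega D f F].

(* The operator A_D^D'[f], performed through Omega and extended by 0 outside
   D'. It is meaningful when [continuable Omega D D' f] holds. *)
Definition continuation Omega D D' f : Cplx R -> Cplx R :=
  xget (fun=> 0) (is_continuation Omega D f) \_ D'.

Definition strip (x y : R) : set (Cplx R) :=
  [set s | x < complex.Re s < y].

Section Summation.
Variables (T : choiceType) (I : set T).

Definition csummable (u : T -> Cplx R) :=
  summable I (fun i => (Normc.normc (u i))%:E).

Definition rsum (u : T -> R) : R :=
  fine (esum I (EFin \o u)^\+ - esum I (EFin \o u)^\-)%E.

Definition csum (u : T -> Cplx R) : Cplx R :=
  (rsum (fun i => complex.Re (u i)) +i* rsum (fun i => complex.Im (u i)))%C.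

End Summation.

End ComplexAnalysis.

Section EuclideanSpace.
Variables (R : realType) (d : nat).
Implicit Types (g : 'rV[R]_d -> R) (x : 'rV[R]_d) (beta : 'I_d -> nat).

Definition enorm x : R := Num.sqrt (\sum_j x ord0 j ^+ 2).

Definition mdeg beta : nat := (\sum_j beta j)%N.

Definition monomial x beta : R := \prod_j x ord0 j ^+ beta j.

Definition pderive (j : 'I_d) g : 'rV[R]_d -> R := 'D_(delta_mx ord0 j) g.

Definition mpderive beta g : 'rV[R]_d -> R :=
  foldr (fun j h => iter (beta j) (pderive j) h) g (enum 'I_d).

Definition smooth g := forall l : seq 'I_d,
  let h := foldr pderive g l in
  continuous h /\ forall j x, derivable h x (delta_mx ord0 j).

Definition support_of g := closure [set x | g x != 0].

Definition Cc_infty g := smooth g /\ compact (support_of g).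

Definition radial g := exists G : R -> R, forall x, g x = G (enorm x).

Definition box (a : R) : set 'rV[R]_d :=
  [set x | forall j, - a <= x ord0 j <= a].

(* The library has no measure on 'rV[R]_d: integrate over d.-tuple R. *)
Definition lebesgue_tuple := @power_measure _ _ _ (@lebesgue_measure R) d.

Definition row_of_tuple (t : d.-tuple (measurableTypeR R)) : 'rV[R]_d :=
  \row_j tnth t j.

Definition cintegrable (f : 'rV[R]_d -> Cplx R) :=
  lebesgue_tuple.-integrable setT
    (fun t => (complex.Re (f (row_of_tuple t)))%:E) /\
  lebesgue_tuple.-integrable setT
    (fun t => (complex.Im (f (row_of_tuple t)))%:E).

Definition cintegral (f : 'rV[R]_d -> Cplx R) : Cplx R :=
  (Rintegral lebesgue_tuple setT (fun t => complex.Re (f (row_of_tuple t)))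
   +i* Rintegral lebesgue_tuple setT
         (fun t => complex.Im (f (row_of_tuple t))))%C.

End EuclideanSpace.

Section LatticeSums.
Variables (R : realType) (d : nat).
Variables (g : 'rV[R]_d -> R) (a : R) (alpha : 'I_d -> nat).

Definition Zd0 : set 'rV[int]_d := [set i | i != 0].

Definition hom_kernel (s : Cplx R) (x : 'rV[R]_d) : Cplx R :=
  (monomial x (fun j => 2 * alpha j)%N)%:C%C / cpow (enorm x) s.

Definition cut_kernel (N : nat) (s : Cplx R) (x : 'rV[R]_d) : Cplx R :=
  (g ((a / N%:R) *: x))%:C%C * hom_kernel s x.

Definition lattice (f : 'rV[R]_d -> Cplx R) (i : 'rV[int]_d) : Cplx R :=
  f (map_mx intr i).

Definition trap_defect (s : Cplx R) (N : nat) : Cplx R :=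
  cintegral (cut_kernel N s) - csum Zd0 (lattice (cut_kernel N s)).

Definition trap_limit (s : Cplx R) : Cplx R := lim (trap_defect s @ \oo).

End LatticeSums.

(* Main.v *)
Require Import Defs.
From HB Require Import structures.
From mathcomp Require Import all_boot all_order all_algebra complex ring lra zify.
From mathcomp Require Import all_classical all_reals all_analysis measurable_realfun.
Import Order.TTheory GRing.Theory Num.Theory numFieldNormedType.Exports.
Set Implicit Arguments.
Unset Strict Implicit.
Unset Printing Implicit Defensive.
Local Open Scope classical_set_scope.
Local Open Scope ring_scope.

(** Put S = d + 2 |alpha|, weigh a point x of space or of the lattice by
    x^(2 alpha), and fix the integer k = S + 1. The theorem holds because the
    truncated difference between integral and sum can be rewritten as one
    integral over t > 0 whose limit is visibly a meromorphic function of s, and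
    because the rewriting also applies to the untruncated series when it
    converges.

    Taylor's formula at infinity ([taylor_kernelE]) turns a smooth function phi
    decaying on the half-line into a superposition of truncated powers,
      phi (n) = 1/k! * int (t - n)_+^k (-1)^(k+1) phi^(k+1) (t) dt.
    With n = |x|^2 and phi (t) = g (c sqrt t) t^(-s/2), Fubini
    ([fubini_kernel]) leaves the Riesz means of order k of the weights:
    int x^(2 alpha) (t - |x|^2)_+^k dx, which by homogeneity is exactly
    C t^(k + S/2), and the corresponding sum B (t) over nonzero lattice points.
    Hence ([trap_defectE])
      truncated difference = int (C t^(k + S/2) - B t) Psi_N (t) dt,
    where Psi_N is 1/k! times the signed derivative of order k + 1.

    The decisive estimate is |B t - C t^(k + S/2)| <= c t^k for t >= 1
    ([lattice_mean]), a gain of t^(S/2) over the trivial size. In one dimension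
    it is the rapid convergence of the trapezoidal rule: the sum over a shifted
    grid is periodic in the shift, so each of its derivatives vanishes somewhere
    and is bounded by the next one ([periodic_quadrature]). Higher dimensions
    follow one coordinate at a time, since a Riesz mean integrated or summed
    over one more coordinate is again of the same form
    ([riesz_mean_asymptotic]).

    As the truncation is removed, Psi_N tends to q(s)/k! t^(-s/2 - k - 1) with
    q(s) = (s/2) (s/2 + 1) ... (s/2 + k), and is bounded by a multiple of that
    power uniformly in N. On 0 < Re s < S the estimate above gives an integrable
    majorant, so dominated convergence yields the limit ([trap_defect_cvg])
      F s = q(s)/k! * (2 C / (S - s) + int_1^oo (C t^(k + S/2) - B t) t^(-s/2 - k - 1) dt),
    the first term being the integral over t <= 1, where B vanishes. The
    remaining integral converges and is analytic for Re s > 0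
    ([mellin_analytic]), so F is analytic there except at S. For Re s > S the
    same steps with g replaced by 1 express the absolutely convergent series
    through int B t Psi dt, and the elementary integral of the power of t shows
    that its negative is F again ([hom_kernel_sum]). Thus F continues all three
    functions through the punctured strip, which is connected, and by the
    identity theorem ([analytic_identity]) it is the only continuation. *)

(** * Convergence in the complex plane *)

Section ComplexTopology.
Variable R : realType.
Implicit Types (s z w : Cplx R).

Notation normc := (@Normc.normc R).

Lemma normc_ge0 s : 0 <= normc s.
Proof. by case: s => x y; exact: sqrtr_ge0. Qed.

Lemma normc_def' s : `|s| = (normc s)%:C%C :> R[i].
Proof. by case: s. Qed.

Lemma nbhs_normc s0 (P : Cplx R -> Prop) :
  (\forall s \near s0, P s) <->
  exists2 e : R, 0 < e & forall s, normc (s - s0) < e -> P s.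
Proof.
split=> [/nbhs_normP[e /= e0 Pe]|[e e0 Pe]].
  exists (complex.Re e); first by move: e0; rewrite ltcE => /andP[].
  move=> s ss0; apply: Pe => /=; rewrite distrC normc_def'.
  move: e0 => /gtr0_real/RRe_real <-; by rewrite ltcR.
apply/nbhs_normP; exists (e%:C)%C; first by rewrite /= ltcR.
by move=> s /=; rewrite distrC normc_def' ltcR; exact: Pe.
Qed.

Lemma cvg_normc T (F : set_system T) {FF : Filter F} (u : T -> Cplx R) (l : Cplx R) :
  (forall e : R, 0 < e -> \forall n \near F, normc (u n - l) < e) <->
  (u @ F --> l).
Proof.
split=> [H|H e e0].
  move=> A /nbhs_normc[e e0 Ae]; near=> n; apply: Ae.
  by near: n; exact: H.
apply: (H [set s | normc (s - l) < e]); apply/nbhs_normc; by exists e.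
Unshelve. all: by end_near. Qed.

Lemma normcB s w : normc (s - w) = normc (w - s).
Proof. by rewrite -opprB normcN. Qed.

Lemma normr_Re_le s : `|complex.Re s| <= normc s.
Proof. by case: s => x y /=; rewrite -sqrtr_sqr ler_wsqrtr// lerDl sqr_ge0. Qed.
Lemma normr_Im_le s : `|complex.Im s| <= normc s.
Proof. by case: s => x y /=; rewrite -sqrtr_sqr ler_wsqrtr// lerDr sqr_ge0. Qed.
Lemma normc_le_ReIm s : normc s <= `|complex.Re s| + `|complex.Im s|.
Proof.
case: s => x y /=; rewrite -[leRHS]ger0_norm ?addr_ge0// -sqrtr_sqr ler_wsqrtr//.
rewrite sqrrD -(real_normK (num_real x)) -(real_normK (num_real y)).
by rewrite lerD2r lerDl mulrn_wge0// mulr_ge0.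
Qed.

Lemma normcX s n : normc (s ^+ n) = normc s ^+ n.
Proof.
elim: n => [|n IH]; first by rewrite !expr0 Normc.normc1.
by rewrite !exprS Normc.normcM IH.
Qed.

Lemma normc_real (x : R) : normc (x%:C)%C = `|x|.
Proof. by rewrite /= expr0n addr0 sqrtr_sqr. Qed.

Lemma normc_sum (I : Type) (r : seq I) (P : pred I) (F : I -> R[i]) :
  normc (\sum_(i <- r | P i) F i) <= \sum_(i <- r | P i) normc (F i).
Proof.
elim/big_ind2 : _ => //; first by rewrite Normc.normc0.
by move=> x1 x2 y1 y2 H1 H2; rewrite (le_trans (le_normcD _ _))// lerD.
Qed.

Lemma cvg_Cplx T (F : set_system T) {FF : Filter F} (u : T -> Cplx R) (l : Cplx R) :
  (complex.Re (u x)) @[x --> F] --> complex.Re l ->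
  (complex.Im (u x)) @[x --> F] --> complex.Im l ->
  u @ F --> l.
Proof.
move=> /cvgrPdist_lt HR /cvgrPdist_lt HI; apply/cvg_normc => e e0.
have e2 : 0 < e / 2 by rewrite divr_gt0.
have := HR _ e2; have := HI _ e2; apply: filterS2 => x H1 H2.
apply: (le_lt_trans (normc_le_ReIm _)).
rewrite !raddfB/= distrC [X in _ + X]distrC [ltRHS]splitr addrC.
by rewrite ltrD.
Qed.

Lemma cvgDc T (F : set_system T) {FF : Filter F} (u v : T -> Cplx R) (l m : Cplx R) :
  u @ F --> l -> v @ F --> m -> (fun x => u x + v x) @ F --> l + m.
Proof.
move=> /cvg_normc Hu /cvg_normc Hv; apply/cvg_normc => e e0.
have e2 : 0 < e / 2 by rewrite divr_gt0.
have := Hu _ e2; have := Hv _ e2; apply: filterS2 => x H1 H2.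
rewrite opprD addrACA (le_lt_trans (le_normcD _ _))// [ltRHS]splitr.
by rewrite ltrD.
Qed.

Lemma cvgMrc T (F : set_system T) {FF : Filter F} (u : T -> Cplx R) (l a : Cplx R) :
  u @ F --> l -> (fun x => a * u x) @ F --> a * l.
Proof.
move=> /cvg_normc Hu; apply/cvg_normc => e e0.
have a1 : 0 < normc a + 1 by rewrite ltr_wpDl ?normc_ge0.
have : 0 < e / (normc a + 1) by rewrite divr_gt0.
move=> /Hu; apply: filterS => x.
rewrite -mulrBr Normc.normcM ltr_pdivlMr// mulrC; apply: le_lt_trans.
by rewrite ler_wpM2r ?normc_ge0// lerDl.
Qed.

Lemma cvg_uniquec T (F : set_system T) {FF : ProperFilter F} (u : T -> Cplx R) (l m : Cplx R) :
  u @ F --> l -> u @ F --> m -> l = m.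
Proof. by move=> Hl Hm; exact: (cvg_unique _ Hl Hm). Qed.

Lemma open_normc (A : set (Cplx R)) :
  open A <-> forall s, A s -> exists2 e : R, 0 < e &
    forall w, normc (w - s) < e -> A w.
Proof.
rewrite openE; split=> [H s /H/nbhs_normc//|H s /H ?].
exact/nbhs_normc.
Qed.

End ComplexTopology.

(** * Power series and the identity theorem *)

Section Analytic.
Variable R : realType.
Implicit Types (s z w : Cplx R) (f g h : Cplx R -> Cplx R).
Notation normc := (@Normc.normc R).

Definition analytic_at f s0 := exists c : nat -> Cplx R,
  \forall s \near s0, series (fun n => c n * (s - s0) ^+ n) @ \oo --> f s.

Definition pser (c : nat -> Cplx R) (s0 s : Cplx R) (n : nat) : Cplx R :=
  \sum_(0 <= k < n) c k * (s - s0) ^+ k.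

Lemma analytic_pser f s0 : analytic_at f s0 <->
  exists c : nat -> Cplx R, \forall s \near s0, pser c s0 s @ \oo --> f s.
Proof. by []. Qed.

Lemma analytic_near f g s0 : (\forall s \near s0, f s = g s) ->
  analytic_at f s0 -> analytic_at g s0.
Proof.
by move=> fg [c Hc]; exists c; apply: filterS2 fg Hc => s ->.
Qed.

Lemma analytic_add f g s0 : analytic_at f s0 -> analytic_at g s0 ->
  analytic_at (fun s => f s + g s) s0.
Proof.
move=> /analytic_pser[c Hc] /analytic_pser[e He].
apply/analytic_pser; exists (fun n => c n + e n).
apply: filterS2 Hc He => s Hc He.
have -> : pser (fun n => c n + e n) s0 s = (fun n => pser c s0 s n + pser e s0 s n).
  by apply/funext => n; rewrite /pser -big_split; apply: eq_bigr => i _; rewrite mulrDl.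
exact: cvgDc.
Qed.

(** A polynomial factor in s is multiplied in one affine factor at a time. *)
Lemma analytic_linM (a b : Cplx R) f s0 : analytic_at f s0 ->
  analytic_at (fun s => (a + b * s) * f s) s0.
Proof.
move=> [c Hc].
pose a' := a + b * s0.
exists (fun n => a' * c n + b * (if n is m.+1 then c m else 0)).
apply: filterS Hc => s Hc.
rewrite (_ : a + b * s = a' + b * (s - s0)); last by rewrite /a'; ring.
rewrite -cvg_shiftS.
pose S := series (fun n => c n * (s - s0) ^+ n).
rewrite (_ : (fun n => _) = (fun n => a' * S n.+1 + (b * (s - s0)) * S n)).
  rewrite mulrDl; apply: cvgDc; apply: cvgMrc; last exact: Hc.
  by rewrite (cvg_shiftS S).
apply/funext; elim => [|n IH].
  by rewrite /S /series/= !big_nat1 big_nil !mulr0 !expr0 !mulr1 !addr0.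
rewrite [LHS]seriesSr IH [in RHS]/S [X in _ = _ + _ * X]seriesSr.
by rewrite [X in _ = _ * X + _]seriesSr/= exprS -/S; ring.
Qed.

(** Near its centre a power series is governed by its first nonzero term: the
    rest is a geometric tail. *)
Lemma power_series_leading f s0 (c : nat -> Cplx R) m :
  (\forall s \near s0, series (fun n => c n * (s - s0) ^+ n) @ \oo --> f s) ->
  (forall i, (i < m)%N -> c i = 0) ->
  exists2 K : R, 0 <= K & \forall s \near s0,
    normc (f s - c m * (s - s0) ^+ m) <= K * normc (s - s0) ^+ m.+1.
Proof.
move=> /nbhs_normc[e e0 Hc] cm.
pose r := e / 2.
have r0 : 0 < r by rewrite divr_gt0.
(* The series converges at s0 + r, so its terms there are bounded. *)
have [M M0 HM] : exists2 M, 0 <= M & forall n, normc (c n) * r ^+ n <= M.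
  have := Hc (s0 + (r%:C)%C).
  rewrite (addrC s0) addrK normc_real gtr0_norm// ltr_pdivrMr// ltr_pMr//.
  rewrite ltr1n => /(_ isT) Hr.
  have /cvg_normc/(_ 1 ltr01)[N _ HN] := cvg_series_cvg_0 (cvgP _ Hr).
  exists (1 + \sum_(i < N) normc (c i) * r ^+ i).
    by rewrite addr_ge0// sumr_ge0// => i _; rewrite mulr_ge0 ?normc_ge0 ?exprn_ge0// ltW.
  move=> n; have [nN|Nn] := ltnP n N.
    rewrite (bigD1 (Ordinal nN))//= addrCA lerDl addr_ge0// sumr_ge0// => i _.
    by rewrite mulr_ge0 ?normc_ge0 ?exprn_ge0// ltW.
  have := HN n Nn; rewrite subr0 Normc.normcM normcX normc_real gtr0_norm// => /ltW.
  move=> /le_trans; apply; rewrite lerDl sumr_ge0// => i _.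
  by rewrite mulr_ge0 ?normc_ge0 ?exprn_ge0// ltW.
exists (M * r ^- m.+1 * 2); first by rewrite !mulr_ge0// invr_ge0 exprn_ge0// ltW.
apply/nbhs_normc; exists (r / 2) => [|s Hs]; first by rewrite divr_gt0.
set x := normc (s - s0) in Hs *.
have x0 : 0 <= x by exact: normc_ge0.
have /Hc/cvg_normc Hcs : normc (s - s0) < e.
  by rewrite (lt_trans Hs)// /r; nra.
apply/ler_addgt0Pr => d d0.
have [N _ /(_ (m.+1 + N)%N)] := Hcs d d0.
rewrite /= leq_addl => /(_ isT) HN.
set S := series _ _ in HN.
rewrite (_ : f s - _ = (S - c m * (s - s0) ^+ m) - (S - f s)); last by ring.
rewrite (le_trans (le_normcD _ _))// normcN lerD//; last exact: ltW.
rewrite /S /series/= (big_cat_nat (n := m.+1)) ?leq_addr//=.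
rewrite big_nat_recr//= big_nat_cond big1 ?add0r; last first.
  by move=> i; rewrite andbT => /andP[_ /cm ->]; rewrite mul0r.
rewrite addrAC subrr add0r -{1}[m.+1]add0n big_addn addKn big_mkord.
rewrite (le_trans (normc_sum _ _ _))//.
apply: (@le_trans _ _ (\sum_(i < N) (M * r ^- m.+1 * x ^+ m.+1) * (1 / 2) ^+ i)).
  apply: ler_sum => i _; rewrite Normc.normcM normcX -/x exprD.
  have H1 : normc (c (i + m.+1)%N) <= M * r ^- (i + m.+1).
    by rewrite ler_pdivlMr ?exprn_gt0.
  rewrite (le_trans (ler_wpM2r _ H1)) ?mulr_ge0 ?exprn_ge0//.
  rewrite exprD invfM -!mulrA ler_wpM2l//.
  rewrite mulrCA ler_wpM2l ?invr_ge0 ?exprn_ge0 ?(ltW r0)//.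
  rewrite mulrCA mulrA mulrC ler_wpM2l ?exprn_ge0//.
  rewrite -exprVn -exprMn lerXn2r ?nnegrE ?divr_ge0 ?(ltW r0)//.
    exact: ltW.
  by rewrite ler_pdivrMr// mul1r mulrC ltW.
rewrite -mulr_sumr -!mulrA ler_wpM2l// ler_wpM2l ?invr_ge0 ?exprn_ge0 ?(ltW r0)//.
rewrite [leRHS]mulrC ler_wpM2l ?exprn_ge0//.
have -> : \sum_(i < N) (1 / 2 : R) ^+ i = (1 - (1 / 2) ^+ N) * 2.
  elim: N {S HN} => [|n IH]; first by rewrite big_ord0 expr0 subrr mul0r.
  by rewrite big_ord_recr/= IH exprS; field.
have : 0 <= (1 / 2 : R) ^+ N by rewrite exprn_ge0.
by lra.
Qed.

(** If the zeros accumulate at s0, then no coefficient can be the first nonzero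
    one, as the leading term would outweigh the rest at a zero close to s0. *)
Lemma analytic_isolated f s0 : analytic_at f s0 ->
  (forall e : R, 0 < e -> exists s, [/\ s != s0, normc (s - s0) < e & f s = 0]) ->
  \forall s \near s0, f s = 0.
Proof.
move=> [c Hc] Hz.
have c0 n : c n = 0.
  elim/ltn_ind : n => m IH; apply/eqP/negPn/negP => cm0.
  have [K K0 /nbhs_normc[e e0 He]] := power_series_leading Hc IH.
  have ncm : 0 < normc (c m).
    rewrite lt_neqAle normc_ge0 andbT eq_sym; apply: contra_neq cm0.
    exact: Normc.eq0_normc.
  pose d := Num.min e (normc (c m) / (K + 1)).
  have d0 : 0 < d by rewrite lt_min e0/= divr_gt0// ltr_wpDl.
  have [s [ss0 sd fs0]] := Hz d d0.
  have xp : 0 < normc (s - s0).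
    rewrite lt_neqAle normc_ge0 andbT eq_sym; apply: contra_neq ss0.
    by move/Normc.eq0_normc/eqP; rewrite subr_eq0 => /eqP.
  have := He s; rewrite (lt_le_trans sd) ?ge_min ?lexx// => /(_ isT).
  rewrite fs0 sub0r normcN Normc.normcM normcX exprSr mulrA.
  rewrite [leRHS]mulrAC ler_pM2r ?exprn_gt0// => H.
  have : normc (s - s0) < normc (c m) / (K + 1).
    by rewrite (lt_le_trans sd)// ge_min lexx orbT.
  rewrite ltr_pdivlMr ?ltr_wpDl//; move: H; nra.
apply: filterS Hc => s.
have -> : series (fun n => c n * (s - s0) ^+ n) = fun=> 0; last first.
  by move=> /cvg_uniquec -/(_ _ (cvg_cst _)).
apply/funext => n; rewrite /series/= big1// => i _; by rewrite c0 mul0r.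
Qed.

(** The interior of the zero set of f - g is closed in Omega because a limit of
    interior zeros is an accumulation point of zeros. *)
Lemma analytic_identity (Omega D : set (Cplx R)) f g :
  open Omega -> connected Omega -> open D -> D !=set0 -> D `<=` Omega ->
  (forall s, Omega s -> analytic_at f s) -> (forall s, Omega s -> analytic_at g s) ->
  (forall s, D s -> f s = g s) -> forall s, Omega s -> f s = g s.
Proof.
move=> oO cO oD [s1 Ds1] DO fa ga fg.
(* The difference is written with an affine factor to be recognisably analytic. *)
pose h s := f s + (-1 + 0 * s) * g s.
have hE s : (h s == 0) = (f s == g s).
  by rewrite /h mul0r addr0 mulN1r subr_eq0.
have ha s : Omega s -> analytic_at h s.
  by move=> Os; apply: analytic_add; [exact: fa|apply: analytic_linM; exact: ga].
pose B := [set s | Omega s /\ \forall w \near s, h w = 0].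
suff -> : Omega = B.
  by move=> s [Os /nbhs_singleton/eqP]; rewrite hE => /eqP.
apply/esym/cO.
- exists s1; split; first exact: DO.
  have := open_nbhs_nbhs (conj oD Ds1); apply: filterS => s /fg fgs.
  by apply/eqP; rewrite hE fgs.
- exists [set s | \forall w \near s, h w = 0]; last by [].
  by have := @open_interior _ [set w | h w = 0].
- exists (closure B); first exact: closed_closure.
  apply/seteqP; split=> s; first by move=> Bs; split; [case: Bs|exact: subset_closure].
  move=> [Os cBs]; split=> //; apply: analytic_isolated; first exact: ha.
  move=> e e0.
  have [] := cBs [set w | normc (w - s) < e].
    by apply/nbhs_normc; exists e.
  move=> b [[Ob /nbhs_normc[d d0 Hd]]] /= be.
  (* When b is s itself, a real translate of s supplies a second zero. *)
  have [bs|bs] := eqVneq b s; last first.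
    exists b; split=> //; apply: Hd; by rewrite subrr Normc.normc0.
  pose t := Num.min d e / 2.
  have m0 : 0 < Num.min d e by rewrite lt_min d0 e0.
  have t0 : 0 < t by rewrite divr_gt0.
  have tm : t < Num.min d e by rewrite ltr_pdivrMr// ltr_pMr// ltr1n.
  have E : s + (t%:C)%C - s = (t%:C)%C by rewrite addrAC subrr add0r.
  exists (s + (t%:C)%C); split.
  - rewrite addrC -subr_eq0 addrK.
    by apply/eqP => /complexI t00; rewrite t00 ltxx in t0.
  - by rewrite E normc_real gtr0_norm// (lt_le_trans tm)// ge_min lexx orbT.
  - apply: Hd; rewrite bs E normc_real gtr0_norm//.
    by rewrite (lt_le_trans tm)// ge_min lexx.
Qed.

End Analytic.

(** * The punctured strip and analytic continuation *)

Section Continuation.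
Variable R : realType.
Implicit Types (s z w : Cplx R) (f g F : Cplx R -> Cplx R) (A D : set (Cplx R)).
Notation normc := (@Normc.normc R).

(** The geometric series in (s - s0) / (c - s0). *)
Lemma analytic_pole (c s0 : Cplx R) : s0 != c ->
  analytic_at (fun s => (c - s)^-1) s0.
Proof.
move=> s0c; apply/analytic_pser.
have d0 : c - s0 != 0 by rewrite subr_eq0 eq_sym.
have nd0 : 0 < normc (c - s0).
  rewrite lt_neqAle normc_ge0 andbT eq_sym; apply: contra_neq d0.
  exact: Normc.eq0_normc.
exists (fun n => (c - s0) ^- n.+1); apply/nbhs_normc.
exists (normc (c - s0)) => // s Hs.
have cs0 : c - s != 0.
  by apply: contraTneq Hs => /subr0_eq <-; rewrite ltxx.
pose x := (s - s0) / (c - s0).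
have nx : normc x < 1.
  by rewrite /x Normc.normcM Normc.normcV ltr_pdivrMr// mul1r.
have -> : pser (fun n => (c - s0) ^- n.+1) s0 s =
    fun n => (c - s)^-1 + (- (c - s)^-1) * x ^+ n.
  apply/funext; elim => [|n IH].
    by rewrite /pser big_nil expr0 mulr1 subrr.
  rewrite /pser big_nat_recr//= -/(pser _ _ _ _) IH !exprS /x !expr_div_n.
  field.
  by rewrite cs0 d0 expf_neq0.
rewrite -[X in _ --> X]addr0; apply: cvgDc; first exact: cvg_cst.
rewrite -(mulr0 (- (c - s)^-1)); apply: cvgMrc.
apply/cvg_normc => e e0.
have : normc x ^+ n @[n --> \oo] --> 0.
  by apply: cvg_expr; rewrite ger0_norm ?normc_ge0.
move=> /cvgrPdist_lt/(_ e e0); apply: filterS => n.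
by rewrite sub0r normrN ger0_norm ?exprn_ge0 ?normc_ge0// subr0 normcX.
Qed.

Lemma open_strip x y : open (strip x y : set (Cplx R)).
Proof.
apply/open_normc => s /andP[xs sy].
exists (Num.min (complex.Re s - x) (y - complex.Re s)).
  by rewrite lt_min !subr_gt0 xs sy.
move=> w; rewrite lt_min => /andP[H1 H2].
have := normr_Re_le (w - s); rewrite raddfB/= ler_norml => /andP[H3 H4].
rewrite /strip/=; apply/andP; split; lra.
Qed.

Lemma convex_connected A :
  (forall s w (t : R), A s -> A w -> 0 <= t <= 1 -> A (s + (t%:C)%C * (w - s))) ->
  connected A.
Proof.
move=> cvx; have [A0|/set0P[s0 As0]] := eqVneq A set0.
  by rewrite A0; exact: connected0.
pose seg w (t : R) : Cplx R := s0 + (t%:C)%C * (w - s0).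
have -> : A = \bigcup_(w in A) (seg w @` `[0, 1]).
  apply/seteqP; split=> [w Aw|w [v Av [t /=]]].
    exists w => //; exists 1; first by rewrite /= in_itv/= ler01 lexx.
    by rewrite /seg mul1r addrC subrK.
  by rewrite in_itv/= => t01 <-; exact: cvx.
apply: bigcup_connected.
  exists s0 => w _; exists 0; first by rewrite /= in_itv/= ler01 lexx.
  by rewrite /seg mul0r addr0.
move=> w _; apply: connected_continuous_connected; first exact: segment_connected.
apply: continuous_subspaceT => t; apply/cvg_normc => e e0.
have n1 : 0 < normc (w - s0) + 1 by rewrite ltr_wpDl ?normc_ge0.
have : 0 < e / (normc (w - s0) + 1) by rewrite divr_gt0.
have /cvgrPdist_lt H : u @[u --> t] --> t by exact: cvg_id.
move=> /H; apply: filterS => u.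
rewrite /seg opprD addrACA subrr add0r -mulrBl -raddfB/= Normc.normcM normc_real distrC.
rewrite ltr_pdivlMr//; apply: le_lt_trans.
by rewrite ler_wpM2l// lerDl.
Qed.

(** The punctured strip is a chain of four overlapping convex pieces: the part
    left of the puncture, the upper half, the part right of it, the lower half. *)
Lemma punctured_strip_connected (x : R) : 0 < x ->
  connected (strip 0 (x + 1) `\ (x%:C)%C : set (Cplx R)).
Proof.
move=> x0.
have cvx1 (a c d t : R) : 0 <= t -> t <= 1 -> a < c -> a < d -> a < (1 - t) * c + t * d.
  move=> t0 t1 ac ad; rewrite -subr_gt0.
  rewrite (_ : _ - a = (1 - t) * (c - a) + t * (d - a)); last by ring.
  have [->|tn0] := eqVneq t 0; first by rewrite subr0 mul1r mul0r addr0 subr_gt0.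
  have tp : 0 < t by rewrite lt_neqAle eq_sym tn0.
  by rewrite ltr_wpDl// ?mulr_gt0 ?mulr_ge0 ?subr_ge0 ?subr_gt0// ltW.
have cvxT (a b c d t : R) : 0 <= t <= 1 -> a < c < b -> a < d < b ->
    a < c + t * (d - c) < b.
  move=> /andP[t0 t1] /andP[ac cb] /andP[ad db].
  rewrite (_ : c + _ = (1 - t) * c + t * d); last by ring.
  apply/andP; split; first exact: cvx1.
  rewrite -ltrN2 opprD -!mulrN; apply: cvx1 => //; by rewrite ltrN2.
have cL (y y1 : R) : connected (strip y y1 : set (Cplx R)).
  apply: convex_connected => -[a b] [c d] t; rewrite /strip/= => H1 H2 t01.
  by rewrite mul0r subr0; exact: cvxT.
have cU (e : R) : connected ([set s | strip 0 (x + 1) s /\ 0 < e * complex.Im s] : set (Cplx R)).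
  apply: convex_connected => -[a b] [c d] t; rewrite /strip/= => -[H1 H2] [H3 H4] t01.
  rewrite !mul0r subr0 addr0; split; first exact: cvxT.
  move: t01 => /andP[t0 t1].
  rewrite (_ : e * _ = (1 - t) * (e * b) + t * (e * d)); last by ring.
  exact: cvx1.
pose U : set (Cplx R) := [set s | strip 0 (x + 1) s /\ 0 < 1 * complex.Im s].
pose V : set (Cplx R) := [set s | strip 0 (x + 1) s /\ 0 < -1 * complex.Im s].
have -> : strip 0 (x + 1) `\ (x%:C)%C =
    ((strip 0 x `|` U) `|` strip x (x + 1)) `|` V :> set (Cplx R).
  apply/seteqP; split=> -[a b]; rewrite /U /V /strip/= !mul1r mulN1r oppr_gt0.
    move=> [/andP[a0 ax] abx].
    have [b0|b0|b0] := ltgtP b 0; [by right; rewrite a0 ax|by left; left; right; rewrite a0 ax|].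
    have [a1|a1|a1] := ltgtP a x.
    - by left; left; left; rewrite a0.
    - by left; right.
    - by exfalso; apply: abx; rewrite a1 b0.
  move=> [[[/andP[a0 ax]|[-> b0]]|/andP[a0 ax]]|[-> b0]].
  - split; first by rewrite a0 (lt_trans ax)// ltrDl.
    by move=> [ax' _]; rewrite ax' ltxx in ax.
  - by split=> // -[_ b0']; rewrite b0' ltxx in b0.
  - split; first by rewrite ax (lt_trans x0).
    by move=> [ax' _]; rewrite ax' ltxx in a0.
  - by split=> // -[_ b0']; rewrite b0' ltxx in b0.
have hx : 0 < x / 2 < x by rewrite divr_gt0//= ltr_pdivrMr// ltr_pMr// ltr1n.
move: hx => /andP[hx1 hx2].
have h2 : 1 / 2 < 1 :> R by lra.
have h20 : 0 < 1 / 2 :> R by lra.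
apply: connectedU; [|apply: connectedU; [|apply: connectedU; [|exact: cL|exact: cU]|exact: cL]|exact: cU].
- exists ((x / 2) +i* -1)%C; split; first by do 2 left; rewrite /strip/= hx1 hx2.
  by split; rewrite /strip/= ?hx1 ?mulrNN ?mulr1// (lt_trans hx2) ?ltrDl.
- exists ((x + 1 / 2) +i* 1)%C; split; last by rewrite /strip/= ltrDl h20 ltrD2l.
  by right; split; rewrite /strip/= ?mulr1 ?addr_gt0//= ltrD2l.
- exists ((x / 2) +i* 1)%C; split; first by rewrite /strip/= hx1.
  by split; rewrite /strip/= ?mulr1 ?hx1//= (lt_trans hx2) ?ltrDl.
Qed.

Lemma punctured_strip_open (x : R) :
  open (strip 0 (x + 1) `\ (x%:C)%C : set (Cplx R)).
Proof.
apply/open_normc => s [/= ss sx].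
have [e e0 He] := (iffLR (@open_normc _ _) (@open_strip 0 (x + 1))) s ss.
have d0 : 0 < normc (s - (x%:C)%C).
  rewrite lt_neqAle normc_ge0 andbT eq_sym; apply/eqP => /Normc.eq0_normc/subr0_eq.
  exact: sx.
exists (Num.min e (normc (s - (x%:C)%C))); first by rewrite lt_min e0 d0.
move=> w; rewrite lt_min => /andP[we wd]; split; first exact: He.
by move=> /= wx; rewrite wx normcB ltxx in wd.
Qed.

(** The continuation is defined by a choice among all analytic extensions; the
    identity theorem makes that choice immaterial. *)
Lemma continuationE (Omega D D' : set (Cplx R)) f F :
  open Omega -> connected Omega -> open D -> D !=set0 -> D `<=` Omega ->
  D' `<=` Omega -> analytic_on Omega F -> (forall s, D s -> F s = f s) ->
  forall s, D' s -> continuation Omega D D' f s = F s.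
Proof.
move=> oO cO oD D0 DO DO' aF Ff s D's.
rewrite /continuation patchT ?inE//.
have [aG Gf] : is_continuation Omega D f (xget (fun=> 0) (is_continuation Omega D f)).
  by apply: xgetPex; exists F.
apply: (analytic_identity oO cO oD D0 DO aG aF); last exact: DO'.
by move=> w Dw; rewrite Gf// Ff.
Qed.

Lemma continuableE (Omega D D' : set (Cplx R)) f F :
  open Omega -> connected Omega -> open D -> D `<=` Omega ->
  D' `<=` Omega -> analytic_on Omega F -> (forall s, D s -> F s = f s) ->
  continuable Omega D D' f.
Proof.
move=> oO cO oD DO DO' aF Ff; split=> //.
- by move=> s [/DO|/DO'].
- move=> s Ds; apply: (@analytic_near _ F); last by apply: aF; exact: DO.
  by have := open_nbhs_nbhs (conj oD Ds); apply: filterS => w /Ff.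
- by exists F.
Qed.

End Continuation.

(** * Complex-valued functions of a real variable *)

Section RealDerive.
Variable R : realType.
Implicit Types (f g : R -> R) (t : R).

Lemma is_derive_add' f g t df dg : is_derive t 1 f df -> is_derive t 1 g dg ->
  is_derive t 1 (fun x => f x + g x) (df + dg).
Proof. by move=> Hf Hg; exact: (@is_deriveD _ _ _ f g). Qed.

Lemma is_derive_sub' f g t df dg : is_derive t 1 f df -> is_derive t 1 g dg ->
  is_derive t 1 (fun x => f x - g x) (df - dg).
Proof. by move=> Hf Hg; exact: (@is_deriveB _ _ _ f g). Qed.

Lemma is_derive_mul' f g t df dg : is_derive t 1 f df -> is_derive t 1 g dg ->
  is_derive t 1 (fun x => f x * g x) (df * g t + f t * dg).
Proof.
move=> Hf Hg; apply: (is_derive_eq (@is_deriveM _ _ f g t 1 df dg Hf Hg)).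
by rewrite /GRing.scale/=; ring.
Qed.

Lemma is_derive_cst' (c : R) t : is_derive t 1 (fun=> c) 0.
Proof. exact: is_derive_cst. Qed.

Lemma is_derive_exp' n t : is_derive t 1 (fun x : R => x ^+ n) (n%:R * t ^+ n.-1).
Proof.
elim: n => [|n IH].
  by rewrite mul0r; under eq_fun do rewrite expr0; exact: is_derive_cst'.
under eq_fun do rewrite exprS.
apply: (is_derive_eq (is_derive_mul' (f := fun x => x) (is_derive_id _ _) IH)).
case: n {IH} => [|n] /=; first by rewrite !mul0r mulr0 addr0.
by rewrite [in RHS]mulrSr exprS; ring.
Qed.

Lemma is_derive_comp' f g t df dg : is_derive (g t) 1 f df -> is_derive t 1 g dg ->
  is_derive t 1 (fun x => f (g x)) (df * dg).
Proof. by move=> Hf Hg; apply: is_derive1_comp. Qed.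

Lemma is_derive_continuous f t df : is_derive t 1 f df -> {for t, continuous f}.
Proof. by move=> H; apply: differentiable_continuous; apply/derivable1_diffP; case: H. Qed.

Lemma is_derive_le f df (a b M : R) : a <= b ->
  (forall x, a <= x <= b -> is_derive x 1 f (df x)) ->
  (forall x, a <= x <= b -> `|df x| <= M) -> `|f b - f a| <= M * (b - a).
Proof.
move=> ab Hd HM.
have [x xab ->] : exists2 c, c \in `[a, b]%R & f b - f a = df c * (b - a).
  apply: MVT_segment => //.
    by move=> x; rewrite in_itv/= => /andP[ax xb]; apply: Hd; rewrite !ltW.
  apply: derivable_within_continuous => x; rewrite in_itv/= => /Hd H.
  by case: H.
rewrite normrM (ger0_norm (x := b - a)) ?subr_ge0// ler_wpM2r ?subr_ge0//.
by apply: HM; rewrite in_itv in xab.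
Qed.

End RealDerive.

Section ComplexDerive.
Variable R : realType.
Implicit Types (f g : R -> Cplx R) (t : R).
Notation normc := (@Normc.normc R).
Notation Re := (@complex.Re R).
Notation Im := (@complex.Im R).

Lemma ReD (s w : R[i]) : Re (s + w) = Re s + Re w.
Proof. by case: s => a b; case: w => c d. Qed.
Lemma ImD (s w : R[i]) : Im (s + w) = Im s + Im w.
Proof. by case: s => a b; case: w => c d. Qed.
Lemma ReN (s : R[i]) : Re (- s) = - Re s. Proof. by case: s. Qed.
Lemma ImN (s : R[i]) : Im (- s) = - Im s. Proof. by case: s. Qed.
Lemma ReB' (s w : R[i]) : Re (s - w) = Re s - Re w.
Proof. by rewrite ReD ReN. Qed.
Lemma ImB' (s w : R[i]) : Im (s - w) = Im s - Im w.
Proof. by rewrite ImD ImN. Qed.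
Lemma ReM (s w : R[i]) : Re (s * w) = Re s * Re w - Im s * Im w.
Proof. by case: s => a b; case: w => c d. Qed.
Lemma ImM (s w : R[i]) : Im (s * w) = Re s * Im w + Im s * Re w.
Proof. by case: s => a b; case: w => c d /=. Qed.

Definition is_cder f t (df : Cplx R) :=
  is_derive t 1 (fun x => Re (f x)) (Re df) /\
  is_derive t 1 (fun x => Im (f x)) (Im df).

Lemma is_cder_eq f t df df' : is_cder f t df -> df = df' -> is_cder f t df'.
Proof. by move=> H <-. Qed.

Lemma is_cder_cst (c : Cplx R) t : is_cder (fun=> c) t 0.
Proof. by split; exact: is_derive_cst. Qed.

Lemma is_cderD f g t df dg : is_cder f t df -> is_cder g t dg ->
  is_cder (fun x => f x + g x) t (df + dg).
Proof.
move=> [f1 f2] [g1 g2]; split.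
  rewrite [X in is_derive _ _ X](_ : _ = fun x => Re (f x) + Re (g x)).
    by rewrite ReD; exact: is_derive_add'.
  by apply/funext => x; rewrite ReD.
rewrite [X in is_derive _ _ X](_ : _ = fun x => Im (f x) + Im (g x)).
  by rewrite ImD; exact: is_derive_add'.
by apply/funext => x; rewrite ImD.
Qed.

Lemma is_cderM f g t df dg : is_cder f t df -> is_cder g t dg ->
  is_cder (fun x => f x * g x) t (df * g t + f t * dg).
Proof.
move=> [f1 f2] [g1 g2]; split.
  rewrite [X in is_derive _ _ X](_ : _ = fun x => Re (f x) * Re (g x) - Im (f x) * Im (g x)); last first.
    by apply/funext => x; rewrite ReM.
  apply: (is_derive_eq (is_derive_sub' (is_derive_mul' f1 g1) (is_derive_mul' f2 g2))).
  by rewrite ReD !ReM; ring.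
rewrite [X in is_derive _ _ X](_ : _ = fun x => Re (f x) * Im (g x) + Im (f x) * Re (g x)); last first.
  by apply/funext => x; rewrite ImM.
apply: (is_derive_eq (is_derive_add' (is_derive_mul' f1 g2) (is_derive_mul' f2 g1))).
by rewrite ImD !ImM; ring.
Qed.

Lemma is_cderZ (c : Cplx R) f t df : is_cder f t df ->
  is_cder (fun x => c * f x) t (c * df).
Proof.
move=> H; apply: (is_cder_eq (is_cderM (is_cder_cst c t) H)).
by rewrite mul0r add0r.
Qed.

Lemma is_cder_real (h : R -> R) t dh : is_derive t 1 h dh ->
  is_cder (fun x => (h x)%:C%C) t (dh%:C)%C.
Proof. by move=> H; split => //=; exact: is_derive_cst. Qed.

Lemma is_cder_comp f (h : R -> R) t df dh : is_cder f (h t) df -> is_derive t 1 h dh ->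
  is_cder (fun x => f (h x)) t (df * (dh%:C)%C).
Proof.
move=> [f1 f2] H; split.
  apply: (is_derive_eq (is_derive_comp' f1 H)).
  by rewrite ReM /=; ring.
apply: (is_derive_eq (is_derive_comp' f2 H)).
by rewrite ImM /=; ring.
Qed.

(** The factor 2 comes from estimating real and imaginary parts separately,
    which is how the real mean value theorem applies to complex values. *)
Lemma is_cder_le f df (a b M : R) : a <= b ->
  (forall x, a <= x <= b -> is_cder f x (df x)) ->
  (forall x, a <= x <= b -> normc (df x) <= M) ->
  normc (f b - f a) <= 2 * M * (b - a).
Proof.
move=> ab Hd HM; rewrite (le_trans (normc_le_ReIm _))// !raddfB/=.
rewrite -mulrA mulr2n mulrDl mul1r lerD//.
- apply: (is_derive_le (f := fun x => Re (f x)) (df := fun x => Re (df x))) => // x xab; first by case: (Hd x xab).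
  by rewrite (le_trans (normr_Re_le _))// HM.
- apply: (is_derive_le (f := fun x => Im (f x)) (df := fun x => Im (df x))) => // x xab; first by case: (Hd x xab).
  by rewrite (le_trans (normr_Im_le _))// HM.
Qed.

Definition cexp (z : Cplx R) : Cplx R :=
  ((expR (Re z) * cos (Im z)) +i* (expR (Re z) * sin (Im z)))%C.

Lemma Re_cexp z : Re (cexp z) = expR (Re z) * cos (Im z). Proof. by []. Qed.
Lemma Im_cexp z : Im (cexp z) = expR (Re z) * sin (Im z). Proof. by []. Qed.

Lemma cexp0 : cexp 0 = 1.
Proof. by rewrite /cexp/= expR0 cos0 sin0 mulr1 mulr0. Qed.

Lemma cexpD z w : cexp (z + w) = cexp z * cexp w.
Proof.
rewrite /cexp ReD ImD expRD cosD sinD; apply/eqP.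
by rewrite eq_complex ReM ImM/=; apply/andP; split; apply/eqP; ring.
Qed.

Lemma normc_cexp z : normc (cexp z) = expR (Re z).
Proof.
rewrite /cexp/= !exprMn -mulrDr cos2Dsin2 mulr1 sqrtr_sqr ger0_norm// expR_ge0.
Qed.

Lemma cexp_cder (z : Cplx R) t : is_cder (fun x => cexp ((x%:C)%C * z)) t (z * cexp ((t%:C)%C * z)).
Proof.
have L (c : R) : is_derive t 1 (fun x : R => x * c) c.
  have H : is_derive t 1 (fun x : R => x * c) (1 * c + t * 0).
    exact: (is_derive_mul' (f := fun x => x) (is_derive_id _ _) (is_derive_cst' c t)).
  by apply: (is_derive_eq H); rewrite mul1r mulr0 addr0.
have E1 : is_derive t 1 (fun x : R => expR (Re (x%:C%C * z))) (expR (t * Re z) * Re z).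
  rewrite [X in is_derive _ _ X](_ : _ = fun x => expR (x * Re z)).
    exact: (is_derive_comp' (is_derive_expR _) (L _)).
  by apply/funext => x; rewrite ReM/= mul0r subr0.
have E0 : is_derive t 1 (fun x : R => Im (x%:C%C * z)) (Im z).
  rewrite [X in is_derive _ _ X](_ : _ = fun x => x * Im z); first exact: L.
  by apply/funext => x; rewrite ImM/= mul0r addr0.
have R0 : Re ((t%:C)%C * z) = t * Re z by rewrite ReM/= mul0r subr0.
have I0 : Im ((t%:C)%C * z) = t * Im z by rewrite ImM/= mul0r addr0.
split.
  apply: (is_derive_eq (is_derive_mul' E1 (is_derive_comp' (is_derive_cos _) E0))).
  by rewrite (ReM z (cexp _)) Re_cexp Im_cexp R0 I0; ring.
apply: (is_derive_eq (is_derive_mul' E1 (is_derive_comp' (is_derive_sin _) E0))).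
by rewrite (ImM z (cexp _)) Re_cexp Im_cexp R0 I0; ring.
Qed.

Definition cexp_ser (z : Cplx R) (n : nat) : Cplx R :=
  \sum_(0 <= k < n) ((k`!%:R)^-1%:C)%C * z ^+ k.

Lemma cexp_ser_cder z n t :
  is_cder (fun x => cexp_ser ((x%:C)%C * z) n) t (z * cexp_ser ((t%:C)%C * z) n.-1).
Proof.
case: n => [|n].
  rewrite /cexp_ser/= big_nil mulr0.
  by under eq_fun do rewrite big_nil; exact: is_cder_cst.
elim: n => [|n IH] /=.
  rewrite /cexp_ser big_nil mulr0.
  under eq_fun do rewrite big_nat1.
  exact: is_cder_cst.
rewrite /cexp_ser big_nat_recr//= -/(cexp_ser _ _) mulrDr.
under eq_fun do rewrite big_nat_recr//= -/(cexp_ser _ _).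
apply: is_cderD; first exact: IH.
under eq_fun do rewrite exprMn mulrCA.
have H : is_derive t 1 (fun x : R => x ^+ n.+1) (n.+1%:R * t ^+ n).
  exact: is_derive_exp'.
have -> : (fun x : R => (x%:C)%C ^+ n.+1 * (((n.+1)`!%:R)^-1%:C%C * z ^+ n.+1)) =
   (fun x : R => (((n.+1)`!%:R)^-1%:C%C * z ^+ n.+1) * ((x ^+ n.+1)%:C)%C).
  by apply/funext => x; rewrite rmorphXn mulrC.
apply: is_cder_eq; first exact: (is_cderZ _ (is_cder_real H)).
rewrite factS natrM invfM !rmorphM/= rmorphXn exprMn exprS.
have N0 : (n.+1%:R : R) != 0 by rewrite pnatr_eq0.
transitivity (((n.+1%:R^-1 * n.+1%:R : R)%:C)%C * ((n`!%:R)^-1%:C * (z * z ^+ n) * t%:C ^+ n)%C).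
  by rewrite rmorphM/=; ring.
by rewrite mulVf// mul1r; ring.
Qed.

Lemma expR_ser_le (x : R) n : 0 <= x -> \sum_(0 <= k < n) (k`!%:R)^-1 * x ^+ k <= expR x.
Proof.
move=> x0; have -> : \sum_(0 <= k < n) (k`!%:R)^-1 * x ^+ k = series (exp_coeff x) n.
  by apply: eq_bigr => k _; rewrite /exp_coeff/= mulrC.
have nd : nondecreasing_seq (series (exp_coeff x)).
  by apply: nondecreasing_series => i _ _; rewrite /exp_coeff/= divr_ge0 ?exprn_ge0.
exact: (nondecreasing_cvgn_le nd (is_cvg_series_exp_coeff x) n).
Qed.

Lemma normc_cexp_ser_le z n : normc (cexp_ser z n) <= expR (normc z).
Proof.
rewrite (le_trans (normc_sum _ _ _))// (le_trans _ (expR_ser_le n (normc_ge0 z)))//.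
apply: ler_sum => k _; rewrite Normc.normcM normcX normc_real ger0_norm//.
Qed.

(** Along the segment from 0 to z, the derivative of the n-th partial sum times
    exp (- x z) retains only the top-degree term, which tends to 0 uniformly. *)
Lemma cexp_ser_cvg z : cexp_ser z @ \oo --> cexp z.
Proof.
rewrite -cvg_shiftS; apply/cvg_normc => e e0.
have zE (n : nat) : normc (cexp_ser z n.+1 - cexp z) <=
    2 * expR (normc z) * expR (normc z) * normc z * exp_coeff (normc z) n.
  pose u (x : R) : Cplx R := cexp ((x%:C)%C * - z) * cexp_ser ((x%:C)%C * z) n.+1.
  pose du (x : R) : Cplx R := - z * cexp ((x%:C)%C * - z) *
     (((n`!%:R)^-1%:C)%C * ((x%:C)%C * z) ^+ n).
  have Hu x : is_cder u x (du x).
    apply: is_cder_eq; first exact: (is_cderM (cexp_cder (- z) x) (cexp_ser_cder z n.+1 x)).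
    by rewrite /du /cexp_ser/= big_nat_recr//=; ring.
  have Hle : normc (u 1 - u 0) <=
      2 * (expR (normc z) * normc z * exp_coeff (normc z) n) * (1 - 0).
    apply: (is_cder_le (df := du)) => // x /andP[x0 x1].
    rewrite /du !Normc.normcM normcN normc_cexp normcX Normc.normcM !normc_real.
    rewrite !ger0_norm ?invr_ge0// /exp_coeff/= -!mulrA mulrCA.
    apply: ler_pM; rewrite ?expR_ge0// ?mulr_ge0 ?normc_ge0 ?invr_ge0 ?exprn_ge0 ?mulr_ge0 ?normc_ge0//.
      rewrite ler_expR ReM ReN/= mul0r subr0 mulrN (le_trans (ler_norm _))// normrN normrM.
      rewrite ger0_norm// -[leRHS]mul1r ler_pM// ?normr_Re_le//.
    rewrite ler_wpM2l ?normc_ge0// mulrC ler_wpM2r ?invr_ge0// lerXn2r ?nnegrE ?mulr_ge0 ?normc_ge0//.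
    by rewrite ler_piMl ?normc_ge0.
  rewrite (_ : _ - _ = cexp z * (u 1 - u 0)).
    rewrite Normc.normcM normc_cexp -!mulrA mulrCA.
    apply: ler_pM; rewrite ?expR_ge0 ?normc_ge0//.
      by rewrite ler_expR (le_trans (ler_norm _))// normr_Re_le.
    by move: Hle; rewrite subr0 mulr1 !mulrA.
  rewrite /u !mul1r !mul0r cexp0 mul1r mulrBr mulrA -cexpD subrr cexp0 mul1r.
  congr (_ - _); rewrite /cexp_ser big_nat_recl//= big1 ?addr0; last first.
    by move=> i _; rewrite exprS mul0r mulr0.
  by rewrite expr0 invr1 mulr1 mulr1.
pose K := 2 * expR (normc z) * expR (normc z) * normc z.
have : K * exp_coeff (normc z) n @[n --> \oo] --> 0.
  by rewrite -(mulr0 K); apply: cvgMr; exact: cvg_exp_coeff.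
move=> /cvgrPdist_lt/(_ e e0); apply: filterS => n.
rewrite sub0r normrN; apply: le_lt_trans.
by rewrite (le_trans (zE n))// ler_norm.
Qed.

End ComplexDerive.
Arguments cexp {R} z : simpl never.
Arguments Normc.normc {R} x : simpl never.

(** * Integrals of complex-valued functions *)

Section ComplexIntegral.
Context d (T : measurableType d) (R : realType) (mu : {measure set T -> \bar R}).
Variables (D : set T) (mD : measurable D).
Implicit Types f g : T -> Cplx R.
Notation normc := (@Normc.normc R).
Notation Re := (@complex.Re R).
Notation Im := (@complex.Im R).

Definition cmeas f := measurable_fun D (fun x => Re (f x)) /\
                      measurable_fun D (fun x => Im (f x)).

Definition cintble f := mu.-integrable D (fun x => (Re (f x))%:E) /\
                        mu.-integrable D (fun x => (Im (f x))%:E).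

Definition cint f : Cplx R :=
  ((Rintegral mu D (fun x => Re (f x))) +i* (Rintegral mu D (fun x => Im (f x))))%C.

Lemma cmeas_cst (c : Cplx R) : cmeas (fun=> c).
Proof. by split; exact: measurable_cst. Qed.

Lemma cmeasD f g : cmeas f -> cmeas g -> cmeas (fun x => f x + g x).
Proof.
move=> [f1 f2] [g1 g2]; split.
  rewrite (_ : (fun x => _) = (fun x => Re (f x)) \+ (fun x => Re (g x))).
    exact: measurable_funD.
  by apply/funext => x; rewrite ReD.
rewrite (_ : (fun x => _) = (fun x => Im (f x)) \+ (fun x => Im (g x))).
  exact: measurable_funD.
by apply/funext => x; rewrite ImD.
Qed.

Lemma cmeasM f g : cmeas f -> cmeas g -> cmeas (fun x => f x * g x).
Proof.
move=> [f1 f2] [g1 g2]; split.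
  rewrite (_ : (fun x => _) = ((fun x => Re (f x)) \* (fun x => Re (g x))) \-
     ((fun x => Im (f x)) \* (fun x => Im (g x)))).
    by apply: measurable_funB; apply: measurable_funM.
  by apply/funext => x; rewrite ReM.
rewrite (_ : (fun x => _) = ((fun x => Re (f x)) \* (fun x => Im (g x))) \+
     ((fun x => Im (f x)) \* (fun x => Re (g x)))).
  by apply: measurable_funD; apply: measurable_funM.
by apply/funext => x; rewrite ImM.
Qed.

Lemma cmeas_real (h : T -> R) : measurable_fun D h -> cmeas (fun x => (h x)%:C%C).
Proof. by move=> mh; split => //=; exact: measurable_cst. Qed.

Lemma cmeas_sum f (F : nat -> T -> Cplx R) n : (forall k, cmeas (F k)) ->
  cmeas (fun x => \sum_(0 <= k < n) F k x).
Proof.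
move=> mF; elim: n => [|n IH].
  by under eq_fun do rewrite big_nil; exact: cmeas_cst.
by under eq_fun do rewrite big_nat_recr//=; exact: cmeasD.
Qed.

Lemma le_integrable_real (h g : T -> R) : measurable_fun D h ->
  mu.-integrable D (EFin \o g) -> (forall x, D x -> `|h x| <= g x) ->
  mu.-integrable D (fun x => (h x)%:E).
Proof.
move=> mh ig hg; apply: (le_integrable mD _ _ ig).
  exact/measurable_EFinP.
by move=> x Dx /=; rewrite lee_fin (le_trans (hg x Dx))// ler_norm.
Qed.

Lemma cintble_le f (g : T -> R) : cmeas f -> mu.-integrable D (EFin \o g) ->
  (forall x, D x -> normc (f x) <= g x) -> cintble f.
Proof.
move=> [mf1 mf2] ig fg; split; apply: (le_integrable_real _ ig) => // x Dx.
- by rewrite (le_trans (normr_Re_le _))// fg.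
- by rewrite (le_trans (normr_Im_le _))// fg.
Qed.

Lemma cintble_cmeas f : cintble f -> cmeas f.
Proof.
by move=> [/measurable_int/measurable_EFinP ? /measurable_int/measurable_EFinP ?]; split.
Qed.

Lemma cintble_norm f : cintble f -> mu.-integrable D (fun x => (normc (f x))%:E).
Proof.
move=> [f1 f2].
have : mu.-integrable D (fun x => (`|Re (f x)| + `|Im (f x)|)%:E).
  apply: (eq_integrable mD ((fun x => `|(Re (f x))%:E|) \+ (fun x => `|(Im (f x))%:E|))%E).
    by [].
  by apply: integrableD => //; exact: integrable_abse.
have [m1 m2] := cintble_cmeas (conj f1 f2).
apply: le_integrable => //=.
  apply/measurable_EFinP.
  rewrite (_ : (fun x => _) = Num.sqrt \o ((fun x => Re (f x) ^+ 2 + Im (f x) ^+ 2))).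
    apply: measurableT_comp; first by apply: continuous_measurable_fun; exact: sqrt_continuous.
    by apply: measurable_funD; exact: measurable_funX.
  by apply/funext => x /=; case: (f x).
move=> x Dx; rewrite lee_fin ger0_norm ?normc_ge0// ger0_norm ?addr_ge0//.
exact: normc_le_ReIm.
Qed.

Lemma eq_cint f g : (forall x, D x -> f x = g x) -> cint f = cint g.
Proof.
move=> fg; rewrite /cint; congr (_ +i* _)%C; apply: eq_Rintegral => x;
  by rewrite inE => /fg ->.
Qed.

Lemma eq_cintble f g : (forall x, D x -> f x = g x) -> cintble f -> cintble g.
Proof.
move=> fg [f1 f2]; split.
  by apply: (eq_integrable mD _ _ _ f1) => x; rewrite inE => /fg ->.
by apply: (eq_integrable mD _ _ _ f2) => x; rewrite inE => /fg ->.
Qed.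

Lemma cintbleD f g : cintble f -> cintble g -> cintble (fun x => f x + g x).
Proof.
move=> [f1 f2] [g1 g2]; split.
  apply: (eq_integrable mD _ _ _ (integrableD mD f1 g1)) => x _ /=.
  by rewrite ReD.
apply: (eq_integrable mD _ _ _ (integrableD mD f2 g2)) => x _ /=.
by rewrite ImD.
Qed.

Lemma cintD f g : cintble f -> cintble g ->
  cint (fun x => f x + g x) = cint f + cint g.
Proof.
move=> [f1 f2] [g1 g2]; apply/eqP; rewrite eq_complex /=; apply/andP; split; apply/eqP.
  rewrite -RintegralD//; apply: eq_Rintegral => x _; by rewrite ReD.
rewrite -RintegralD//; apply: eq_Rintegral => x _; by rewrite ImD.
Qed.

Lemma cintbleZ (c : Cplx R) f : cintble f -> cintble (fun x => c * f x).
Proof.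
move=> [f1 f2]; split.
  apply: (eq_integrable mD _ _ _ (integrableB mD (integrableZl mD (Re c) f1) (integrableZl mD (Im c) f2))) => x _ /=.
  by rewrite ReM.
apply: (eq_integrable mD _ _ _ (integrableD mD (integrableZl mD (Re c) f2) (integrableZl mD (Im c) f1))) => x _ /=.
by rewrite ImM.
Qed.

Lemma cintZ (c : Cplx R) f : cintble f -> cint (fun x => c * f x) = c * cint f.
Proof.
move=> [f1 f2]; apply/eqP; rewrite eq_complex ReM ImM; apply/andP; split; apply/eqP.
  rewrite /= -!RintegralZl// -RintegralB//; last 2 first.
    exact: (integrableZl mD (Re c) f1).
    exact: (integrableZl mD (Im c) f2).
  by apply: eq_Rintegral => x _; rewrite ReM.
rewrite /= -!RintegralZl// -RintegralD//; last 2 first.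
  exact: (integrableZl mD (Re c) f2).
  exact: (integrableZl mD (Im c) f1).
by apply: eq_Rintegral => x _; rewrite ImM.
Qed.

Lemma cint0 : cint (fun=> 0) = 0.
Proof.
by rewrite /cint /Rintegral/= !integral0.
Qed.

Lemma cint_sum (F : nat -> T -> Cplx R) n : (forall k, cintble (F k)) ->
  cintble (fun x => \sum_(0 <= k < n) F k x) /\
  cint (fun x => \sum_(0 <= k < n) F k x) = \sum_(0 <= k < n) cint (F k).
Proof.
move=> iF; elim: n => [|n [IH1 IH2]].
  under [X in cintble X]eq_fun do rewrite big_nil.
  under [X in cint X]eq_fun do rewrite big_nil.
  rewrite big_nil cint0; split => //.
  by split; exact: integrable0.
under [X in cintble X]eq_fun do rewrite big_nat_recr//=.
under [X in cint X]eq_fun do rewrite big_nat_recr//=.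
by rewrite big_nat_recr//= -IH2 cintD//; split=> //; exact: cintbleD.
Qed.

(** Dominated convergence, by components: the majorant of the modulus is one of
    the real and of the imaginary part. *)
Lemma cint_dct (F : nat -> T -> Cplx R) f (g : T -> R) :
  (forall n, cmeas (F n)) -> cmeas f ->
  (forall x, D x -> F ^~ x @ \oo --> f x) ->
  mu.-integrable D (EFin \o g) ->
  (forall n x, D x -> normc (F n x) <= g x) ->
  cintble f /\ (fun n => cint (F n)) @ \oo --> cint f.
Proof.
move=> mF mf Ff ig Fg.
have key (h : nat -> T -> R) (h0 : T -> R) : (forall n, measurable_fun D (h n)) ->
  measurable_fun D h0 -> (forall x, D x -> h n x @[n --> \oo] --> h0 x) ->
  (forall n x, D x -> `|h n x| <= g x) ->
  mu.-integrable D (EFin \o h0) /\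
  Rintegral mu D (h n) @[n --> \oo] --> Rintegral mu D h0.
  move=> mh mh0 hh hg.
  have [ih0 _ H] : [/\ mu.-integrable D (EFin \o h0),
    [sequence \int[mu]_(x in D) `|(EFin \o h n) x - (EFin \o h0) x|]_n @ \oo --> 0 &
    [sequence \int[mu]_(x in D) ((EFin \o h n) x)]_n @ \oo --> \int[mu]_(x in D) ((EFin \o h0) x)]%E.
    apply: (dominated_convergence mD _ _ _ ig).
    - by move=> n; exact/measurable_EFinP.
    - exact/measurable_EFinP.
    - apply: aeW => x Dx; apply: cvg_EFin; first exact: nearW.
      exact: hh.
    - by apply: aeW => x n Dx /=; rewrite lee_fin; exact: hg.
  split=> //.
  have ih n : mu.-integrable D (EFin \o h n).
    by apply: le_integrable_real ig _ => // x Dx; exact: hg.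
  have -> : (fun n => Rintegral mu D (h n)) =
      fine \o (fun n => \int[mu]_(x in D) ((EFin \o h n) x))%E by [].
  apply: fine_cvg.
  by rewrite fineK//; exact: integrable_fin_num.
have [||||i1 c1] := key (fun n x => Re (F n x)) (fun x => Re (f x)).
- by move=> n; case: (mF n).
- by case: mf.
- move=> x Dx; apply/cvgrPdist_lt => e e0.
  have /cvg_normc/(_ e e0) := Ff x Dx; apply: filterS => n.
  by apply: le_lt_trans; rewrite normcB -ReB' normr_Re_le.
- by move=> n x Dx; rewrite (le_trans (normr_Re_le _))// Fg.
have [||||i2 c2] := key (fun n x => Im (F n x)) (fun x => Im (f x)).
- by move=> n; case: (mF n).
- by case: mf.
- move=> x Dx; apply/cvgrPdist_lt => e e0.
  have /cvg_normc/(_ e e0) := Ff x Dx; apply: filterS => n.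
  by apply: le_lt_trans; rewrite normcB -ImB' normr_Im_le.
- by move=> n x Dx; rewrite (le_trans (normr_Im_le _))// Fg.
split=> //; exact: cvg_Cplx.
Qed.

End ComplexIntegral.

(** * Complex powers and improper integrals *)

Section PowerFunctions.
Variable R : realType.
Implicit Types (w v : Cplx R) (t x : R).
Notation normc := (@Normc.normc R).
Notation Re := (@complex.Re R).
Notation Im := (@complex.Im R).

(** The power t^w as a function of t for fixed w; in this form the addition law
    and the derivative come directly from those of the exponential. *)
Definition tpow w t : Cplx R := cexp ((ln t)%:C%C * w).

Lemma tpow0 t : tpow 0 t = 1.
Proof. by rewrite /tpow mulr0 cexp0. Qed.

Lemma tpowD w v t : tpow (w + v) t = tpow w t * tpow v t.
Proof. by rewrite /tpow mulrDr cexpD. Qed.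

Lemma tpow1 w : tpow w 1 = 1.
Proof. by rewrite /tpow ln1 mul0r cexp0. Qed.

Lemma tpowNK w t : tpow w t * tpow (- w) t = 1.
Proof. by rewrite -tpowD subrr tpow0. Qed.

Lemma tpow_neq0 w t : tpow w t != 0.
Proof.
apply/eqP => H; have := tpowNK w t; rewrite H mul0r => /eqP.
by rewrite eq_sym oner_eq0.
Qed.

Lemma tpowN w t : tpow (- w) t = (tpow w t)^-1.
Proof. by apply: (mulfI (tpow_neq0 w t)); rewrite tpowNK mulfV// tpow_neq0. Qed.

Lemma powR_expR t x : 0 < t -> t `^ x = expR (x * ln t).
Proof. by move=> t0; rewrite /powR gt_eqF. Qed.

Lemma normc_tpow w t : 0 < t -> normc (tpow w t) = t `^ Re w.
Proof.
by move=> t0; rewrite normc_cexp ReM/= mul0r subr0 powR_expR// mulrC.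
Qed.

Lemma tpow_real x t : 0 < t -> tpow (x%:C)%C t = (t `^ x)%:C%C.
Proof.
move=> t0; rewrite /tpow /cexp ReM ImM/= !mul0r mulr0 subr0 addr0 cos0 sin0.
by rewrite mulr1 mulr0 powR_expR// mulrC.
Qed.

Lemma tpow_cpow w t : 0 < t -> cpow t w = tpow w t.
Proof.
move=> t0; rewrite /tpow /cexp /cpow ReM ImM/= !mul0r subr0 addr0.
by rewrite powR_expR// (mulrC (Re w)) (mulrC (Im w)).
Qed.

Lemma tpow_cder w t : 0 < t -> is_cder (tpow w) t (w * tpow (w - 1) t).
Proof.
move=> t0; have Hl : is_derive t 1 (@ln R) t^-1 by exact: is_derive1_ln.
apply: is_cder_eq; first exact: (is_cder_comp (cexp_cder w (ln t)) Hl).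
rewrite -/(tpow w t) tpowD -mulrA; congr (_ * (_ * _)).
rewrite (_ : -1 = ((-1 : R)%:C)%C :> Cplx R); last by rewrite rmorphN1.
by rewrite tpow_real// powR_inv1// ltW.
Qed.

Lemma cmeas_tpow w (D : set (measurableTypeR R)) : measurable D -> cmeas D (tpow w).
Proof.
move=> mD.
have ml : measurable_fun D (@ln R) by apply: measurable_funTS; exact: measurable_ln.
rewrite /cmeas; split.
  rewrite (_ : (fun x => _) = (fun t => expR (ln t * Re w) * cos (ln t * Im w))).
    apply: measurable_funM.
      apply: measurableT_comp => //; apply: measurable_funM => //.
    apply: measurableT_comp; first by apply: continuous_measurable_fun; exact: continuous_cos.
    exact: measurable_funM.
  by apply/funext => t; rewrite /tpow Re_cexp ReM ImM/= !mul0r subr0 addr0.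
rewrite (_ : (fun x => _) = (fun t => expR (ln t * Re w) * sin (ln t * Im w))).
  apply: measurable_funM.
    apply: measurableT_comp => //; apply: measurable_funM => //.
  apply: measurableT_comp; first by apply: continuous_measurable_fun; exact: continuous_sin.
  exact: measurable_funM.
by apply/funext => t; rewrite /tpow Im_cexp ReM ImM/= !mul0r subr0 addr0.
Qed.

Lemma powRS t x : 0 < t -> t `^ (x + 1) = t * t `^ x.
Proof.
move=> t0; rewrite powRD; last by rewrite (gt_eqF t0) implybT.
by rewrite powRr1 ?(ltW t0)// mulrC.
Qed.

Lemma is_derive_powR x t : 0 < t -> is_derive t 1 (fun u => u `^ x) (x * t `^ (x - 1)).
Proof. by move=> t0; exact: (is_derive1_powR x t0). Qed.

End PowerFunctions.
Arguments tpow {R} w t : simpl never.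

Section Improper.
Variable R : realType.
Notation mu := (@lebesgue_measure R).
Notation normc := (@Normc.normc R).
Notation Re := (@complex.Re R).
Notation Im := (@complex.Im R).

(** Increasing compact intervals filling D, so that one lemma covers improper
    integrals both at infinity and at 0. *)
Definition exhausts (D : set R) (a b : nat -> R) :=
  [/\ measurable (D : set (measurableTypeR R)),
      forall n, 0 < a n < b n,
      forall n, `[a n, b n]%classic `<=` D,
      forall n, a n.+1 <= a n /\ b n <= b n.+1 &
      forall t, D t -> exists n, a n <= t <= b n].

Lemma exhausts_ray (c : R) : 0 < c ->
  exhausts [set t | c <= t] (fun=> c) (fun n => c + n.+1%:R).
Proof.
move=> c0; split.
- by rewrite -set_itvcy; exact: measurable_itv.
- by move=> n; rewrite c0 ltrDl ltr0n.
- by move=> n t /=; rewrite in_itv/= => /andP[].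
- by move=> n; split=> //; rewrite lerD2l ler_nat.
- move=> t /= ct; exists (Num.truncn t); rewrite ct/=.
  by have /ltW H := truncnS_gt t; rewrite (le_trans H)// lerDr ltW.
Qed.

Lemma exhausts_unit :
  exhausts [set t : R | 0 < t <= 1] (fun n => (n.+2%:R)^-1) (fun=> 1).
Proof.
split.
- rewrite (_ : [set t | _] = `]0, 1]%classic); first exact: measurable_itv.
  by apply/seteqP; split=> t /=; rewrite in_itv.
- by move=> n; rewrite invr_gt0 ltr0n/= invf_lt1 ?ltr1n ?ltr0n.
- move=> n t /=; rewrite in_itv/= => /andP[nt ->]; rewrite andbT.
  by apply: lt_le_trans nt; rewrite invr_gt0 ltr0n.
- by move=> n; split=> //; rewrite lef_pV2 ?posrE ?ltr0n// ler_nat.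
- move=> t /= /andP[t0 t1]; exists (Num.truncn t^-1); rewrite t1 andbT.
  rewrite -[leRHS]invrK lef_pV2 ?posrE ?ltr0n ?invr_gt0//.
  by rewrite (le_trans (ltW (truncnS_gt t^-1)))// ler_nat.
Qed.

Lemma FTC2_pos (f F : R -> R) (a b : R) : 0 < a -> a < b ->
  (forall t : R, 0 < t -> {for t, continuous f}) ->
  (forall t : R, 0 < t -> is_derive t 1 F (f t)) ->
  (\int[mu]_(x in `[a, b]) (f x)%:E = (F b - F a)%:E)%E.
Proof.
move=> a0 ab cf dF; rewrite EFinB; apply: continuous_FTC2 => //.
- apply: continuous_in_subspaceT => t; rewrite inE/= in_itv/= => /andP[at_ _].
  by apply: cf; exact: lt_le_trans at_.
- have cF t : 0 < t -> {for t, continuous F}.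
    by move=> t0; exact: is_derive_continuous (dF t t0).
  split.
  + move=> t; rewrite in_itv/= => /andP[at_ _].
    by case: (dF t (lt_trans a0 at_)).
  + by apply: cvg_at_right_filter; apply: cF.
  + by apply: cvg_at_left_filter; apply: cF; exact: lt_trans ab.
- move=> t; rewrite in_itv/= => /andP[at_ _].
  rewrite derive1E; have [_ H] := dF t (lt_trans a0 at_); exact: H.
Qed.

Lemma exhausts_bigcup D a b : exhausts D a b ->
  D = \bigcup_n `[a n, b n]%classic.
Proof.
move=> [_ _ sD _ cD]; apply/seteqP; split=> [t /cD[n tn]|t [n _]]; last exact: sD.
by exists n => //=; rewrite in_itv.
Qed.

Lemma exhausts_ndecr D a b : exhausts D a b ->
  nondecreasing_seq (fun n => `[a n, b n]%classic : set R).
Proof.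
move=> [_ _ _ mab _]; apply/nondecreasing_seqP => n; rewrite subsetEset.
apply: subset_itv; rewrite bnd_simp; by case: (mab n).
Qed.

(** Monotone convergence of the integrals over the compact pieces, which the
    fundamental theorem of calculus evaluates. *)
Lemma improper_integrable D a b (f F : R -> R) (M : R) : exhausts D a b ->
  measurable_fun (D : set (measurableTypeR R)) f ->
  (forall t : R, 0 < t -> {for t, continuous f}) ->
  (forall t : R, 0 < t -> is_derive t 1 F (f t)) ->
  (forall t, D t -> 0 <= f t) ->
  (forall n, F (b n) - F (a n) <= M) ->
  mu.-integrable D (EFin \o f).
Proof.
move=> ex mf cf dF f0 FM; have [mD ab sD _ _] := ex.
apply/integrableP; split; first exact/measurable_EFinP.
apply: (@le_lt_trans _ _ M%:E); last exact: ltry.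
have cv := @ge0_nondecreasing_set_cvg_integral _ (measurableTypeR R) R (fun n => `[a n, b n]%classic)
  (fun x => `|(f x)%:E|%E) mu (exhausts_ndecr ex) _ _ _.
move: cv; rewrite -(exhausts_bigcup ex) => cv.
have -> : (\int[mu]_(x in D) `|(EFin \o f) x|)%E =
   limn (fun n => (\int[mu]_(x in `[a n, b n]) `|(EFin \o f) x|)%E).
  apply/esym/cvg_lim => //; apply: cv.
  - by move=> n; exact: measurable_itv.
  - move=> n; apply: measurableT_comp => //; apply/measurable_EFinP.
    exact: measurable_funS mf.
  - by move=> n x _; exact: abse_ge0.
apply: lime_le; first by apply: (cvgP _ (cv _ _ _));
  [by move=> n; exact: measurable_itv|
   by move=> n; apply: measurableT_comp => //; apply/measurable_EFinP; exact: measurable_funS mf|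
   by move=> n x _; exact: abse_ge0].
apply: nearW => n; have /andP[a0 anb] := ab n.
have -> : (\int[mu]_(x in `[a n, b n]) `|(EFin \o f) x|)%E = (F (b n) - F (a n))%:E.
  rewrite -(FTC2_pos (F := F) a0 anb cf dF); apply: eq_integral => x.
  by rewrite inE => /sD/f0 fx /=; rewrite ger0_norm.
by rewrite lee_fin.
Qed.

(** Dominated convergence over the compact pieces, with the modulus of f as
    majorant. *)
Lemma improper_cint D a b (f F : R -> Cplx R) (L : Cplx R) : exhausts D a b ->
  (forall t : R, 0 < t -> {for t, continuous (fun x => Re (f x))} /\
                      {for t, continuous (fun x => Im (f x))}) ->
  (forall t : R, 0 < t -> is_cder F t (f t)) ->
  cintble mu D f ->
  (fun n => F (b n) - F (a n)) @ \oo --> L ->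
  cint mu D f = L.
Proof.
move=> ex cf dF if_ FL; have [mD ab sD mab cD] := ex.
have [mf1 mf2] := cintble_cmeas if_.
pose I n : set R := `[a n, b n]%classic.
pose g n t : Cplx R := f t * ((\1_(I n) t : R)%:C)%C.
have mI n : measurable_fun (D : set (measurableTypeR R)) (fun x => \1_(I n) x : R).
  by apply: measurable_funTS; apply: measurable_indic; exact: measurable_itv.
have [] := @cint_dct _ _ R mu D mD g f (fun t => normc (f t)).
- by move=> n; apply: cmeasM => //; exact: cmeas_real.
- by [].
- move=> t Dt; have [n0 tn] := cD t Dt.
  apply/cvg_normc => e e0; exists n0 => // n /= n0n.
  rewrite /g indicE mem_set ?mulr1 ?subrr ?Normc.normc0//.
  have : (I n0 `<=` I n) by rewrite -subsetEset; apply: (exhausts_ndecr ex).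
  by apply; rewrite /I/= in_itv.
- exact: cintble_norm.
- move=> n t Dt; rewrite /g Normc.normcM normc_real indicE.
  by case: (_ \in _); rewrite /= ?normr1 ?normr0 ?mulr1// mulr0 normc_ge0.
move=> _; suff -> : (fun n => cint mu D (g n)) = (fun n => F (b n) - F (a n)).
  by move=> H; exact: cvg_uniquec H FL.
apply/funext => n; have /andP[a0 anb] := ab n.
have key (h : R -> R) (H : R -> R) : (forall t : R, 0 < t -> {for t, continuous h}) ->
    (forall t : R, 0 < t -> is_derive t 1 H (h t)) ->
    Rintegral mu D (fun t => h t * \1_(I n) t) = H (b n) - H (a n).
  move=> ch dH; rewrite -[RHS]/(fine (H (b n) - H (a n))%:E) -(FTC2_pos a0 anb ch dH) /Rintegral.
  congr fine; rewrite -(setIidr (sD n)) integral_mkcondr; apply: eq_integral => t _.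
  rewrite patchE indicE -/(I n); case: (t \in I n); first by rewrite mulr1.
  by rewrite mulr0.
apply/eqP; rewrite eq_complex ReB' ImB'/=; apply/andP; split; apply/eqP.
  transitivity (Rintegral mu D (fun t => Re (f t) * \1_(I n) t)).
    by apply: eq_Rintegral => t _; rewrite /g ReM/= mulr0 subr0.
  by apply: (key (fun t => Re (f t)) (fun t => Re (F t))) => t; [move=> /cf[]|move=> /dF[]].
transitivity (Rintegral mu D (fun t => Im (f t) * \1_(I n) t)).
  by apply: eq_Rintegral => t _; rewrite /g ImM/= mulr0 add0r.
by apply: (key (fun t => Im (f t)) (fun t => Im (F t))) => t; [move=> /cf[]|move=> /dF[]].
Qed.

End Improper.

(** * Integrals of powers and Mellin transforms *)

Section PowerIntegrals.
Variable R : realType.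
Notation mu := (@lebesgue_measure R).
Notation normc := (@Normc.normc R).
Notation Re := (@complex.Re R).
Notation Im := (@complex.Im R).
Local Notation ray1 := ([set t : R | 1 <= t] : set (measurableTypeR R)).
Local Notation unit01 := ([set t : R | 0 < t <= 1] : set (measurableTypeR R)).

Lemma cvg_powR_nat0 (u : nat -> R) (x : R) : x < 0 ->
  (forall n, n%:R <= u n) -> u n `^ x @[n --> \oo] --> 0.
Proof.
move=> x0 Hu; apply/cvgrPdist_lt => e e0.
pose A := (e / 2) `^ (x^-1).
have A0 : 0 < A by rewrite powR_gt0// divr_gt0.
exists (Num.truncn A).+1 => // n /= nA.
have An : A <= u n.
  rewrite (le_trans _ (Hu n))// (le_trans (ltW (truncnS_gt A)))// ler_nat.
  exact: nA.
rewrite sub0r normrN ger0_norm ?powR_ge0//.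
have u0 : 0 < u n by exact: lt_le_trans An.
apply: (@le_lt_trans _ _ (A `^ x)).
  have E z : z `^ x = (z `^ - x)^-1 by rewrite -powRN opprK.
  rewrite (E (u n)) (E A) lef_pV2 ?posrE ?powR_gt0 ?divr_gt0//.
  by apply: ge0_ler_powR; rewrite ?nnegrE ?(ltW A0) ?(ltW u0)// oppr_ge0 ltW.
rewrite /A -powRrM mulVf ?lt_eqF// powRr1; last by rewrite ltW// divr_gt0.
by rewrite ltr_pdivrMr// ltr_pMr// ltr1n.
Qed.

Lemma rayc_powR_integrable (c x : R) : 0 < c -> x < -1 ->
  mu.-integrable ([set t : R | c <= t] : set (measurableTypeR R)) (fun t => (t `^ x)%:E).
Proof.
move=> c0 x1; have x0 : x + 1 < 0 by rewrite -ltrBrDr sub0r.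
have ex := exhausts_ray c0; have [mD _ _ _ _] := ex.
have cf (t : R) : 0 < t -> {for t, continuous (fun u : R => u `^ x)}.
  by move=> t0; exact: is_derive_continuous (is_derive_powR x t0).
have dF (t : R) : 0 < t -> is_derive t 1 (fun u => (x + 1)^-1 * u `^ (x + 1)) (t `^ x).
  move=> t0; apply: (is_derive_eq (is_derive_mul' (is_derive_cst' _ _) (is_derive_powR _ t0))).
  by rewrite mul0r add0r addrK mulrA mulVf ?mul1r// lt_eqF.
apply: (improper_integrable (M := - ((x + 1)^-1 * c `^ (x + 1))) ex _ cf dF).
- by apply: measurable_funTS; exact: measurable_powR.
- by move=> t _; exact: powR_ge0.
- move=> n /=; rewrite gerDr.
  by rewrite nmulr_rle0 ?powR_ge0// invr_lt0.
Qed.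

Lemma ray_powR_integrable (x : R) : x < -1 ->
  mu.-integrable ray1 (fun t => (t `^ x)%:E).
Proof. exact: rayc_powR_integrable. Qed.

Lemma unit_powR_integrable (x : R) : -1 < x ->
  mu.-integrable unit01 (fun t => (t `^ x)%:E).
Proof.
move=> x1; have x0 : 0 < x + 1 by rewrite -ltrBlDr sub0r.
have ex := exhausts_unit R; have [mD _ _ _ _] := ex.
have cf (t : R) : 0 < t -> {for t, continuous (fun u : R => u `^ x)}.
  by move=> t0; exact: is_derive_continuous (is_derive_powR x t0).
have dF (t : R) : 0 < t -> is_derive t 1 (fun u => (x + 1)^-1 * u `^ (x + 1)) (t `^ x).
  move=> t0; apply: (is_derive_eq (is_derive_mul' (is_derive_cst' _ _) (is_derive_powR _ t0))).
  by rewrite mul0r add0r addrK mulrA mulVf ?mul1r// gt_eqF.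
apply: (improper_integrable (M := (x + 1)^-1) ex _ cf dF).
- by apply: measurable_funTS; exact: measurable_powR.
- by move=> t _; exact: powR_ge0.
- move=> n /=; rewrite powR1 mulr1 gerBl.
  by rewrite pmulr_rge0 ?powR_ge0// invr_gt0.
Qed.

Lemma tpow_continuous (w : Cplx R) (t : R) : 0 < t ->
  {for t, continuous (fun x => Re (tpow w x))} /\
  {for t, continuous (fun x => Im (tpow w x))}.
Proof.
move=> /(tpow_cder w)[d1 d2].
split; [exact: is_derive_continuous d1|exact: is_derive_continuous d2].
Qed.

Lemma tpow_primitive (w : Cplx R) (t : R) : w + 1 != 0 -> 0 < t ->
  is_cder (fun x => (w + 1)^-1 * tpow (w + 1) x) t (tpow w t).
Proof.
move=> w0 t0; apply: is_cder_eq; first exact: (is_cderZ _ (tpow_cder (w + 1) t0)).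
by rewrite mulrA mulVf// mul1r addrK.
Qed.

Lemma Re_add1 (w : Cplx R) : Re (w + 1) = Re w + 1.
Proof. by rewrite ReD. Qed.

Lemma ray_tpow (w : Cplx R) : Re w < -1 ->
  cintble mu ray1 (tpow w) /\
  cint mu ray1 (tpow w) = - (w + 1)^-1.
Proof.
move=> w1; have ex := exhausts_ray (ltr01 : 0 < 1 :> R); have [mD _ _ _ _] := ex.
have wp0 : w + 1 != 0.
  apply: contraTneq w1 => /(congr1 Re); rewrite Re_add1/= => H.
  by rewrite -leNgt; lra.
have iw : cintble mu ray1 (tpow w).
  apply: (cintble_le mD (cmeas_tpow w mD) (ray_powR_integrable w1)) => t /= t1.
  by rewrite normc_tpow// (lt_le_trans ltr01).
split=> //; apply: (improper_cint ex (tpow_continuous w) _ iw).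
  by move=> t t0; exact: tpow_primitive.
rewrite -[X in _ --> X]add0r; apply: cvgDc; last first.
  by rewrite tpow1 mulr1; exact: cvg_cst.
rewrite -(mulr0 (w + 1)^-1); apply: cvgMrc; apply/cvg_normc => e e0.
have := @cvg_powR_nat0 (fun n => 1 + n.+1%:R) (Re w + 1) _ _.
move=> /(_ _ _)/cvgrPdist_lt/(_ e e0) H.
have [||N _ HN] := H; [by lra|by move=> n; rewrite -natr1 addrCA lerDl|].
exists N => // n /HN; rewrite sub0r normrN subr0 normc_tpow// ger0_norm ?powR_ge0//.
by rewrite Re_add1.
Qed.

Lemma unit_tpow (w : Cplx R) : -1 < Re w ->
  cintble mu unit01 (tpow w) /\
  cint mu unit01 (tpow w) = (w + 1)^-1.
Proof.
move=> w1; have ex := exhausts_unit R; have [mD _ _ _ _] := ex.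
have wp0 : w + 1 != 0.
  apply: contraTneq w1 => /(congr1 Re); rewrite Re_add1/= => H.
  by rewrite -leNgt; lra.
have iw : cintble mu unit01 (tpow w).
  apply: (cintble_le mD (cmeas_tpow w mD) (unit_powR_integrable w1)) => t /= /andP[t0 t1].
  by rewrite normc_tpow.
split=> //; apply: (improper_cint ex (tpow_continuous w) _ iw).
  by move=> t t0; exact: tpow_primitive.
rewrite -[X in _ --> X]addr0; apply: cvgDc.
  by rewrite tpow1 mulr1; exact: cvg_cst.
rewrite -oppr0 -{1}(mulr0 (w + 1)^-1) -mulrN.
under eq_fun do rewrite -mulrN.
apply: cvgMrc; apply/cvg_normc => e e0.
have := @cvg_powR_nat0 (fun n => n.+2%:R) (- (Re w + 1)) _ _.
move=> /(_ _ _)/cvgrPdist_lt/(_ e e0) H.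
have [||N _ HN] := H; [by lra|by move=> n; rewrite ler_nat; lia|].
exists N => // n /HN; rewrite sub0r normrN oppr0 subr0 normcN normc_tpow; last first.
  by rewrite invr_gt0 ltr0n.
rewrite ger0_norm ?powR_ge0// Re_add1 powRN.
rewrite -[in X in _ -> X]powR_inv1// -powRrM mulN1r powRN.
by [].
Qed.

(** The factor t^(- (s - s0)/2) is expanded in powers of s - s0 and integrated
    term by term. Its exponential series is dominated by t^(|s - s0|/2), so this
    is legitimate as long as the integrand at s0 can spare that power, that is,
    within the distance of s0 to the boundary of convergence. *)
Lemma mellin_analytic (V : R -> R) (C y : R) (b s0 : Cplx R) :
  measurable_fun ray1 V ->
  (forall t, 1 <= t -> `|V t| <= C * t `^ y) ->
  y + Re b - Re s0 / 2 < -1 ->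
  analytic_at (fun s => cint mu ray1
     (fun t => (V t)%:C%C * tpow (b - s / 2) t)) s0.
Proof.
move=> mV VC yb.
have [mD _ _ _ _] := exhausts_ray (ltr01 : 0 < 1 :> R).
(* The margin: at s0 the integrand is O(t^(-1 - dl)). *)
pose dl := - 1 - (y + Re b - Re s0 / 2).
have dl0 : 0 < dl by rewrite /dl; lra.
have C0 : 0 <= C.
  by have := VC 1 (lexx 1); rewrite powR1 mulr1; apply: le_trans.
pose h t : Cplx R := (V t)%:C%C * tpow (b - s0 / 2) t.
have Re2 (s : Cplx R) : Re (s / 2) = Re s / 2.
  rewrite (_ : (2 : Cplx R)^-1 = ((2^-1 : R)%:C)%C); first by rewrite ReM/= mulr0 subr0.
  by rewrite fmorphV rmorph_nat.
have hle (t : R) : 1 <= t -> normc (h t) <= C * t `^ (- 1 - dl).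
  move=> t1; have t0 : 0 < t by exact: lt_le_trans t1.
  rewrite /h Normc.normcM normc_real normc_tpow// ReB' Re2.
  rewrite (_ : - 1 - dl = y + (Re b - Re s0 / 2)); last by rewrite /dl; ring.
  rewrite [t `^ (y + _)]powRD; last by rewrite (gt_eqF t0) implybT.
  by rewrite mulrA ler_wpM2r ?powR_ge0// VC.
have mh : cmeas ray1 h.
  by apply: cmeasM; [exact: cmeas_real|exact: cmeas_tpow].
have ml : measurable_fun ray1 (@ln R).
  by apply: measurable_funTS; exact: measurable_ln.
(* The power t^(-z/2) is the exponential of L t * z. *)
pose L t : R := - (ln t / 2).
have mL : measurable_fun ray1 L.
  rewrite (_ : L = (@ln R) \* (fun=> - 2^-1)); first exact: measurable_funM.
  by apply/funext => t; rewrite /L/= mulrN.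
have mLX k : cmeas ray1
    (fun t => ((L t)%:C)%C ^+ k : Cplx R).
  apply: (eq_ind _ (cmeas _) (cmeas_real (measurable_funX k mL))).
  by apply/funext => t; exact: (rmorphXn (real_complex R) k (L t)).
have expLt (r t : R) : 0 <= r -> 1 <= t -> expR (`|L t| * r) = t `^ (r / 2).
  move=> r0 t1; rewrite powR_expR ?(lt_le_trans ltr01)// /L normrN ger0_norm.
    by congr expR; ring.
  by rewrite divr_ge0// ln_ge0.
pose T k t : Cplx R := h t * (((k`!%:R)^-1%:C)%C * ((L t)%:C)%C ^+ k).
have iray (r : R) : 0 <= r -> r <= dl ->
    mu.-integrable ray1 (EFin \o (fun t => C * t `^ (- 1 - dl + r / 2))).
  move=> r0 rd; have := @ray_powR_integrable (- 1 - dl + r / 2).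
  have -> : -1 - dl + r / 2 < -1 by lra.
  by move=> /(_ isT)/(integrableZl mD C).
have bnd (r t : R) : 0 <= r -> 1 <= t ->
    normc (h t) * expR (`|L t| * r) <= C * t `^ (- 1 - dl + r / 2).
  move=> r0 t1; rewrite expLt// powRD; last by rewrite (gt_eqF (lt_le_trans ltr01 t1)) implybT.
  by rewrite mulrA ler_wpM2r ?powR_ge0// hle.
have iT k : cintble mu ray1 (T k).
  have iC := integrableZl mD (dl ^- k) (iray dl (ltW dl0) (lexx _)).
  apply: (cintble_le mD _ (g := fun t => dl ^- k * (C * t `^ (- 1 - dl + dl / 2))) iC).
    by apply: cmeasM => //; apply: cmeasM => //; exact: cmeas_cst.
  move=> t /= t1; rewrite ler_pdivlMl ?exprn_gt0//.
  apply: le_trans (bnd dl t (ltW dl0) t1).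
  rewrite /T Normc.normcM mulrCA ler_wpM2l ?normc_ge0//.
  rewrite Normc.normcM normc_real ger0_norm ?invr_ge0// normcX normc_real.
  rewrite (le_trans _ (expR_ser_le k.+1 _))// ?mulr_ge0 ?(ltW dl0)//.
  rewrite big_nat_recr//= exprMn mulrCA (mulrC (dl ^+ k)) lerDr sumr_ge0// => i _.
  by rewrite mulr_ge0 ?invr_ge0// exprn_ge0// mulr_ge0 ?(ltW dl0).
apply/analytic_pser; exists (fun k => cint mu ray1 (T k)).
apply/nbhs_normc; exists dl => // s sdl.
pose x := s - s0.
have -> : pser (fun k => cint mu ray1 (T k)) s0 s =
    fun n => cint mu ray1 (fun t => h t * cexp_ser ((L t)%:C%C * x) n).
  apply/funext => n; rewrite /pser.
  transitivity (\sum_(0 <= k < n) cint mu ray1 (fun t => x ^+ k * T k t)).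
    by apply: eq_bigr => k _; rewrite cintZ// mulrC.
  have [_ <-] := cint_sum mD n (fun k => cintbleZ mD (x ^+ k) (iT k)).
  apply: eq_cint => t _; rewrite /cexp_ser mulr_sumr; apply: eq_bigr => k _.
  by rewrite /T exprMn; ring.
have -> : (fun t => (V t)%:C%C * tpow (b - s / 2) t) =
    (fun t => h t * cexp ((L t)%:C%C * x)).
  apply/funext => t; rewrite /h /tpow -mulrA -cexpD; congr (_ * cexp _).
  rewrite /L /x rmorphN rmorphM fmorphV rmorph_nat; ring.
have mser n : cmeas ray1
    (fun t => h t * cexp_ser ((L t)%:C%C * x) n).
  apply: cmeasM => //; rewrite /cexp_ser.
  have H := @cmeas_sum _ _ R _ (fun=> 0)
    (fun k t => ((k`!%:R)^-1%:C)%C * (((L t)%:C)%C * x) ^+ k) n; apply: H => k.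
  apply: cmeasM; first exact: cmeas_cst.
  apply: (eq_ind _ (cmeas _) (cmeasM (mLX k) (cmeas_cst _ (x ^+ k)))).
  by apply/funext => t; rewrite exprMn.
have [||||//] := @cint_dct _ _ R mu _ mD
   (fun n t => h t * cexp_ser ((L t)%:C%C * x) n)
   (fun t => h t * cexp ((L t)%:C%C * x))
   (fun t => C * t `^ (- 1 - dl + normc x / 2)) mser.
- apply: cmeasM => //.
  have H := cmeasM (cmeas_tpow (- (x / 2)) mD) (@cmeas_cst _ _ R ray1 1).
  apply: (eq_ind _ (cmeas _) H); apply/funext => t.
  rewrite mulr1 /tpow /L; congr cexp.
  by rewrite rmorphN rmorphM fmorphV rmorph_nat; ring.
- by move=> t _; apply: cvgMrc; exact: cexp_ser_cvg.
- by apply: iray; [exact: normc_ge0|exact: ltW].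
- move=> n t /= t1; apply: le_trans (bnd _ _ (normc_ge0 x) t1).
  rewrite Normc.normcM ler_wpM2l ?normc_ge0// (le_trans (normc_cexp_ser_le _ _))//.
  by rewrite Normc.normcM normc_real.
Qed.

End PowerIntegrals.

(** * Truncated powers and periodic quadrature *)

Section TruncatedPower.
Variable R : realType.
Implicit Types (u m x t : R).

Definition truncpow m u : R := if 0 < u then u `^ m else 0.

Lemma truncpow_ge0 m u : 0 <= truncpow m u.
Proof. by rewrite /truncpow; case: ifP => // _; exact: powR_ge0. Qed.

Lemma truncpow_pos m u : 0 < u -> truncpow m u = u `^ m.
Proof. by rewrite /truncpow => ->. Qed.

Lemma truncpow_neg m u : u <= 0 -> truncpow m u = 0.
Proof. by move=> u0; rewrite /truncpow ltNge u0. Qed.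

Lemma measurable_truncpow m : measurable_fun [set: measurableTypeR R] (truncpow m).
Proof.
rewrite (_ : truncpow m = (@powR R ^~ m) \* (\1_`]0, +oo[%classic : R -> R)).
  apply: measurable_funM; first exact: measurable_powR.
  by apply: measurable_indic; exact: measurable_itv.
apply/funext => u /=; rewrite /truncpow indicE.
have -> : (u \in `]0, +oo[%classic) = (0 < u).
  by apply/idP/idP; rewrite inE/= in_itv/= andbT.
by case: ifP => _; rewrite ?mulr1 ?mulr0.
Qed.

Lemma truncpow_small m (e : R) : 0 < m -> 0 < e ->
  exists2 d : R, 0 < d & forall u, u < d -> truncpow m u < e.
Proof.
move=> m0 e0; exists (e `^ (m^-1)); first exact: powR_gt0.
move=> u ud; have [u0|u0] := ltP 0 u; last by rewrite truncpow_neg.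
rewrite truncpow_pos//.
have := gt0_ltr_powR m0; move=> /(_ u (e `^ m^-1)).
rewrite !nnegrE (ltW u0) powR_ge0 => /(_ isT isT ud)/lt_le_trans; apply.
by rewrite -powRrM mulVf ?gt_eqF// powRr1// ltW.
Qed.

(** At the origin the difference quotient is itself a truncated power, with
    exponent m - 1 > 0, hence continuous. *)
Lemma is_derive_truncpow m u : 1 < m -> is_derive u 1 (truncpow m) (m * truncpow (m - 1) u).
Proof.
move=> m1; have [u0|u0|u0] := ltgtP u 0.
- rewrite truncpow_neg ?ltW// mulr0.
  apply: (near_eq_is_derive _ (is_derive_cst' (0 : R) u)).
  by near=> z; rewrite truncpow_neg// ltW//; near: z; exact: lt_nbhsl.
- rewrite truncpow_pos//.
  apply: (near_eq_is_derive _ (is_derive_powR m u0)).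
  by near=> z; rewrite truncpow_pos//; near: z; exact: lt_nbhsr.
- subst u; rewrite truncpow_neg// mulr0.
  apply/is_derive1_caratheodory; exists (truncpow (m - 1)); split.
  + move=> z; rewrite subr0 (truncpow_neg _ (lexx 0)) subr0.
    have [z0|z0] := ltP 0 z; last by rewrite !truncpow_neg ?mul0r.
    by rewrite !truncpow_pos// -{1}(subrK 1 m) powRS// mulrC.
  + apply/cvgrPdist_lt => e e0; rewrite (truncpow_neg _ (lexx 0)).
    have m10 : 0 < m - 1 by lra.
    have [d d0 H] := truncpow_small m10 e0.
    apply/nbhs_normP; exists d => //= z; rewrite sub0r normrN => zd.
    rewrite ger0_norm ?truncpow_ge0//; apply: H; apply: le_lt_trans (ler_norm z) _.
    by move: zd; rewrite /ball_/= sub0r normrN.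
  + by rewrite truncpow_neg.
Unshelve. all: by end_near. Qed.

End TruncatedPower.

Section Quadrature.
Variable R : realType.

(** Here f 1 is the integrand, f 0 a primitive of it, f j.+1 the derivative of
    f j, and f 1, ..., f K vanish outside ]-L, L[. The sum over a shifted grid
    is a periodic function of the shift. Each of its derivatives integrates to
    zero over a period, so vanishes somewhere, so is bounded by the next
    derivative; and its own mean value is the integral. *)
Lemma periodic_quadrature (f : nat -> R -> R) (K L : nat) (M : R) : (0 < L)%N ->
  (1 <= K)%N ->
  (forall j (x : R), (j <= K)%N -> `|x| <= L%:R -> is_derive x 1 (f j) (f j.+1 x)) ->
  (forall j (x : R), (1 <= j <= K)%N -> L%:R <= `|x| -> f j x = 0) ->
  (forall x, `|f K.+1 x| <= M) ->
  `|\sum_(0 <= n < (2 * L)) f 1%N (n%:R - L%:R) - (f 0%N L%:R - f 0%N (- L%:R))|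
    <= (2 * L)%:R * M.
Proof.
move=> L0 K1 df f0 fM.
pose S j (x : R) := \sum_(0 <= n < 2 * L) f j (n%:R - L%:R + x).
have dS j (x : R) : (j <= K)%N -> 0 <= x <= 1 -> is_derive x 1 (S j) (S j.+1 x).
  move=> jK /andP[x0 x1]; rewrite /S !big_mkord.
  have H (n : 'I_(2 * L)) : is_derive x 1 (fun y => f j (n%:R - L%:R + y)) (f j.+1 (n%:R - L%:R + x)).
    rewrite -[f j.+1 _]mulr1; apply: (is_derive_comp' (df j _ jK _)).
      have n1 : n%:R + 1 <= 2 * L%:R :> R.
        by rewrite -natrM natr1 ler_nat ltn_ord.
      have n0 : 0 <= n%:R :> R by [].
      by rewrite ler_norml; apply/andP; split; lra.
    rewrite -[X in is_derive _ _ _ X]add0r.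
    exact: (is_derive_add' (is_derive_cst' _ _) (is_derive_id _ _)).
  rewrite [X in is_derive _ _ X](_ : _ = \sum_(n < 2 * L) (fun y : R => f j (n%:R - L%:R + y))).
    exact: (is_derive_sum (fun n : 'I_(2 * L) => H n)).
  by apply/funext => y; rewrite fct_sumE big_mkord.
(* Shifting the grid by 1 telescopes, leaving only the two end points. *)
have S01 j : S j 1 - S j 0 = f j L%:R - f j (- L%:R).
  rewrite /S -sumrB.
  rewrite (eq_bigr (fun n => f j (n.+1%:R - L%:R) - f j (n%:R - L%:R))); last first.
    by move=> n _; rewrite addr0 -natr1; congr (f _ _ - _); ring.
  rewrite telescope_sumr// sub0r; congr (f _ _ - _).
  by rewrite natrM; ring.
have Sz j : (j <= K)%N -> exists2 x, 0 <= x <= 1 & S j.+1 x = f j L%:R - f j (- L%:R).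
  move=> jK; have [|||x] := @MVT_segment R (S j) (S j.+1) 0 1 => //.
  - by move=> x; rewrite in_itv/= => /andP[x0 x1]; apply: dS => //; rewrite !ltW.
  - apply: derivable_within_continuous => x; rewrite in_itv/= => x01.
    by case: (dS j x jK x01).
  - by rewrite in_itv/= subr0 mulr1 S01 => x01 Sx; exists x.
have M0 : 0 <= M by exact: le_trans (fM 0).
have step j (B : R) : (j <= K)%N -> (forall x, 0 <= x <= 1 -> `|S j.+1 x| <= B) ->
    forall x y : R, 0 <= x <= 1 -> 0 <= y <= 1 -> `|S j x - S j y| <= B.
  move=> jK HB.
  have wl (x y : R) : x <= y -> 0 <= x <= 1 -> 0 <= y <= 1 -> `|S j y - S j x| <= B.
    move=> xy /andP[x0 x1] /andP[y0 y1].
    have B0 : 0 <= B by apply: le_trans (HB 0 _) => //; rewrite lexx ler01.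
    apply: (@le_trans _ _ (B * (y - x))).
      apply: (is_derive_le (df := S j.+1)) => // z /andP[xz zy].
        by apply: dS => //; rewrite (le_trans x0 xz) (le_trans zy y1).
      by apply: HB; rewrite (le_trans x0 xz) (le_trans zy y1).
    by rewrite ler_piMr//; lra.
  move=> x y x01 y01; have [xy|/ltW xy] := leP x y; last exact: wl.
  by rewrite distrC; exact: wl.
have bound j : (2 <= j <= K.+1)%N -> forall x, 0 <= x <= 1 -> `|S j x| <= (2 * L)%:R * M.
  move=> /andP[]; elim: (K.+1 - j)%N {-2}j (erefl (K.+1 - j)%N) => [|i IH] {}j Hj j2 jK x x01.
    have -> : j = K.+1 by lia.
    rewrite (le_trans (ler_norm_sum _ _ _))// (le_trans (ler_sum _ (fun n _ => fM _)))//.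
    by rewrite sumr_const_nat subn0 mulr_natl.
  case: j j2 jK Hj => // j j2 jK Hj.
  have [y y01 Sy] := Sz j (ltac:(lia)).
  have Sy0 : S j.+1 y = 0 by rewrite Sy !f0 ?subrr ?normrN ?ger0_norm//; lia.
  have := @step j.+1 _ _ _ x y x01 y01; rewrite Sy0 subr0; apply; first by lia.
  by move=> z z01; apply: (IH j.+2) => //; lia.
have [y y01 Sy] := Sz 0%N isT.
rewrite -Sy (_ : \sum_(0 <= n < _) _ = S 1%N 0); last first.
  by apply: eq_bigr => n _; rewrite addr0.
apply: (step 1%N) => //; last by rewrite lexx ler01.
by apply: bound; lia.
Qed.

(** The j-th derivative in x of x^i (t - x^2)_+^m, for j < m. The recursion
    runs over all i and m because only the whole family is closed under
    differentiation. *)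
Fixpoint dkernel (t : R) (j i : nat) (m : R) (x : R) : R :=
  if j is j'.+1 then
    i%:R * dkernel t j' i.-1 m x - 2 * m * dkernel t j' i.+1 (m - 1) x
  else x ^+ i * truncpow m (t - x ^+ 2).

Lemma dkernel_derive (t : R) j i (m x : R) : j.+1%:R < m ->
  is_derive x 1 (dkernel t j i m) (dkernel t j.+1 i m x).
Proof.
elim: j i m => [|j IH] i m jm.
  have d1 : is_derive x 1 (fun x => t - x ^+ 2) (- (2 * x)).
    apply: (is_derive_eq (is_derive_sub' (is_derive_cst' t x) (is_derive_exp' 2 x))).
    by rewrite sub0r /= expr1.
  apply: (is_derive_eq (is_derive_mul' (is_derive_exp' i x) (is_derive_comp' (is_derive_truncpow _ jm) d1))).
  by rewrite /= (exprS x i); ring.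
apply: is_derive_sub'.
  apply: (is_derive_eq (is_derive_mul' (is_derive_cst' _ _) (IH i.-1 m _))).
    by apply: lt_trans jm; rewrite ltr_nat.
  by rewrite mul0r add0r.
apply: (is_derive_eq (is_derive_mul' (is_derive_cst' _ _) (IH i.+1 (m - 1) _))).
  by rewrite ltrBrDr natr1.
by rewrite mul0r add0r.
Qed.

Lemma dkernel_out (t : R) j i (m x : R) : t <= x ^+ 2 -> dkernel t j i m x = 0.
Proof.
move=> tx; elim: j i m => [|j IH] i m /=; last by rewrite !IH !mulr0 subrr.
by rewrite truncpow_neg ?mulr0// subr_le0.
Qed.

(** On the support |x| <= sqrt t, so that each derivative lowers the order of
    magnitude by sqrt t. *)
Lemma dkernel_bound j i (m : R) : j%:R <= m -> exists2 c : R, 0 <= c &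
  forall t x, 0 <= t -> `|dkernel t j i m x| <= c * (1 + t) `^ (i%:R / 2 + m - j%:R / 2).
Proof.
elim: j i m => [|j IH] i m jm.
  exists 1 => // t x t0.
  have t1 : 0 < 1 + t by lra.
  rewrite mul1r mul0r subr0 powRD; last by rewrite (gt_eqF t1) implybT.
  have [tx|xt] := lerP t (x ^+ 2).
    by rewrite dkernel_out// normr0 mulr_ge0// powR_ge0.
  rewrite /= normrM (ger0_norm (truncpow_ge0 _ _)) truncpow_pos ?subr_gt0//.
  apply: ler_pM; rewrite ?normr_ge0 ?powR_ge0//.
    rewrite normrX mulrC powRrM powR_mulrn ?powR_ge0// lerXn2r ?nnegrE ?powR_ge0//.
    by rewrite (powR12_sqrt (ltW t1)) -sqrtr_sqr ler_wsqrtr//; lra.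
  apply: ge0_ler_powR => //; rewrite ?nnegrE ?subr_ge0 ?(ltW xt) ?(ltW t1)//.
  by have := sqr_ge0 x; lra.
have [|c1 c10 H1] := IH i.-1 m; first by rewrite (le_trans _ jm)// ler_nat.
have [|c2 c20 H2] := IH i.+1 (m - 1); first by rewrite lerBrDr natr1.
exists (i%:R * c1 + 2 * `|m| * c2).
  by rewrite addr_ge0 ?mulr_ge0.
move=> t x t0; rewrite /= (le_trans (ler_normB _ _))// [leRHS]mulrDl lerD//.
  case: i H1 {H2} => [|i] H1; first by rewrite !mul0r normr0.
  rewrite normrM ger0_norm// -mulrA ler_wpM2l//.
  rewrite (le_trans (H1 t x t0))//= ler_wpM2l//.
  by rewrite -natr1 -[j.+1%:R]natr1 le_eqVlt; apply/orP; left; apply/eqP; congr (_ `^ _); ring.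
rewrite 2!normrM (ger0_norm (x := 2))// -!mulrA ler_wpM2l// ler_wpM2l//.
rewrite (le_trans (H2 t x t0))// ler_wpM2l//.
by rewrite -natr1 -[j.+1%:R]natr1 le_eqVlt; apply/orP; left; apply/eqP; congr (_ `^ _); field.
Qed.

End Quadrature.

(** * Quadrature of the truncated power on the line *)

Section OneDim.
Variable R : realType.
Notation mu := (@lebesgue_measure R).

Lemma antiderivative (f : R -> R) (A : R) : continuous f ->
  exists P : R -> R, forall x, A < x -> is_derive x 1 P (f x).
Proof.
move=> cf; exists (fun x => (\int[mu]_(t in `[A, x]) f t)%R) => x Ax.
have xx : x < x + 1 by rewrite ltrDl.
have i1 : mu.-integrable [set` Interval (BLeft A) (BRight (x + 1))] (EFin \o f).
  apply: continuous_compact_integrable; first exact: segment_compact.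
  exact: continuous_subspaceT.
have [||d1 d2] := continuous_FTC1 xx i1; [by rewrite ?bnd_simp|exact: cf|].
by split; [exact: d1|rewrite -derive1E; exact: d2].
Qed.

Lemma integral_supported (f P : R -> R) (r : R) : 0 < r -> continuous f ->
  (forall x, r <= `|x| -> f x = 0) ->
  (forall x, - r <= x <= r -> is_derive x 1 P (f x)) ->
  (\int[mu]_x (f x)%:E = (P r - P (- r))%:E)%E.
Proof.
move=> r0 cf f0 dP.
have rr : - r < r by lra.
transitivity (\int[mu]_(x in `[(- r)%R, r]) (f x)%:E)%E.
  rewrite [RHS]integral_mkcond; apply: eq_integral => x _.
  rewrite patchE; case: ifPn => //; rewrite notin_setE/= in_itv/= -ler_norml => /negP.
  by rewrite -ltNge => /ltW/f0 ->.
have cP x : - r <= x <= r -> {for x, continuous P}.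
  by move=> /dP d; exact: is_derive_continuous d.
rewrite EFinB; apply: continuous_FTC2 => //.
- exact: continuous_subspaceT.
- split.
  + by move=> x; rewrite in_itv/= => /andP[x1 x2]; case: (dP x); rewrite // !ltW.
  + by apply: cvg_at_right_filter; apply: cP; rewrite lexx ltW.
  + by apply: cvg_at_left_filter; apply: cP; rewrite lexx ltW.
- move=> x; rewrite in_itv/= => /andP[x1 x2]; rewrite derive1E.
  by have [|_ H] := dP x; [rewrite !ltW|exact: H].
Qed.

Variables (a K : nat) (m : R).
Hypotheses (K1 : (1 <= K)%N) (Km : K%:R < m).

Let phi (t x : R) := x ^+ (2 * a) * truncpow m (t - x ^+ 2).

Let m1 : 1 < m.
Proof. by apply: le_lt_trans Km; rewrite ler1n. Qed.

Let continuous_phi t : continuous (phi t).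
Proof.
move=> x; apply: (@is_derive_continuous _ _ _ (dkernel t 1 (2 * a) m x)).
exact: (@dkernel_derive _ t 0).
Qed.

Let phi_out t x : t <= x ^+ 2 -> phi t x = 0.
Proof. exact: (@dkernel_out _ t 0). Qed.

Lemma truncpowM (t u : R) : 0 < t -> truncpow m (t * u) = t `^ m * truncpow m u.
Proof.
move=> t0; rewrite /truncpow pmulr_rgt0//; case: ifP => u0; last by rewrite mulr0.
by rewrite powRM// ltW.
Qed.

Let ex : R := m + a%:R + 2^-1.

(** The value of the integral follows from x = sqrt t * y, and the error from
    the periodic quadrature with K derivatives. The number of grid points
    2 L is left free subject to covering the support. *)
Lemma line_quadrature : exists C c : R, [/\ 0 <= C, 0 <= c,
  forall t, (\int[mu]_x (phi t x)%:E = (C * truncpow ex t)%:E)%E &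
  forall t (L : nat), 0 <= t -> (0 < L)%N -> t <= L%:R ^+ 2 ->
    `|\sum_(0 <= n < 2 * L) phi t (n%:R - L%:R) - C * truncpow ex t| <=
    (2 * L)%:R * (c * (1 + t) `^ (a%:R + m - K%:R / 2))].
Proof.
have [P1 dP1] := antiderivative (-2) (@continuous_phi 1).
pose C := P1 1 - P1 (-1).
have intC : (\int[mu]_x (phi 1 x)%:E = C%:E)%E.
  apply: (integral_supported (P := P1) ltr01 (@continuous_phi 1)).
    by move=> x x1; apply: phi_out; rewrite -real_normK ?num_real// expr_ge1.
  by move=> x /andP[x1 x2]; apply: dP1; lra.
have C0 : 0 <= C.
  rewrite -lee_fin -intC; apply: integral_ge0 => x _.
  by rewrite lee_fin mulr_ge0 ?truncpow_ge0// exprM exprn_ge0 ?sqr_ge0.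
have scal t : (\int[mu]_x (phi t x)%:E = (C * truncpow ex t)%:E)%E.
  have [t0|t0] := ltP 0 t; last first.
    rewrite truncpow_neg// mulr0 -[RHS](integral0 mu setT); apply: eq_integral => x _.
    by rewrite phi_out// (le_trans t0)// sqr_ge0.
  pose r := Num.sqrt t.
  have r0 : 0 < r by rewrite sqrtr_gt0.
  have r2 : r ^+ 2 = t by rewrite sqr_sqrtr// ltW.
  have -> : C * truncpow ex t = t `^ ex * P1 (r^-1 * r) - t `^ ex * P1 (r^-1 * - r).
    by rewrite mulrN mulVf ?gt_eqF// -mulrBr -/C truncpow_pos// mulrC.
  apply: (integral_supported (P := fun x => t `^ ex * P1 (r^-1 * x)) r0 (@continuous_phi t)).
    move=> x rx; apply: phi_out; rewrite -r2 -(real_normK (num_real x)).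
    by rewrite lerXn2r ?nnegrE ?(ltW r0).
  move=> x /andP[x1 x2].
  have dl : is_derive x 1 (fun x : R => r^-1 * x) r^-1.
    apply: (is_derive_eq (is_derive_mul' (f := fun=> r^-1) (g := fun y => y) (is_derive_cst' _ _) (is_derive_id _ _))).
    by rewrite mul0r add0r mulr1.
  have dP : -2 < r^-1 * x.
    rewrite mulrC ltr_pdivlMr//; lra.
  apply: (is_derive_eq (is_derive_mul' (is_derive_cst' _ _) (is_derive_comp' (dP1 _ dP) dl))).
  rewrite mul0r add0r /phi.
  have -> : t - x ^+ 2 = t * (1 - (r^-1 * x) ^+ 2).
    by rewrite exprMn exprVn r2 mulrBr mulr1 mulrA mulfV ?mul1r// gt_eqF.
  rewrite truncpowM// /ex -addrA powRD; last by rewrite (gt_eqF t0) implybT.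
  rewrite powRD; last by rewrite (gt_eqF t0) implybT.
  have Er : (r^-1 * x) ^+ (2 * a) = (t ^+ a)^-1 * x ^+ (2 * a).
    by rewrite exprMn [r^-1 ^+ _]exprM exprVn r2 exprVn.
  rewrite powR_mulrn ?(ltW t0)// powR12_sqrt ?(ltW t0)// -/r Er.
  by field; rewrite !gt_eqF// exprn_gt0.
have [c c0 Hc] := dkernel_bound (2 * a) (ltW Km).
exists C, c; split=> // t L t0 L0 tL.
have LR : 0 < L%:R :> R by rewrite ltr0n.
have [P dP] := antiderivative (- L%:R - 1) (@continuous_phi t).
(* P is based at - L - 1, so as to be differentiable at the end point - L too. *)
pose f j := if j is j'.+1 then dkernel t j' (2 * a) m else P.
have fz (x : R) j : L%:R <= `|x| -> dkernel t j (2 * a) m x = 0.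
  move=> Lx; apply: dkernel_out; rewrite (le_trans tL)// -(real_normK (num_real x)).
  by rewrite lerXn2r ?nnegrE ?(ltW LR).
have -> : C * truncpow ex t = P L%:R - P (- L%:R).
  apply: EFin_inj; rewrite -scal; apply: (integral_supported LR (@continuous_phi t)).
  - by move=> x; exact: (fz x 0%N).
  - by move=> x /andP[x1 x2]; apply: dP; lra.
apply: (@periodic_quadrature _ f K L _ L0 K1).
- case=> [|j] x jK Lx; first by apply: dP; move: Lx; rewrite ler_norml => /andP[? ?]; lra.
  by apply: dkernel_derive; apply: le_lt_trans Km; rewrite ler_nat.
- by case=> // j x _ Lx; exact: fz.
- move=> x /=; apply: le_trans (Hc t x t0) _.
  by rewrite (_ : (2 * a)%:R / 2 = a%:R)// natrM; field.
Qed.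

End OneDim.

(** * Weights on tuples and on lattice points *)

Section Kernels.
Variable R : realType.
Notation mu := (@lebesgue_measure R).

Lemma esumZ (T : choiceType) (D : set T) (c : R) (u : T -> \bar R) : 0 <= c ->
  (forall i, 0 <= u i)%E ->
  (\esum_(i in D) (c%:E * u i) = c%:E * \esum_(i in D) u i)%E.
Proof.
move=> c0 u0.
have le (e : R) (v : T -> \bar R) : 0 <= e -> (forall i, 0 <= v i)%E ->
    (\esum_(i in D) (e%:E * v i) <= e%:E * \esum_(i in D) v i)%E.
  move=> e0 v0; apply: ge_ereal_sup => _ [A [fA AD] <-].
  rewrite -ge0_mule_fsumr//.
  by rewrite lee_wpmul2l ?lee_fin//; apply: esum_ge; exists A.
apply/eqP; rewrite eq_le le//=.
have [->|cn0] := eqVneq c 0.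
  by rewrite mul0e; apply: esum_ge0 => i _; rewrite mul0e.
have := le c^-1 (fun i => c%:E * u i)%E; rewrite invr_ge0 c0 => /(_ isT) H.
have {}H := H (fun i => mule_ge0 (c0 : 0 <= c%:E)%E (u0 i)).
have cp : 0 < c by rewrite lt_neqAle eq_sym cn0.
rewrite muleC -lee_pdivlMr// muleC.
apply: le_trans H; apply: le_esum => i _.
by rewrite muleA -EFinM mulVf// mul1e.
Qed.

Definition tweight d (al : 'I_d -> nat) (x : d.-tuple (measurableTypeR R)) : R :=
  \prod_j (tnth x j) ^+ (2 * al j).
Definition tnorm2 d (x : d.-tuple (measurableTypeR R)) : R := \sum_j (tnth x j) ^+ 2.
Definition lweight d (al : 'I_d -> nat) (i : 'rV[int]_d) : R :=
  \prod_j ((i ord0 j)%:~R) ^+ (2 * al j).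
Definition lnorm2 d (i : 'rV[int]_d) : R := \sum_j ((i ord0 j)%:~R) ^+ 2.

Lemma tweight_ge0 d al x : 0 <= @tweight d al x.
Proof. by apply: prodr_ge0 => j _; rewrite exprM exprn_ge0// sqr_ge0. Qed.
Lemma lweight_ge0 d al x : 0 <= @lweight d al x.
Proof. by apply: prodr_ge0 => j _; rewrite exprM exprn_ge0// sqr_ge0. Qed.
Lemma tnorm2_ge0 d x : 0 <= @tnorm2 d x.
Proof. by apply: sumr_ge0 => j _; exact: sqr_ge0. Qed.
Lemma lnorm2_ge0 d x : 0 <= @lnorm2 d x.
Proof. by apply: sumr_ge0 => j _; exact: sqr_ge0. Qed.

Lemma measurable_tweight d al : measurable_fun setT (@tweight d al).
Proof.
apply: measurable_prod => j _; apply: measurable_funX.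
exact: measurable_tnth.
Qed.

Lemma measurable_tnorm2 d : measurable_fun setT (@tnorm2 d).
Proof.
apply: measurable_sum => j; apply: measurable_funX.
exact: measurable_tnth.
Qed.

Lemma tweight_cons d (al : 'I_d.+1 -> nat) (z : measurableTypeR R) x :
  tweight al (tuple_cons (z, x)) = z ^+ (2 * al ord0) * tweight (al \o lift ord0) x.
Proof.
rewrite /tweight big_ord_recl; congr (_ ^+ _ * _).
by apply: eq_bigr => j _ /=; rewrite tnthS.
Qed.

Lemma tnorm2_cons d (z : measurableTypeR R) (x : d.-tuple _) :
  tnorm2 (tuple_cons (z, x)) = z ^+ 2 + tnorm2 x.
Proof.
rewrite /tnorm2 big_ord_recl; congr (_ ^+ _ + _).
by apply: eq_bigr => j _ /=; rewrite tnthS.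
Qed.

Definition cons_row d (x : int * 'rV[int]_d) : 'rV[int]_d.+1 :=
  \row_j (if unlift ord0 j is Some j' then x.2 ord0 j' else x.1).

Lemma cons_row0 d x : @cons_row d x ord0 ord0 = x.1.
Proof. by rewrite mxE unlift_none. Qed.
Lemma cons_rowS d x j : @cons_row d x ord0 (lift ord0 j) = x.2 ord0 j.
Proof. by rewrite mxE liftK. Qed.

Lemma lweight_cons d (al : 'I_d.+1 -> nat) x :
  lweight al (cons_row x) = x.1%:~R ^+ (2 * al ord0) * lweight (al \o lift ord0) x.2.
Proof.
rewrite /lweight big_ord_recl cons_row0; congr (_ * _).
by apply: eq_bigr => j _; rewrite cons_rowS.
Qed.

Lemma lnorm2_cons d x : lnorm2 (@cons_row d x) = x.1%:~R ^+ 2 + lnorm2 x.2.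
Proof.
rewrite /lnorm2 big_ord_recl cons_row0; congr (_ + _).
by apply: eq_bigr => j _; rewrite cons_rowS.
Qed.

Lemma cons_row_bij d : set_bij [set: int * 'rV[int]_d] setT (@cons_row d).
Proof.
split=> //.
- move=> [n x] [n' x'] _ _ H; congr pair.
    by have := congr1 (fun v : 'rV_d.+1 => v ord0 ord0) H; rewrite !cons_row0.
  apply/rowP => j.
  by have := congr1 (fun v : 'rV_d.+1 => v ord0 (lift ord0 j)) H; rewrite !cons_rowS.
- move=> v _; exists (v ord0 ord0, \row_j v ord0 (lift ord0 j)) => //.
  apply/rowP => j; rewrite mxE; case: unliftP => [j' ->|->] //=.
  by rewrite mxE.
Qed.

Lemma integral_tuple_cons d (f : d.+1.-tuple (measurableTypeR R) -> \bar R) :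
  measurable_fun setT f -> (forall x, 0 <= f x)%E ->
  (\int[@lebesgue_tuple R d.+1]_x f x =
   \int[mu]_z \int[@lebesgue_tuple R d]_x f (tuple_cons (z, x)))%E.
Proof.
move=> mf f0.
have mc : measurable_fun setT (@tuple_cons _ (measurableTypeR R) d).
  exact: measurable_cons.
rewrite /lebesgue_tuple /= /power_succ.
rewrite ge0_integral_pushforward//.
rewrite preimage_setT fubini_tonelli1//.
  exact: measurableT_comp.
by move=> x; exact: f0.
Qed.

(** The range starts at - L in order to match the grid of the quadrature; the
    end point n = L may be left out since u vanishes there. *)
Lemma esum_int_supported (u : int -> R) (L : nat) : (forall n, 0 <= u n) ->
  (forall n : int, L%:R ^+ 2 <= (n%:~R : R) ^+ 2 -> u n = 0) ->
  (\esum_(n in [set: int]) (u n)%:E =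
   (\sum_(0 <= n < 2 * L) u (n%:Z - L%:Z))%:E)%E.
Proof.
move=> u0 uL.
pose s : seq int := [seq (n%:Z - L%:Z) | n : nat <- iota 0 (2 * L)].
have us : uniq s.
  by rewrite map_inj_uniq ?iota_uniq// => x y /addIr [].
transitivity (\esum_(n in [set` s]) (u n)%:E)%E.
  rewrite -(setTI [set` s]) esum_mkcondr; apply: eq_esum => n _.
  case: ifPn => //; rewrite notin_setE/= => /negP ns; rewrite uL//.
  have [nL|Ln] := ltrP (n ^+ 2) (L%:Z ^+ 2); last first.
    by move: Ln; rewrite -(ler_int R) !rmorphXn.
  exfalso; move/negP : ns; apply; apply/mapP; exists (absz (n + L%:Z)).
    by rewrite mem_iota add0n; nia.
  nia.
rewrite esum_fset//; [|exact: finite_seq|by move=> i _; rewrite lee_fin].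
rewrite -fsbig_seq// big_map sumEFin; congr (_%:E).
by rewrite /index_iota subn0.
Qed.

End Kernels.

(** * Riesz means of the lattice weights *)

Section Riesz.
Variable R : realType.
Variables (K : nat) (k : R).
Hypotheses (K1 : (1 <= K)%N) (Kk : K%:R < k).

(** Every coordinate raises the degree of homogeneity of the integral in t by
    half the degree of its weight plus one half for the measure. *)
Definition riesz_exp (k : R) d (al : 'I_d -> nat) : R := k + \sum_j ((al j)%:R + 2^-1).

Lemma riesz_exp_ge d (al : 'I_d -> nat) : k <= riesz_exp k al.
Proof. by rewrite lerDl sumr_ge0// => j _; rewrite addr_ge0. Qed.

Lemma riesz_exp_cons d (al : 'I_d.+1 -> nat) :
  riesz_exp k al = riesz_exp k (al \o lift ord0) + (al ord0)%:R + 2^-1.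
Proof. by rewrite /riesz_exp big_ord_recl/=; ring. Qed.

Let b_neg d (al : 'I_d -> nat) (b : R -> R) :
  (forall t, \esum_(i in setT) (lweight R al i * truncpow k (t - lnorm2 R i))%:E = (b t)%:E)%E ->
  forall t, t <= 0 -> b t = 0.
Proof.
move=> Hb t t0; apply: EFin_inj; rewrite -Hb esum1// => i _.
by rewrite truncpow_neg ?mulr0// subr_le0 (le_trans t0)// lnorm2_ge0.
Qed.

(** By induction on the dimension: fixing the new coordinate z leaves a Riesz
    mean at t - z^2, whose main term is a truncated power of t - z^2 to which
    the quadrature on the line applies. There are O(sqrt t) values of z, and the
    factor sqrt t is exactly the growth of the exponent allowed to the error by
    the extra coordinate. *)
Lemma riesz_mean_asymptotic d (al : 'I_d -> nat) : exists C c : R, exists b : R -> R,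
  [/\ 0 <= C, 0 <= c,
  forall t, (\int[@lebesgue_tuple R d]_x (tweight al x * truncpow k (t - tnorm2 x))%:E =
             (C * truncpow (riesz_exp k al) t)%:E)%E,
  forall t, (\esum_(i in setT) (lweight R al i * truncpow k (t - lnorm2 R i))%:E = (b t)%:E)%E &
  forall t, 0 <= t -> `|b t - C * truncpow (riesz_exp k al) t| <= c * (1 + t) `^ (riesz_exp k al - K%:R / 2)].
Proof.
elim: d al => [|d IH] al.
  have kE : riesz_exp k al = k by rewrite /riesz_exp big_ord0 addr0.
  exists 1, 0, (truncpow k); split=> //.
  - move=> t; rewrite /lebesgue_tuple/= integral_dirac//=; last first.
      apply/measurable_EFinP; apply: measurable_funM; first exact: measurable_tweight.
      apply: measurableT_comp; first exact: measurable_truncpow.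
      by apply: measurable_funB => //; exact: measurable_tnorm2.
    by rewrite diracT mul1e kE /tweight /tnorm2 !big_ord0 !mul1r subr0.
  - move=> t; rewrite (_ : setT = [set 0]).
      by rewrite esum_set1 /lweight /lnorm2 ?big_ord0 ?mul1r ?subr0// lee_fin truncpow_ge0.
    by apply/seteqP; split=> // x _ /=; apply/rowP => -[].
  - by move=> t t0; rewrite kE mul1r subrr normr0 mul0r.
have [C1 [c1 [b1 [C10 c10 I1 S1 E1]]]] := IH (al \o lift ord0).
set a := al ord0; set k1 := riesz_exp k (al \o lift ord0) in I1 E1.
have Kk1 : K%:R < k1 by apply: lt_le_trans Kk (riesz_exp_ge _).
have [Cq [cq [Cq0 cq0 Iq Eq]]] := line_quadrature a K1 Kk1.
have b10 := b_neg S1.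
have b1_ge0 u : 0 <= b1 u.
  by rewrite -lee_fin -S1; apply: esum_ge0 => i _; rewrite lee_fin mulr_ge0 ?lweight_ge0 ?truncpow_ge0.
(* Only the coordinates z with z^2 <= t contribute, so L = 1 + floor (sqrt t)
   makes the window [-L, L[ large enough. *)
pose L (t : R) := (Num.truncn (Num.sqrt t)).+1.
have LP t : t <= (L t)%:R ^+ 2.
  have [t0|/ltW t0] := leP 0 t; last by rewrite (le_trans t0)// sqr_ge0.
  rewrite -{1}(sqr_sqrtr t0) lerXn2r ?nnegrE ?sqrtr_ge0//.
  exact: ltW (truncnS_gt _).
pose nu (t : R) (n : nat) : R := n%:R - (L t)%:R.
pose b t := \sum_(0 <= n < 2 * L t) nu t n ^+ (2 * a) * b1 (t - nu t n ^+ 2).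
have kE : riesz_exp k al = k1 + a%:R + 2^-1 by rewrite riesz_exp_cons.
exists (C1 * Cq), (4 * (c1 + C1 * cq)), b; split.
- exact: mulr_ge0.
- by rewrite mulr_ge0// addr_ge0// mulr_ge0.
- move=> t; rewrite integral_tuple_cons; last 2 first.
    + apply/measurable_EFinP; apply: measurable_funM; first exact: measurable_tweight.
      apply: measurableT_comp; first exact: measurable_truncpow.
      by apply: measurable_funB => //; exact: measurable_tnorm2.
    + by move=> x; rewrite lee_fin mulr_ge0 ?tweight_ge0 ?truncpow_ge0.
  rewrite kE -mulrA EFinM -Iq -ge0_integralZl_EFin//; last 2 first.
    + by move=> x _; rewrite lee_fin mulr_ge0 ?truncpow_ge0// exprM exprn_ge0// sqr_ge0.
    + apply/measurable_EFinP; apply: measurable_funM; first exact: measurable_funX.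
      apply: measurableT_comp; first exact: measurable_truncpow.
      by apply: measurable_funB => //; exact: measurable_funX.
  apply: eq_integral => z _.
  rewrite -EFinM mulrCA EFinM -I1 -ge0_integralZl_EFin//; last 3 first.
    + by move=> x _; rewrite lee_fin mulr_ge0 ?tweight_ge0 ?truncpow_ge0.
    + apply/measurable_EFinP; apply: measurable_funM; first exact: measurable_tweight.
      apply: measurableT_comp; first exact: measurable_truncpow.
      by apply: measurable_funB => //; exact: measurable_tnorm2.
    + by rewrite exprM exprn_ge0// sqr_ge0.
  apply: eq_integral => x _; rewrite -EFinM tweight_cons tnorm2_cons mulrA.
  by rewrite opprD addrA.
- move=> t; rewrite (reindex_esum _ _ _ _ (@cons_row_bij d)).
  transitivity (\esum_(n in [set: int]) \esum_(i in [set: 'rV[int]_d])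
     (n%:~R ^+ (2 * a) * (lweight R (al \o lift ord0) i * truncpow k ((t - n%:~R ^+ 2) - lnorm2 R i)))%:E)%E.
    rewrite esum_esum; last first.
      move=> n i _ _; rewrite lee_fin mulr_ge0 ?mulr_ge0 ?lweight_ge0 ?truncpow_ge0//.
      by rewrite exprM exprn_ge0// sqr_ge0.
    rewrite (_ : [set: int] `*`` _ = setT); last by apply/seteqP; split.
    by apply: eq_esum => x _; rewrite lweight_cons lnorm2_cons mulrA opprD addrA.
  transitivity (\esum_(n in [set: int]) ((n%:~R ^+ (2 * a) * b1 (t - n%:~R ^+ 2) : R)%:E))%E.
    apply: eq_esum => n _; rewrite [RHS]EFinM -S1 -esumZ//.
      by rewrite exprM exprn_ge0// sqr_ge0.
    by move=> i; rewrite lee_fin mulr_ge0 ?lweight_ge0 ?truncpow_ge0.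
  rewrite (@esum_int_supported R _ (L t)).
  + congr (_%:E); apply: eq_bigr => n _.
    by rewrite /nu intrD rmorphN.
  + by move=> n; rewrite mulr_ge0// exprM exprn_ge0// sqr_ge0.
  + by move=> n Hn; rewrite b10 ?mulr0// subr_le0 (le_trans (LP t)).
- move=> t t0; have t1 : 0 < 1 + t by lra.
  pose e := k1 - K%:R / 2.
  have e0 : 0 <= e.
    have : 0 <= K%:R :> R by [].
    rewrite /e; lra.
  pose X := (1 + t) `^ (a%:R + k1 - K%:R / 2).
  have X0 : 0 <= X by exact: powR_ge0.
  (* The sum over z of the main terms, between the lattice sum and the integral. *)
  pose S2 := \sum_(0 <= n < 2 * L t) nu t n ^+ (2 * a) * truncpow k1 (t - nu t n ^+ 2).
  have H1 : `|b t - C1 * S2| <= (2 * L t)%:R * (c1 * X).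
    rewrite /b /S2 mulr_sumr -sumrB (le_trans (ler_norm_sum _ _ _))//.
    apply: (@le_trans _ _ (\sum_(0 <= n < 2 * L t) (c1 * X))); last first.
      by rewrite sumr_const_nat subn0 mulr_natl.
    apply: ler_sum => n _; rewrite mulrCA -mulrBr normrM.
    have [u0|u0] := leP 0 (t - nu t n ^+ 2); last first.
      by rewrite b10 ?(ltW u0)// truncpow_neg ?(ltW u0)// mulr0 subrr normr0 mulr0 mulr_ge0.
    rewrite /X -addrA powRD; last by rewrite (gt_eqF t1) implybT.
    rewrite mulrCA; apply: ler_pM => //.
      rewrite powR_mulrn ?(ltW t1)// exprM normrX ger0_norm ?sqr_ge0//.
      rewrite lerXn2r ?nnegrE ?sqr_ge0 ?(ltW t1)//; lra.
    rewrite (le_trans (E1 _ u0))// ler_wpM2l// ge0_ler_powR ?nnegrE ?(ltW t1)//.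
      lra.
    by have := sqr_ge0 (nu t n); lra.
  have H2 : `|S2 - Cq * truncpow (riesz_exp k al) t| <= (2 * L t)%:R * (cq * X).
    by rewrite kE; exact: (Eq t (L t) t0 isT (LP t)).
  have H3 : (2 * L t)%:R <= 4 * (1 + t) `^ (2^-1).
    rewrite powR12_sqrt ?(ltW t1)//.
    rewrite (_ : (2 * L t)%:R = 2 * ((Num.truncn (Num.sqrt t))%:R + 1) :> R); last by rewrite natrM natr1.
    have h1 : (Num.truncn (Num.sqrt t))%:R <= Num.sqrt t.
      by rewrite truncn_le sqrtr_ge0.
    have h2 : Num.sqrt t <= Num.sqrt (1 + t) by rewrite ler_wsqrtr//; lra.
    have h3 : 1 <= Num.sqrt (1 + t) by rewrite -{1}sqrtr1 ler_wsqrtr//; lra.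
    lra.
  have -> : b t - C1 * Cq * truncpow (riesz_exp k al) t =
      (b t - C1 * S2) + C1 * (S2 - Cq * truncpow (riesz_exp k al) t) by ring.
  rewrite (le_trans (ler_normD _ _))// normrM (ger0_norm C10).
  apply: (@le_trans _ _ ((2 * L t)%:R * ((c1 + C1 * cq) * X))).
    rewrite [(c1 + _) * X]mulrDl mulrDr lerD// -mulrA mulrCA ler_wpM2l//.
  rewrite [leRHS](_ : _ = (4 * (1 + t) `^ (2^-1)) * ((c1 + C1 * cq) * X)).
    by rewrite ler_wpM2r// mulr_ge0// addr_ge0// mulr_ge0.
  rewrite /X kE (_ : k1 + a%:R + 2^-1 - K%:R / 2 = 2^-1 + (a%:R + k1 - K%:R / 2)); last by ring.
  rewrite powRD; last by rewrite (gt_eqF t1) implybT.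
  by ring.
Qed.

End Riesz.

(** * Taylor expansion at infinity *)

Section PowerChain.
Variable R : realType.
Notation mu := (@lebesgue_measure R).
Notation normc := (@Normc.normc R).
Notation Re := (@complex.Re R).
Implicit Types (E : nat -> R -> R) (w : Cplx R) (t : R).

(** For an Euler chain E, [power_chain E j 0 w] is (-1)^j times the j-th
    derivative of E 0 t * t^-w. The index i and the exponent w move along
    because differentiating t^-w E_i again gives functions of this form. *)
Fixpoint power_chain E (j i : nat) w t : Cplx R :=
  if j is j'.+1 then
    (w - i%:R / 2) * power_chain E j' i (w + 1) t - (2^-1 : Cplx R) * power_chain E j' i.+1 (w + 1) t
  else (((E i t)%:C)%C : Cplx R) * tpow (- w) t.

Lemma power_chainS E j i w t : power_chain E j.+1 i w t =
  (w - i%:R / 2) * power_chain E j i (w + 1) t - (2^-1 : Cplx R) * power_chain E j i.+1 (w + 1) t.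
Proof. by []. Qed.

(** The differential equations satisfied by E_i (t) = r^i G^(i) (r) with
    r = c sqrt t. They do not involve c, which makes all estimates uniform in
    the dilation. *)
Definition euler_chain E := forall i t, 0 < t ->
  is_derive t 1 (E i) ((i%:R / 2 * E i t + E i.+1 t / 2) / t).

Lemma real_natC n : ((n%:R : R)%:C)%C = n%:R :> Cplx R.
Proof. exact: rmorph_nat. Qed.

Lemma real_halfC : ((2^-1 : R)%:C)%C = 2^-1 :> Cplx R.
Proof. by rewrite fmorphV rmorph_nat. Qed.

Lemma Re_natC n : Re (n%:R) = n%:R.
Proof. by rewrite -real_natC. Qed.

Lemma tpow_inv w t : 0 < t -> tpow (w - 1) t = tpow w t * ((t^-1)%:C)%C.
Proof.
move=> t0; rewrite tpowD (_ : -1 = ((-1 : R)%:C)%C :> Cplx R); last by rewrite rmorphN1.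
by rewrite tpow_real// powR_inv1// ltW.
Qed.

Lemma power_chain_cder E j i w t : euler_chain E -> 0 < t ->
  is_cder (power_chain E j i w) t (- power_chain E j.+1 i w t).
Proof.
move=> chE t0; elim: j i w => [|j IH] i w.
  apply: is_cder_eq.
    exact: (is_cderM (is_cder_real (chE i t t0)) (tpow_cder (- w) t0)).
  rewrite /= (opprD w) !tpow_inv//.
  rewrite !rmorphM/= rmorphD/= !rmorphM/= !real_natC real_halfC.
  by ring.
have -> : - power_chain E j.+2 i w t =
    (w - i%:R / 2) * (- power_chain E j.+1 i (w + 1) t) + (- (2^-1 : Cplx R)) * (- power_chain E j.+1 i.+1 (w + 1) t).
  by rewrite (power_chainS E j.+1 i); ring.
have := is_cderD (is_cderZ (w - i%:R / 2) (IH i (w + 1)))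
                (is_cderZ (- (2^-1 : Cplx R)) (IH i.+1 (w + 1))).
rewrite (_ : (fun x => _) = power_chain E j.+1 i w)//.
by apply/funext => x; rewrite power_chainS mulNr.
Qed.

Lemma power_chain_bound (Ms : nat -> R) j i w : exists2 M : R, 0 <= M &
  forall E t, 0 < t -> (forall i, `|E i t| <= Ms i) ->
    normc (power_chain E j i w t) <= M * t `^ (- Re w - j%:R).
Proof.
elim: j i w => [|j IH] i w.
  exists `|Ms i| => // E t t0 HE /=.
  rewrite Normc.normcM normc_real normc_tpow// ReN subr0 ler_wpM2r ?powR_ge0//.
  by rewrite (le_trans (HE i))// ler_norm.
have [M1 M10 H1] := IH i (w + 1).
have [M2 M20 H2] := IH i.+1 (w + 1).
exists (normc (w - i%:R / 2) * M1 + normc 2^-1 * M2).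
  by rewrite addr_ge0// mulr_ge0 ?normc_ge0.
move=> E t t0 HE /=; rewrite (le_trans (le_normcD _ _))// normcN (Normc.normcM (w - _)) (Normc.normcM 2^-1).
have e : - Re w - j.+1%:R = - Re (w + 1) - j%:R by rewrite ReD -natr1 /=; ring.
rewrite e [leRHS]mulrDl lerD//.
  by rewrite -mulrA ler_wpM2l ?normc_ge0// H1.
by rewrite -[leRHS]mulrA ler_wpM2l ?normc_ge0// H2.
Qed.

Lemma power_chain_lim (E : nat -> nat -> R -> R) E0 j i w t :
  (forall i, E n i t @[n --> \oo] --> E0 i t) ->
  (fun n => power_chain (E n) j i w t) @ \oo --> power_chain E0 j i w t.
Proof.
move=> EE; elim: j i w => [|j IH] i w.
  have H : (fun n => ((E n i t)%:C)%C : Cplx R) @ \oo --> (((E0 i t)%:C)%C : Cplx R).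
    by apply: cvg_Cplx; [exact: EE|exact: cvg_cst].
  rewrite (_ : (fun n => power_chain (E n) 0 i w t) =
     (fun n => tpow (- w) t * (((E n i t)%:C)%C : Cplx R))); last first.
    by apply/funext => n; rewrite /= mulrC.
  rewrite (_ : power_chain E0 0 i w t = tpow (- w) t * (((E0 i t)%:C)%C : Cplx R)); last by rewrite /= mulrC.
  exact: cvgMrc H.
rewrite (_ : (fun n => power_chain (E n) j.+1 i w t) = (fun n => (w - i%:R / 2) * power_chain (E n) j i (w + 1) t +
   (- (2^-1 : Cplx R)) * power_chain (E n) j i.+1 (w + 1) t)); last first.
  by apply/funext => n; rewrite power_chainS [RHS]addrC mulNr addrC.
rewrite (_ : power_chain E0 j.+1 i w t = (w - i%:R / 2) * power_chain E0 j i (w + 1) t +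
   (- (2^-1 : Cplx R)) * power_chain E0 j i.+1 (w + 1) t); last by rewrite power_chainS [RHS]addrC mulNr addrC.
by apply: cvgDc; apply: cvgMrc; exact: IH.
Qed.

(** The chain of the constant function 1: the limit of the dilations, and the
    chain of the series without cut-off. *)
Definition const_chain (i : nat) (t : R) : R := (i == 0%N)%:R.

Lemma euler_const_chain : euler_chain const_chain.
Proof.
move=> i t t0; rewrite /const_chain; case: i => [|i] /=.
  by rewrite !mul0r addr0 mul0r; exact: is_derive_cst'.
by rewrite mulr0 mul0r addr0 mul0r; exact: is_derive_cst'.
Qed.

Lemma power_chain_constS j i w t : power_chain const_chain j i.+1 w t = 0.
Proof.
elim: j i w => [|j IH] i w /=; first by rewrite mul0r.
by rewrite !IH !mulr0 subrr.
Qed.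

Lemma power_chain_const j w t :
  power_chain const_chain j 0 w t = (\prod_(l < j) (w + l%:R)) * tpow (- w - j%:R) t.
Proof.
elim: j w => [|j IH] w /=; first by rewrite big_ord0 subr0.
rewrite power_chain_constS mulr0 subr0 IH mul0r subr0 big_ord_recl /= addr0 -mulrA.
congr (_ * (_ * tpow _ _)); first by apply: eq_bigr => l _; rewrite /bump/= natrD addrA.
by rewrite -natr1; ring.
Qed.

Lemma cmeas_power_chain E j i w (D : set (measurableTypeR R)) : measurable D ->
  (forall i, measurable_fun D (E i)) -> cmeas D (power_chain E j i w).
Proof.
move=> mD mE; elim: j i w => [|j IH] i w /=.
  by apply: cmeasM; [exact: cmeas_real|exact: cmeas_tpow].
have H := cmeasD (cmeasM (cmeas_cst D (w - i%:R / 2)) (IH i (w + 1)))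
                (cmeasM (cmeas_cst D (- (2^-1 : Cplx R))) (IH i.+1 (w + 1))).
apply: (eq_ind _ (cmeas _) H).
by apply/funext => t; rewrite mulNr.
Qed.

(** The Taylor polynomials at t of the function t^-w E_0, evaluated at n, form
    a primitive in t of the integrand up to sign. At t = n they give the value
    of the function, and at infinity they vanish as Re w > 0. *)
Lemma power_chain_taylor E (Ms : nat -> R) w (k : nat) (n : R) : euler_chain E ->
  (forall i t, 0 < t -> `|E i t| <= Ms i) -> 0 < Re w -> 0 < n ->
  (forall i, measurable_fun (setT : set (measurableTypeR R)) (E i)) ->
  cintble mu [set t | n <= t] (fun t => ((t - n) ^+ k / k`!%:R)%:C%C * power_chain E k.+1 0 w t) /\
  cint mu [set t | n <= t] (fun t => ((t - n) ^+ k / k`!%:R)%:C%C * power_chain E k.+1 0 w t)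
    = power_chain E 0 0 w n.
Proof.
move=> chE bE w0 n0 mE.
have ex := exhausts_ray n0; have [mD _ _ _ _] := ex.
pose f t : Cplx R := ((t - n) ^+ k / k`!%:R)%:C%C * power_chain E k.+1 0 w t.
pose T j t : Cplx R := ((t - n) ^+ j / j`!%:R)%:C%C * power_chain E j 0 w t.
pose F m t := \sum_(0 <= j < m) (-1) * T j t.
have cpol j t : is_derive t 1 (fun t => (t - n) ^+ j / j`!%:R) (j%:R * (t - n) ^+ j.-1 / j`!%:R).
  have d1 : is_derive t 1 (fun t : R => t - n) 1.
    by apply: (is_derive_eq (is_derive_sub' (f := fun t => t) (is_derive_id _ _) (is_derive_cst' n t))); rewrite subr0.
  apply: (is_derive_eq (is_derive_mul' (is_derive_comp' (is_derive_exp' j _) d1) (is_derive_cst' _ _))).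
  by rewrite mulr1 mulr0 addr0.
have dF m t : 0 < t ->
    is_cder (F m) t ((m%:R * (t - n) ^+ m.-1 / m`!%:R)%:C%C * power_chain E m 0 w t).
  move=> t0; elim: m => [|m IH].
    rewrite !mul0r; apply: (eq_ind _ (fun g => is_cder g t 0) (is_cder_cst 0 t)).
    by apply/funext => x; rewrite /F big_nil.
  have := is_cderD IH (is_cderZ (-1) (is_cderM (is_cder_real (cpol m t)) (power_chain_cder m 0 w chE t0))).
  move=> H; apply: (is_cder_eq (df := _ + _)).
    apply: (eq_ind _ (fun g => is_cder g t _) H).
    by apply/funext => x; rewrite /F big_nat_recr.
  rewrite mulN1r opprD addrA [X in X + _]addrN add0r mulrN opprK succnK.
  congr (_%:C%C * _); rewrite factS natrM; field.
  by rewrite -(natrD _ 1) !pnatr_eq0 -lt0n fact_gt0.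
have [M M0 HM] := power_chain_bound Ms k.+1 0 w.
have kf0 : 0 < k`!%:R :> R by rewrite ltr0n fact_gt0.
have if_ : cintble mu [set t | n <= t] f.
  have x1 : - Re w - 1 < - 1 by lra.
  have iC := integrableZl mD M (rayc_powR_integrable n0 x1).
  apply: (cintble_le mD _ (g := fun t => M * t `^ (- Re w - 1)) iC).
    apply: cmeasM; last by apply: cmeas_power_chain => // i; exact: measurable_funTS.
    apply: cmeas_real; apply: measurable_funM => //.
    by apply: measurable_funX; apply: measurable_funB.
  move=> t /= nt; have t0 : 0 < t by exact: lt_le_trans nt.
  rewrite /f Normc.normcM normc_real.
  have Hk : `|(t - n) ^+ k / k`!%:R| <= t `^ k%:R.
    rewrite normrM normfV (ger0_norm (ltW kf0)) normrX ger0_norm ?subr_ge0//.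
    rewrite (powR_mulrn _ (ltW t0)) ler_pdivrMr//.
    rewrite -[leLHS]mulr1 ler_pM ?exprn_ge0 ?subr_ge0 ?ler1n ?fact_gt0//.
    by rewrite lerXn2r ?nnegrE ?subr_ge0 ?(ltW t0)// gerBl ltW.
  rewrite (le_trans (ler_pM _ _ Hk (HM E t t0 (fun i => bE i t t0))))// ?normc_ge0//.
  rewrite mulrCA ler_wpM2l// -powRD; last by rewrite (gt_eqF t0) implybT.
  by rewrite -natr1 le_eqVlt; apply/orP; left; apply/eqP; congr (_ `^ _); ring.
have dFk t : 0 < t -> is_cder (F k.+1) t (f t).
  move=> t0; apply: is_cder_eq; first exact: dF.
  rewrite /f succnK; congr (_%:C%C * _); rewrite factS natrM; field.
  by rewrite -(natrD _ 1) !pnatr_eq0 -lt0n fact_gt0.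
split=> //; apply: (improper_cint ex _ dFk if_).
  move=> t t0.
  have := is_cderM (is_cder_real (cpol k t)) (power_chain_cder k.+1 0 w chE t0).
  by move=> [d1 d2]; split; [exact: is_derive_continuous d1|exact: is_derive_continuous d2].
rewrite -[X in _ --> X]add0r; apply: cvgDc; last first.
  rewrite (_ : - F k.+1 n = power_chain E 0 0 w n); first exact: cvg_cst.
  rewrite /F big_nat_recl//= big1 ?addr0.
    by rewrite /T expr0 divr1 mulN1r opprK mul1r.
  by move=> i _; rewrite /T subrr expr0n/= !mul0r mulr0.
have HT j : (fun N => T j (n + N.+1%:R)) @ \oo --> 0.
  have [Mj Mj0 HMj] := power_chain_bound Ms j 0 w.
  apply/cvg_normc => e e0.
  have e1 : 0 < e / (Mj + 1) by rewrite divr_gt0// ltr_wpDl.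
  have Nw0 : - Re w < 0 by rewrite oppr_lt0.
  have hN N : N%:R <= n + N.+1%:R :> R by rewrite -natr1; lra.
  have /cvgrPdist_lt/(_ _ e1) := cvg_powR_nat0 Nw0 hN.
  apply: filterS => N; rewrite sub0r normrN ger0_norm ?powR_ge0// subr0.
  set t := n + _; have t0 : 0 < t by rewrite /t addr_gt0.
  have jf0 : 0 < j`!%:R :> R by rewrite ltr0n fact_gt0.
  rewrite ltr_pdivlMr ?ltr_wpDl// => He; apply: le_lt_trans He.
  rewrite /T Normc.normcM normc_real.
  have nt : 0 <= t - n by rewrite /t addrAC subrr add0r.
  have Hk : `|(t - n) ^+ j / j`!%:R| <= t `^ j%:R.
    rewrite normrM normfV (ger0_norm (ltW jf0)) normrX ger0_norm//.
    rewrite (powR_mulrn _ (ltW t0)) ler_pdivrMr//.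
    rewrite -[leLHS]mulr1 ler_pM ?exprn_ge0 ?ler1n ?fact_gt0//.
    by rewrite lerXn2r ?nnegrE ?(ltW t0)// gerBl ltW.
  rewrite (le_trans (ler_pM _ _ Hk (HMj E t t0 (fun i => bE i t t0))))// ?normc_ge0//.
  rewrite mulrCA -powRD; last by rewrite (gt_eqF t0) implybT.
  rewrite (_ : j%:R + _ = - Re w); last by ring.
  by rewrite mulrC ler_wpM2l ?powR_ge0// lerDl.
elim: k.+1 => [|m IH].
  rewrite (_ : (fun _ => _) = fun=> 0); first exact: cvg_cst.
  by apply/funext => N; rewrite /F big_nil.
rewrite (_ : (fun _ => _) = fun N => F m (n + N.+1%:R) + (-1) * T m (n + N.+1%:R)); last first.
  by apply/funext => N; rewrite /F big_nat_recr.
rewrite -[X in _ --> X]addr0; apply: cvgDc; first exact: IH.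
by rewrite -(mulr0 (-1 : Cplx R)); apply: cvgMrc; exact: HT.
Qed.

End PowerChain.

(** * Exchanging integrals against a truncated power *)

Section FubiniKernel.
Context d (X : measurableType d) (R : realType).
Variable nu : {sigma_finite_measure set X -> \bar R}.
Notation mu := (@lebesgue_measure R).
Notation Re := (@complex.Re R).
Notation Im := (@complex.Im R).
Local Notation Dpos := ([set t : R | 0 < t] : set (measurableTypeR R)).
Variables (w q : X -> R) (k : R) (h : R -> R).
Hypotheses (mw : measurable_fun setT w) (mq : measurable_fun setT q).
Hypothesis w0 : forall x, 0 <= w x.
Hypothesis Hh : forall t, (\int[nu]_x (w x * truncpow k (t - q x))%:E = (h t)%:E)%E.

Lemma measurable_Dpos : measurable Dpos.
Proof.
rewrite (_ : Dpos = `]0, +oo[%classic); first exact: measurable_itv.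
by apply/seteqP; split=> t /=; rewrite in_itv/= andbT.
Qed.

Let fubini_real (psi : R -> R) :
  measurable_fun (setT : set (measurableTypeR R)) psi ->
  mu.-integrable setT (fun t => (h t * psi t)%:E) ->
  (forall x, w x != 0 -> mu.-integrable setT (fun t => (truncpow k (t - q x) * psi t)%:E)) ->
  nu.-integrable setT (fun x => (w x * Rintegral mu setT (fun t => truncpow k (t - q x) * psi t))%:E) /\
  Rintegral nu setT (fun x => w x * Rintegral mu setT (fun t => truncpow k (t - q x) * psi t)) =
  Rintegral mu setT (fun t => h t * psi t).
Proof.
move=> mpsi ih iw.
pose f (z : X * measurableTypeR R) : \bar R :=
  ((w z.1 * truncpow k (z.2 - q z.1)) * psi z.2)%:E.
have mk0 : measurable_fun setT (fun z : X * measurableTypeR R => w z.1 * truncpow k (z.2 - q z.1)).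
  apply: measurable_funM; first exact: measurableT_comp.
  apply: measurableT_comp; first exact: measurable_truncpow.
  by apply: measurable_funB => //; exact: measurableT_comp.
have mf : measurable_fun setT f.
  apply/measurable_EFinP; apply: measurable_funM => //.
  exact: measurableT_comp.
have h0 t : 0 <= h t.
  by rewrite -lee_fin -Hh; apply: integral_ge0 => x _; rewrite lee_fin mulr_ge0 ?truncpow_ge0.
have mkt t : measurable_fun setT (fun x => w x * truncpow k (t - q x)).
  apply: measurable_funM => //; apply: measurableT_comp; first exact: measurable_truncpow.
  exact: measurable_funB.
have iker t : nu.-integrable setT (fun x => (w x * truncpow k (t - q x))%:E).
  apply/integrableP; split; first exact/measurable_EFinP.
  rewrite (eq_integral (fun x => (w x * truncpow k (t - q x))%:E)); first by rewrite Hh ltry.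
  by move=> x _; rewrite gee0_abs// lee_fin mulr_ge0 ?truncpow_ge0.
have imf : (nu \x mu)%E.-integrable setT f.
  apply/(integrable21ltyP _ _ mf).
  have -> : (\int[mu]_y \int[nu]_x `|f (x, y)| = \int[mu]_y `|(h y * psi y)%:E|)%E.
    apply: eq_integral => t _.
    have E : (\int[nu]_x ((w x * truncpow k (t - q x))%:E * `|psi t|%:E) = (h t)%:E * `|psi t|%:E)%E.
      rewrite -Hh ge0_integralZr//; first [exact/measurable_EFinP|by rewrite lee_fin|
        by move=> x _; rewrite lee_fin mulr_ge0 ?truncpow_ge0].
    rewrite abse_EFin normrM (ger0_norm (h0 t)) EFinM -E.
    apply: eq_integral => x _; rewrite /f/= normrM ger0_norm ?EFinM//.
    by rewrite mulr_ge0 ?truncpow_ge0.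
  by have /integrableP[] := ih.
have FE : fubini_F mu f = (fun x => (w x * Rintegral mu setT (fun t => truncpow k (t - q x) * psi t))%:E).
  apply/funext => x; rewrite /fubini_F /f/=.
  have [->|wx] := eqVneq (w x) 0.
    by under eq_integral do rewrite !mul0r; rewrite integral0 mul0r.
  under eq_integral do rewrite -mulrA EFinM.
  rewrite integralZl//; last exact: iw.
  by rewrite EFinM /Rintegral fineK//; apply: integrable_fin_num => //; exact: iw.
have GE : fubini_G nu f = (fun t => (h t * psi t)%:E).
  apply/funext => t; rewrite /fubini_G /f/=.
  under eq_integral do rewrite EFinM.
  by rewrite integralZr// Hh EFinM.
split; first by rewrite -FE; exact: integrable_fubini_F.
rewrite /Rintegral; congr fine.
have : (\int[nu]_x fubini_F mu f x = \int[mu]_y fubini_G nu f y)%E := Fubini imf.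
by rewrite FE GE.
Qed.

(** With nonnegative w the hypothesis on h makes the double integral absolutely
    convergent. Integrability of the inner integral is asked only where w does
    not vanish, which is what allows a singular point of the kernel to be
    neutralised by giving it weight 0. *)
Lemma fubini_kernel (Psi : R -> Cplx R) :
  cmeas (setT : set (measurableTypeR R)) Psi ->
  cintble mu Dpos (fun t => (h t)%:C%C * Psi t) ->
  (forall x, w x != 0 -> cintble mu Dpos (fun t => (truncpow k (t - q x))%:C%C * Psi t)) ->
  cintble nu setT (fun x => (w x)%:C%C * cint mu Dpos (fun t => (truncpow k (t - q x))%:C%C * Psi t)) /\
  cint nu setT (fun x => (w x)%:C%C * cint mu Dpos (fun t => (truncpow k (t - q x))%:C%C * Psi t)) =
  cint mu Dpos (fun t => (h t)%:C%C * Psi t).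
Proof.
move=> [m1 m2] [i1 i2] iw.
have mD := measurable_Dpos.
have ext (u v : R -> R) : (fun t => u t * (v \_ Dpos) t) = (fun t => u t * v t) \_ Dpos.
  by apply/funext => t; rewrite /patch; case: ifP => _; rewrite ?mulr0.
have extI (u v : R -> R) : mu.-integrable Dpos (fun t => (u t * v t)%:E) ->
    mu.-integrable setT (fun t => (u t * (v \_ Dpos) t)%:E).
  move=> /(integrable_mkcond _ mD).
  apply: eq_integrable => // t _; rewrite /patch.
  by case: ifP => _; rewrite ?mulr0.
have extR (u v : R -> R) : Rintegral mu setT (fun t => u t * (v \_ Dpos) t) =
   Rintegral mu Dpos (fun t => u t * v t).
  by rewrite ext -Rintegral_mkcond.
have Rer (x : R) (s : Cplx R) : Re ((x%:C)%C * s) = x * Re s.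
  by rewrite ReM/= mul0r subr0.
have Imr (x : R) (s : Cplx R) : Im ((x%:C)%C * s) = x * Im s.
  by rewrite ImM/= mul0r addr0.
have Rec (f : R -> Cplx R) : Re (cint mu Dpos f) = Rintegral mu Dpos (fun t => Re (f t)).
  by [].
have Imc (f : R -> Cplx R) : Im (cint mu Dpos f) = Rintegral mu Dpos (fun t => Im (f t)).
  by [].
have [||| I1 R1] := @fubini_real ((fun t => Re (Psi t)) \_ Dpos).
- by apply/(measurable_restrictT _ mD); exact: measurable_funTS.
- by apply: extI; apply: eq_integrable i1 => // t _; rewrite Rer.
- move=> x wx; apply: extI; have [j1 _] := iw x wx.
  by apply: eq_integrable j1 => // t _; rewrite Rer.
have [||| I2 R2] := @fubini_real ((fun t => Im (Psi t)) \_ Dpos).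
- by apply/(measurable_restrictT _ mD); exact: measurable_funTS.
- by apply: extI; apply: eq_integrable i2 => // t _; rewrite Imr.
- move=> x wx; apply: extI; have [_ j2] := iw x wx.
  by apply: eq_integrable j2 => // t _; rewrite Imr.
split.
  split; [apply: eq_integrable I1 => // x _|apply: eq_integrable I2 => // x _].
    rewrite Rer Rec extR; congr (_ * _)%:E; apply: eq_Rintegral => t _; by rewrite Rer.
  rewrite Imr Imc extR; congr (_ * _)%:E; apply: eq_Rintegral => t _; by rewrite Imr.
have Recn (f : X -> Cplx R) : Re (cint nu setT f) = Rintegral nu setT (fun x => Re (f x)).
  by [].
have Imcn (f : X -> Cplx R) : Im (cint nu setT f) = Rintegral nu setT (fun x => Im (f x)).
  by [].
have eqC (a b : Cplx R) : Re a = Re b -> Im a = Im b -> a = b.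
  by case: a => ? ?; case: b => ? ? /= -> ->.
apply: eqC; rewrite ?Recn ?Imcn ?Rec ?Imc.
  transitivity (Rintegral mu Dpos (fun t => h t * Re (Psi t))).
    rewrite -extR -R1; apply: eq_Rintegral => x _; rewrite Rer Rec extR.
    congr (_ * _); apply: eq_Rintegral => t _; by rewrite Rer.
  by apply: eq_Rintegral => t _; rewrite Rer.
transitivity (Rintegral mu Dpos (fun t => h t * Im (Psi t))).
  rewrite -extR -R2; apply: eq_Rintegral => x _; rewrite Imr Imc extR.
  congr (_ * _); apply: eq_Rintegral => t _; by rewrite Imr.
by apply: eq_Rintegral => t _; rewrite Imr.
Qed.

End FubiniKernel.

(** * The continued function as a Mellin transform *)

Section PositiveLine.
Variable R : realType.
Notation mu := (@lebesgue_measure R).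
Notation normc := (@Normc.normc R).
Local Notation Dpos := ([set t : R | 0 < t] : set (measurableTypeR R)).
Local Notation ray1 := ([set t : R | 1 <= t] : set (measurableTypeR R)).
Local Notation oray1 := ([set t : R | 1 < t] : set (measurableTypeR R)).
Local Notation unit01 := ([set t : R | 0 < t <= 1] : set (measurableTypeR R)).

Let mD : measurable Dpos. Proof. exact: measurable_Dpos. Qed.
Let mray : measurable ray1.
Proof. by have [] := exhausts_ray (ltr01 : 0 < 1 :> R). Qed.
Let munit : measurable unit01. Proof. by have [] := exhausts_unit R. Qed.
Let moray : measurable oray1.
Proof.
rewrite (_ : oray1 = `]1, +oo[%classic); first exact: measurable_itv.
by apply/seteqP; split=> t /=; rewrite in_itv/= andbT.
Qed.

Let DposU : Dpos = unit01 `|` oray1.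
Proof.
apply/seteqP; split=> [t /= t0|t /= [/andP[]//|]]; last exact: lt_trans.
by have [t1|t1] := leP t 1; [left; rewrite t0|right].
Qed.

Let UoD : [disjoint unit01 & oray1].
Proof.
apply/disj_setPS => t /= [/andP[_ t1] t1']; by rewrite ltNge t1 in t1'.
Qed.

Let ray1_D1 : oray1 = ray1 `\ 1.
Proof.
apply/seteqP; split=> t /=; rewrite lt_neqAle.
  by move=> /andP[t1 ->]; split=> // /eqP; rewrite eq_sym (negbTE t1).
by move=> [-> t1]; rewrite andbT; apply/eqP => /esym.
Qed.

(** Majorants on the half-line need different exponents at 0 and at infinity. *)
Definition two_powers (y1 y2 t : R) : R := if t <= 1 then t `^ y1 else t `^ y2.

Lemma measurable_two_powers y1 y2 : measurable_fun (setT : set (measurableTypeR R)) (two_powers y1 y2).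
Proof.
apply: measurable_fun_ifT; try exact: measurable_powR.
exact: measurable_fun_ler.
Qed.

Lemma two_powers_integrable y1 y2 : -1 < y1 -> y2 < -1 ->
  mu.-integrable Dpos (EFin \o two_powers y1 y2).
Proof.
move=> y1P y2P; apply/integrableP; split.
  by apply/measurable_EFinP; apply: measurable_funTS; exact: measurable_two_powers.
have /integrableP[_ i1] := unit_powR_integrable y1P.
have /integrableP[_ i2] := ray_powR_integrable y2P.
rewrite DposU ge0_integral_setU//; last first.
  do 2 apply: measurableT_comp => //.
  by apply: measurable_funTS; exact: measurable_two_powers.
apply: lte_add_pinfty.
  have -> : (\int[mu]_(t in unit01) `|(EFin \o two_powers y1 y2) t| =
      \int[mu]_(t in unit01) `|(t `^ y1)%:E|)%E.
    apply: eq_integral => t; rewrite inE /= => /andP[_ t1]; by rewrite /two_powers t1.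
  exact: i1.
apply: le_lt_trans i2.
have -> : (\int[mu]_(t in [set t : R | (1 < t)%R]) `|(EFin \o two_powers y1 y2) t| =
      \int[mu]_(t in [set t : R | (1 < t)%R]) `|(t `^ y2)%:E|)%E.
  apply: eq_integral => t; rewrite inE /= => t1; by rewrite /two_powers leNgt t1.
apply: ge0_subset_integral => //.
  by do 2 apply: measurableT_comp => //; apply: measurable_funTS; exact: measurable_powR.
by move=> t /= /ltW.
Qed.

Lemma Dpos_cintble (f : R -> Cplx R) (M y1 y2 : R) : -1 < y1 -> y2 < -1 ->
  cmeas Dpos f ->
  (forall t, 0 < t <= 1 -> normc (f t) <= M * t `^ y1) ->
  (forall t, 1 < t -> normc (f t) <= M * t `^ y2) -> cintble mu Dpos f.
Proof.
move=> y1P y2P mf f1 f2.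
have iC := integrableZl mD M (two_powers_integrable y1P y2P).
apply: (cintble_le mD mf (g := fun t => M * two_powers y1 y2 t) iC) => t /= t0.
by rewrite /two_powers; case: ifPn => [t1|]; [apply: f1; rewrite t0|rewrite -ltNge; exact: f2].
Qed.

Lemma cint_split (f : R -> Cplx R) : cintble mu Dpos f ->
  cint mu Dpos f = cint mu unit01 f + cint mu ray1 f.
Proof.
move=> if_; have [i1 i2] := if_; have [m1 m2] := cintble_cmeas if_.
have key (h : R -> R) : mu.-integrable Dpos (EFin \o h) ->
    Rintegral mu Dpos h = Rintegral mu unit01 h + Rintegral mu ray1 h.
  move=> ih; have mh : measurable_fun Dpos (EFin \o h) := measurable_int _ ih.
  rewrite DposU Rintegral_setU//; [congr (_ + _)|by rewrite -DposU].
  rewrite /Rintegral; congr fine; rewrite ray1_D1; apply: integral_setD1.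
    by rewrite -ray1_D1.
  rewrite -ray1_D1; apply: measurable_funS mh => // t /= t1; exact: lt_trans t1.
by rewrite /cint !key.
Qed.

Lemma cintbleS (A B : set (measurableTypeR R)) (f : R -> Cplx R) : measurable A -> measurable B ->
  A `<=` B -> cintble mu B f -> cintble mu A f.
Proof. by move=> mA mB AB [i1 i2]; split; [exact: integrableS i1|exact: integrableS i2]. Qed.

End PositiveLine.

Lemma analytic_eq (R : realType) (f g : Cplx R -> Cplx R) (s0 : Cplx R) :
  (forall s, f s = g s) -> analytic_at f s0 -> analytic_at g s0.
Proof. by move=> fg; have -> : f = g by apply/funext. Qed.

Section Core.
Variable R : realType.
Notation mu := (@lebesgue_measure R).
Notation normc := (@Normc.normc R).
Notation Re := (@complex.Re R).
Notation Im := (@complex.Im R).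
Local Notation Dpos := ([set t : R | 0 < t] : set (measurableTypeR R)).
Local Notation ray1 := ([set t : R | 1 <= t] : set (measurableTypeR R)).
Local Notation unit01 := ([set t : R | 0 < t <= 1] : set (measurableTypeR R)).

Implicit Types (E : nat -> R -> R) (s : Cplx R) (t : R).

Variables (k : nat) (S C cB : R) (B : R -> R).
Hypotheses (S0 : 0 < S) (C0 : 0 <= C) (cB0 : 0 <= cB).
Hypothesis mB : measurable_fun (setT : set (measurableTypeR R)) B.
Let kappa : R := k%:R + S / 2.
Hypothesis B1 : forall t, t <= 1 -> B t = 0.
Hypothesis B2 : forall t, 1 <= t -> `|B t - C * t `^ kappa| <= cB * t `^ k%:R.

Let mD : measurable Dpos. Proof. exact: measurable_Dpos. Qed.
Let mray : measurable ray1.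
Proof. by have [] := exhausts_ray (ltr01 : 0 < 1 :> R). Qed.
Let munit : measurable unit01. Proof. by have [] := exhausts_unit R. Qed.

(** The density against which truncated powers of order k superpose to
    E 0 n * n^(-s/2). *)
Definition taylor_kernel (E : nat -> R -> R) (s : Cplx R) (t : R) : Cplx R :=
  (((k`!%:R)^-1 : R)%:C)%C * power_chain E k.+1 0 (s / 2) t.

Let V (t : R) : R := C * truncpow kappa t - B t.

(** The Mellin transform of V (t) = C t^kappa - B t, times the polynomial factor
    produced by k + 1 differentiations of t^(-s/2). The part of the transform
    over t <= 1, where V is a power, is evaluated and becomes the pole. *)
Definition mellin_defect (s : Cplx R) : Cplx R :=
  (((k`!%:R)^-1 : R)%:C)%C * (\prod_(l < k.+1) (s / 2 + l%:R)) *
  ((C%:C)%C * ((S%:C)%C / 2 - s / 2)^-1 +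
   cint mu ray1 (fun t => (V t)%:C%C * tpow (- k.+1%:R - s / 2) t)).

Lemma Re_half (s : Cplx R) : Re (s / 2) = Re s / 2.
Proof. by rewrite -real_halfC ReM/= mulr0 subr0. Qed.

Let mtruncpow m : measurable_fun (setT : set (measurableTypeR R)) (truncpow m).
Proof. exact: measurable_truncpow. Qed.

Let mV : measurable_fun (setT : set (measurableTypeR R)) V.
Proof. by apply: measurable_funB => //; apply: measurable_funM. Qed.

Let V1 t : 0 < t <= 1 -> V t = C * t `^ kappa.
Proof. by move=> /andP[t0 t1]; rewrite /V truncpow_pos// B1// subr0. Qed.

Let V2 t : 1 <= t -> `|V t| <= cB * t `^ k%:R.
Proof.
move=> t1; rewrite /V truncpow_pos ?(lt_le_trans ltr01)// distrC; exact: B2.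
Qed.

Let B_le t : 0 < t -> `|B t| <= (C + cB) * t `^ kappa.
Proof.
move=> t0; have [t1|t1] := leP t 1.
  by rewrite B1// normr0 mulr_ge0 ?powR_ge0 ?addr_ge0.
rewrite (_ : B t = (B t - C * t `^ kappa) + C * t `^ kappa); last by rewrite subrK.
rewrite (le_trans (ler_normD _ _))// addrC mulrDl lerD//.
  by rewrite ger0_norm// mulr_ge0 ?powR_ge0.
rewrite (le_trans (B2 (ltW t1)))// ler_wpM2l// ler_powR ?(ltW t1)//.
by rewrite /kappa lerDl divr_ge0// ltW.
Qed.

Let kf0 : 0 < (k`!%:R)^-1 :> R.
Proof. by rewrite invr_gt0 ltr0n fact_gt0. Qed.

Lemma taylor_kernel_bound (Ms : nat -> R) (s : Cplx R) : exists2 M : R, 0 <= M &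
  forall E t, 0 < t -> (forall i, `|E i t| <= Ms i) ->
    normc (taylor_kernel E s t) <= M * t `^ (- (Re s / 2) - k.+1%:R).
Proof.
have [M M0 H] := power_chain_bound Ms k.+1 0 (s / 2).
exists ((k`!%:R)^-1 * M); first by rewrite mulr_ge0// ltW.
move=> E t t0 HE; rewrite /taylor_kernel Normc.normcM normc_real gtr0_norm// -mulrA.
by rewrite ler_wpM2l ?(ltW kf0)// -Re_half H.
Qed.

Lemma cmeas_taylor_kernel E s : (forall i, measurable_fun (setT : set (measurableTypeR R)) (E i)) ->
  cmeas (setT : set (measurableTypeR R)) (taylor_kernel E s).
Proof. by move=> mE; apply: cmeasM; [exact: cmeas_cst|exact: cmeas_power_chain]. Qed.

Let cmeasDpos (f : R -> Cplx R) : cmeas (setT : set (measurableTypeR R)) f -> cmeas Dpos f.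
Proof. by move=> [m1 m2]; split; exact: measurable_funTS. Qed.

(** Extending the truncated power by 0 below n frees the domain of integration
    from n, as exchanging the integrals requires. *)
Lemma taylor_kernelE E (Ms : nat -> R) (s : Cplx R) (n : R) : (0 < k)%N -> euler_chain E ->
  (forall i t, 0 < t -> `|E i t| <= Ms i) -> 0 < Re s -> 0 < n ->
  (forall i, measurable_fun (setT : set (measurableTypeR R)) (E i)) ->
  cintble mu Dpos (fun t => (truncpow k%:R (t - n))%:C%C * taylor_kernel E s t) /\
  cint mu Dpos (fun t => (truncpow k%:R (t - n))%:C%C * taylor_kernel E s t) = ((E 0%N n)%:C)%C * tpow (- (s / 2)) n.
Proof.
move=> k0 chE bE s0 n0 mE.
have s20 : 0 < Re (s / 2) by rewrite Re_half divr_gt0.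
have [i1 i2] := power_chain_taylor k chE bE s20 n0 mE.
have [mn _ _ _ _] := exhausts_ray n0.
pose rayn : set (measurableTypeR R) := [set t : R | n <= t].
have sub : rayn `<=` Dpos by move=> t /= nt; exact: lt_le_trans nt.
pose f (t : R) : Cplx R := (truncpow k%:R (t - n))%:C%C * taylor_kernel E s t.
have fE t : rayn t -> ((t - n) ^+ k / k`!%:R)%:C%C * power_chain E k.+1 0 (s / 2) t = f t.
  move=> nt; rewrite /f /taylor_kernel mulrA -rmorphM/=; congr ((_ * _)%:C%C * _).
  move: nt; rewrite /rayn/= le_eqVlt => /predU1P[<-|nt].
    by rewrite subrr truncpow_neg// expr0n gtn_eqF.
  by rewrite truncpow_pos ?subr_gt0// powR_mulrn// subr_ge0 ltW.
have f0 t : ~ rayn t -> f t = 0.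
  by move=> /negP; rewrite -ltNge => tn; rewrite /f truncpow_neg ?mul0r// subr_le0 ltW.
have {}i1 : cintble mu rayn f := eq_cintble mn fE i1.
have {}i2 : cint mu rayn f = power_chain E 0 0 (s / 2) n by rewrite -i2; apply/esym/eq_cint.
have extE (g : R -> R) : (forall t, ~ rayn t -> g t = 0) -> g \_ rayn = g.
  move=> g0; apply/funext => t; rewrite /patch; case: ifPn => //.
  by rewrite notin_setE => /g0.
have extI (g : R -> R) : (forall t, ~ rayn t -> g t = 0) ->
    mu.-integrable rayn (EFin \o g) -> mu.-integrable Dpos (EFin \o g).
  move=> g0 /(integrable_mkcond _ mn) H.
  apply: (integrableS measurableT mD) => //.
  apply: eq_integrable H => // t _; rewrite /patch; case: ifPn => //.
  by rewrite notin_setE => /g0 /= ->.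
have Re0 t : ~ rayn t -> Re (f t) = 0 by move=> /f0 ->.
have Im0 t : ~ rayn t -> Im (f t) = 0 by move=> /f0 ->.
have [j1 j2] := i1.
split; first by split; [exact: extI Re0 j1|exact: extI Im0 j2].
transitivity (cint mu rayn f); last by rewrite i2.
have extR (g : R -> R) : (forall t, ~ rayn t -> g t = 0) ->
    Rintegral mu Dpos g = Rintegral mu rayn g.
  move=> g0; rewrite -(setIidr sub) Rintegral_mkcondr; apply: eq_Rintegral => t _.
  by rewrite extE.
by rewrite /cint (extR _ Re0) (extR _ Im0).
Qed.

Lemma taylor_kernel_const s t : taylor_kernel (@const_chain R) s t =
  ((((k`!%:R)^-1 : R)%:C)%C * (\prod_(l < k.+1) (s / 2 + l%:R))) * tpow (- k.+1%:R - s / 2) t.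
Proof. by rewrite /taylor_kernel power_chain_const mulrA (addrC (- (s / 2))). Qed.

Lemma const_chain_bound i t : `|@const_chain R i t| <= 1.
Proof. by rewrite /const_chain; case: eqP => _; rewrite ?normr1 ?normr0. Qed.

Lemma measurable_const_chain i : measurable_fun (setT : set (measurableTypeR R)) (@const_chain R i).
Proof. exact: measurable_cst. Qed.

(** With compact support the main term and the mean can be integrated
    separately, although neither need be integrable in the limit. *)
Lemma taylor_kernel_compact E (Ms : nat -> R) s (T : R) (h : R -> R) (ch : R) :
  (forall i t, 0 < t -> `|E i t| <= Ms i) ->
  (forall i, measurable_fun (setT : set (measurableTypeR R)) (E i)) ->
  (forall i t, T < t -> E i t = 0) -> 1 <= T -> Re s < S ->
  measurable_fun (setT : set (measurableTypeR R)) h ->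
  (forall t, 0 < t -> `|h t| <= ch * t `^ kappa) ->
  cintble mu Dpos (fun t => (h t)%:C%C * taylor_kernel E s t).
Proof.
move=> bE mE ET T1 sS mh hle.
have ch0 : 0 <= ch.
  by have := hle 1 ltr01; rewrite powR1 mulr1; apply: le_trans.
have [M M0 HM] := taylor_kernel_bound Ms s.
pose y := (S - Re s) / 2 - 1.
have y1 : -1 < y by rewrite /y; lra.
have T0 : 0 < T by lra.
have bnd t : 0 < t -> normc ((h t)%:C%C * taylor_kernel E s t) <= ch * M * t `^ y.
  move=> t0; rewrite Normc.normcM normc_real.
  rewrite (le_trans (ler_pM _ _ (hle t t0) (HM E t t0 (fun i => bE i t t0))))// ?normc_ge0//.
  rewrite mulrACA -powRD; last by rewrite (gt_eqF t0) implybT.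
  rewrite le_eqVlt; apply/orP; left; apply/eqP; congr (_ * _ `^ _).
  by rewrite /kappa /y -natr1; field.
have Ez t : T < t -> taylor_kernel E s t = 0.
  have Az j i w : T < t -> power_chain E j i w t = 0.
    move=> Tt; elim: j i w => [|j IH] i w /=; first by rewrite ET// mul0r.
    by rewrite !IH !mulr0 subrr.
  by move=> Tt; rewrite /taylor_kernel Az// mulr0.
have y20 : 0 <= y + 2 by rewrite /y; lra.
pose M' := ch * M * (1 + T `^ (y + 2)).
have cM0 : 0 <= ch * M by rewrite mulr_ge0.
apply: (@Dpos_cintble R _ M' y (-2)) => //; first by lra.
- apply: cmeasDpos; apply: cmeasM; [exact: cmeas_real|exact: cmeas_taylor_kernel].
- move=> t /andP[t0 t1]; apply: le_trans (bnd t t0) _.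
  by rewrite ler_wpM2r ?powR_ge0// /M' ler_peMr// lerDl powR_ge0.
- move=> t t1; have t0 : 0 < t by exact: lt_trans t1.
  have [Tt|tT] := ltP T t.
    by rewrite Ez// mulr0 Normc.normc0 mulr_ge0 ?powR_ge0// mulr_ge0 ?addr_ge0 ?powR_ge0.
  apply: le_trans (bnd t t0) _; rewrite /M' -!mulrA ler_wpM2l// ler_wpM2l//.
  rewrite (_ : y = (y + 2) + -2); last by ring.
  rewrite [t `^ _]powRD; last by rewrite (gt_eqF t0) implybT.
  rewrite ler_wpM2r ?powR_ge0//.
  apply: (@le_trans _ _ (T `^ (y + 2))).
    by rewrite ge0_ler_powR ?nnegrE ?(ltW t0) ?(ltW T0).
  by rewrite (_ : y + 2 - 2 + 2 = y + 2) ?lerDr//; ring.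
Qed.

(** A pole plus an analytic Mellin transform, multiplied by k + 1 affine
    factors. *)
Lemma mellin_defect_analytic (s0 : Cplx R) : 0 < Re s0 -> s0 != (S%:C)%C -> analytic_at mellin_defect s0.
Proof.
move=> r0 s0S.
have H : analytic_at (fun s => (C%:C)%C * ((S%:C)%C / 2 - s / 2)^-1 +
   cint mu ray1 (fun t => (V t)%:C%C * tpow (- k.+1%:R - s / 2) t)) s0.
  apply: analytic_add.
    have := analytic_linM ((C * 2)%:C)%C 0 (analytic_pole s0S).
    apply: analytic_eq => s.
    rewrite mul0r addr0 -mulrBl invfM invrK mulrCA mulrC.
    by rewrite rmorphM rmorph_nat; ring.
  apply: (mellin_analytic (C := cB) (y := k%:R)).
  - exact: measurable_funTS.
  - by move=> t t1; exact: V2.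
  - by rewrite ReN Re_natC -natr1; lra.
rewrite /mellin_defect.
have lin n : analytic_at (fun s => (((k`!%:R)^-1 : R)%:C)%C * (\prod_(l < n) (s / 2 + l%:R)) *
  ((C%:C)%C * ((S%:C)%C / 2 - s / 2)^-1 +
   cint mu ray1 (fun t => (V t)%:C%C * tpow (- k.+1%:R - s / 2) t))) s0.
  elim: n => [|n IH].
    have := analytic_linM (((k`!%:R)^-1 : R)%:C)%C 0 H.
    by apply: analytic_eq => s; rewrite mul0r addr0 big_ord0 mulr1.
  have := analytic_linM (n%:R) (2^-1) IH.
  apply: analytic_eq => s; rewrite big_ord_recr/=.
  by ring.
exact: lin.
Qed.

Let prefactor (s : Cplx R) : Cplx R :=
  (((k`!%:R)^-1 : R)%:C)%C * (\prod_(l < k.+1) (s / 2 + l%:R)).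

Let powkappa s t : 0 < t ->
  ((t `^ kappa)%:C)%C * tpow (- k.+1%:R - s / 2) t = tpow ((S%:C)%C / 2 - s / 2 - 1) t.
Proof.
move=> t0; rewrite -tpow_real// -tpowD.
have -> : (kappa%:C)%C + (- k.+1%:R - s / 2) = (S%:C)%C / 2 - s / 2 - 1 :> Cplx R.
  by rewrite /kappa rmorphD/= rmorphM/= real_natC real_halfC -natr1; ring.
by [].
Qed.

Lemma defect_kernel_const s : 0 < Re s < S ->
  cint mu Dpos (fun t => (V t)%:C%C * taylor_kernel (@const_chain R) s t) = mellin_defect s.
Proof.
move=> /andP[s0 sS].
pose f t : Cplx R := (V t)%:C%C * tpow (- k.+1%:R - s / 2) t.
have nrm t : 0 < t -> normc (f t) = `|V t| * t `^ (- k.+1%:R - Re s / 2).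
  by move=> t0; rewrite /f Normc.normcM normc_real normc_tpow// ReB' ReN Re_natC Re_half.
have mf : cmeas (setT : set (measurableTypeR R)) f.
  by apply: cmeasM; [exact: cmeas_real|exact: cmeas_tpow].
have if_ : cintble mu Dpos f.
  apply: (@Dpos_cintble R _ (C + cB) ((S - Re s) / 2 - 1) (- Re s / 2 - 1)); [lra|lra| | |].
  - exact: cmeasDpos.
  - move=> t t01; have /andP[t0 t1] := t01; rewrite nrm// V1// ger0_norm ?mulr_ge0 ?powR_ge0//.
    rewrite -mulrA -powRD; last by rewrite (gt_eqF t0) implybT.
    rewrite (_ : kappa + _ = (S - Re s) / 2 - 1); last by rewrite /kappa -natr1; field.
    by rewrite ler_wpM2r ?powR_ge0// lerDl.
  - move=> t t1; have t0 : 0 < t by exact: lt_trans t1.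
    rewrite nrm// (le_trans (ler_wpM2r _ (V2 (ltW t1)))) ?powR_ge0//.
    rewrite -mulrA -powRD; last by rewrite (gt_eqF t0) implybT.
    rewrite (_ : k%:R + _ = - Re s / 2 - 1); last by rewrite -natr1; field.
    by rewrite ler_wpM2r ?powR_ge0// lerDr.
transitivity (prefactor s * cint mu Dpos f).
  by rewrite -cintZ//; apply: eq_cint => t _; rewrite taylor_kernel_const mulrCA.
rewrite /mellin_defect -/(prefactor s); congr (_ * _); rewrite cint_split//; congr (_ + _).
pose w : Cplx R := (S%:C)%C / 2 - s / 2 - 1.
have w1 : -1 < Re w.
  by rewrite /w ReB' ReB' !Re_half/=; lra.
have [iw ew] := unit_tpow w1.
rewrite -[X in _ = _ * X^-1](subrK 1) -/w -ew -cintZ//.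
apply: eq_cint => t t01; have /andP[t0 t1] := t01.
by rewrite /f V1// rmorphM/= -mulrA powkappa.
Qed.

(** To the right of the pole B is integrable without subtracting its main term,
    and the integral over [1, oo[ of the main term cancels the pole. *)
Lemma mean_kernel_const s : S < Re s ->
  cintble mu Dpos (fun t => (B t)%:C%C * taylor_kernel (@const_chain R) s t) /\
  cint mu Dpos (fun t => (B t)%:C%C * taylor_kernel (@const_chain R) s t) = - mellin_defect s.
Proof.
move=> Ss.
pose f t : Cplx R := (B t)%:C%C * tpow (- k.+1%:R - s / 2) t.
have if_ : cintble mu Dpos f.
  apply: (@Dpos_cintble R _ (C + cB) 0 ((S - Re s) / 2 - 1)); [lra|lra| | |].
  - by apply: cmeasDpos; apply: cmeasM; [exact: cmeas_real|exact: cmeas_tpow].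
  - move=> t /andP[t0 t1]; rewrite /f B1// mul0r Normc.normc0.
    by rewrite mulr_ge0 ?powR_ge0 ?addr_ge0.
  - move=> t t1; have t0 : 0 < t by exact: lt_trans t1.
    rewrite /f Normc.normcM normc_real normc_tpow// ReB' ReN Re_natC Re_half.
    rewrite (le_trans (ler_wpM2r _ (B_le t0))) ?powR_ge0//.
    rewrite -mulrA -powRD; last by rewrite (gt_eqF t0) implybT.
    by rewrite (_ : kappa + _ = (S - Re s) / 2 - 1)// /kappa -natr1; field.
have E t : (B t)%:C%C * taylor_kernel (@const_chain R) s t = prefactor s * f t.
  by rewrite taylor_kernel_const mulrCA.
split.
  by apply: (eq_cintble mD _ (cintbleZ mD (prefactor s) if_)) => t _; rewrite E.
transitivity (prefactor s * cint mu Dpos f).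
  by rewrite -cintZ//; apply: eq_cint => t _; rewrite E.
rewrite /mellin_defect -/(prefactor s) -mulrN; congr (_ * _); rewrite cint_split//.
rewrite [cint mu unit01 f](_ : _ = 0); last first.
  rewrite -(cint0 mu unit01); apply: eq_cint => t t01; have /andP[_ t1] := t01.
  by rewrite /f B1// mul0r.
pose w : Cplx R := (S%:C)%C / 2 - s / 2 - 1.
have w1 : Re w < -1.
  by rewrite /w ReB' ReB' !Re_half/=; lra.
have [iw ew] := ray_tpow w1.
have iray : cintble mu ray1 f.
  by apply: cintbleS if_ => // t /= t1; exact: lt_le_trans t1.
rewrite add0r.
have -> : cint mu ray1 (fun t => (V t)%:C%C * tpow (- k.+1%:R - s / 2) t) =
    (C%:C)%C * cint mu ray1 (tpow w) + (-1) * cint mu ray1 f.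
  rewrite -!cintZ// -cintD//; [|exact: cintbleZ|exact: cintbleZ].
  apply: eq_cint => t t1; have t0 : 0 < t by exact: lt_le_trans t1.
  rewrite /V truncpow_pos// rmorphB/= rmorphM/= mulrBl -mulrA powkappa// -/w /f.
  by rewrite mulN1r.
rewrite ew /w subrK; ring.
Qed.

(** Dominated convergence: near 0 the difference V is O(t^kappa) since B
    vanishes there, and at infinity the quadrature estimate makes it O(t^k);
    the two powers of t are integrable precisely for 0 < Re s < S. *)
Lemma defect_kernel_cvg (E : nat -> nat -> R -> R) (Ms : nat -> R) s : 0 < Re s < S ->
  (forall n i t, 0 < t -> `|E n i t| <= Ms i) ->
  (forall n i, measurable_fun (setT : set (measurableTypeR R)) (E n i)) ->
  (forall i t, 0 < t -> E n i t @[n --> \oo] --> @const_chain R i t) ->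
  (fun n => cint mu Dpos (fun t => (V t)%:C%C * taylor_kernel (E n) s t)) @ \oo --> mellin_defect s.
Proof.
move=> sS bE mE EE; rewrite -(defect_kernel_const sS); have /andP[s0 sS'] := sS.
have [M M0 HM] := taylor_kernel_bound Ms s.
have H1 : -1 < (S - Re s) / 2 - 1 by lra.
have H2 : - Re s / 2 - 1 < -1 by lra.
have iC := integrableZl mD ((C + cB) * M) (two_powers_integrable H1 H2).
have [|||||_ H //] := @cint_dct _ _ R mu Dpos mD (fun n t => (V t)%:C%C * taylor_kernel (E n) s t)
  (fun t => (V t)%:C%C * taylor_kernel (@const_chain R) s t)
  (fun t => (C + cB) * M * two_powers ((S - Re s) / 2 - 1) (- Re s / 2 - 1) t) _.
- by move=> n; apply: cmeasDpos; apply: cmeasM; [exact: cmeas_real|exact: cmeas_taylor_kernel].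
- apply: cmeasDpos; apply: cmeasM; [exact: cmeas_real|].
  apply: cmeas_taylor_kernel; exact: measurable_const_chain.
- move=> t /= t0; apply: cvgMrc; rewrite /taylor_kernel; apply: cvgMrc; apply: power_chain_lim => i.
  exact: EE.
- exact: iC.
- move=> n t /= t0; rewrite Normc.normcM normc_real.
  have HP := HM (E n) t t0 (fun i => bE n i t t0).
  rewrite /two_powers; case: ifPn => [t1|].
    rewrite V1 ?t0// (le_trans (ler_wpM2l _ HP))// ger0_norm ?mulr_ge0 ?powR_ge0//.
    rewrite mulrACA -powRD; last by rewrite (gt_eqF t0) implybT.
    rewrite (_ : kappa + _ = (S - Re s) / 2 - 1); last by rewrite /kappa -natr1; field.
    by rewrite ler_wpM2r ?powR_ge0// ler_wpM2r// lerDl.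
  rewrite -ltNge => t1; rewrite (le_trans (ler_pM _ _ (V2 (ltW t1)) HP)) ?normc_ge0//.
  rewrite mulrACA -powRD; last by rewrite (gt_eqF t0) implybT.
  rewrite (_ : k%:R + _ = - Re s / 2 - 1); last by rewrite -natr1; field.
  by rewrite ler_wpM2r ?powR_ge0// ler_wpM2r// lerDr.
Qed.

Lemma mean_le t : 0 < t -> `|B t| <= (C + cB) * t `^ kappa.
Proof. exact: B_le. Qed.

End Core.

(** * The radial profile and its dilations *)

Section Profile.
Variables (R : realType) (d : nat).

(** The restriction of g to a coordinate axis. It is smooth on the whole line,
    which the profile given by radiality need not be, and its derivatives are
    iterated partial derivatives of g. *)
Lemma radial_profile (a : R) (g : 'rV[R]_d -> R) : (1 <= d)%N -> 0 < a ->
  Cc_infty g -> radial g -> support_of g `<=` box a -> g 0 = 1 ->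
  exists G : nat -> R -> R, [/\ forall j (r : R), is_derive r 1 (G j) (G j.+1 r),
    forall j r, a < `|r| -> G j r = 0,
    forall j, exists M, forall r, `|G j r| <= M,
    forall x, g x = G 0%N (enorm x) & G 0%N 0 = 1].
Proof.
move=> d1 a0 [sg _] [G0 gG] supp g0.
pose i0 : 'I_d := Ordinal d1.
pose e : 'rV[R]_d := delta_mx ord0 i0.
pose h j : 'rV[R]_d -> R := foldr (@pderive R d) g (nseq j i0).
pose G j (r : R) := h j (r *: e).
have dG j (r : R) : is_derive r 1 (G j) (G j.+1 r).
  have [_ dh] := sg (nseq j i0).
  have E : (fun u : R => u^-1 *: ((G j \o shift r) (u *: (1 : R)) - G j r)) =
           (fun u : R => u^-1 *: ((h j \o shift (r *: e)) (u *: e) - h j (r *: e))).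
    by apply/funext => u; rewrite /G /= /shift scalerDl /GRing.scale/= mulr1.
  split.
    by rewrite /derivable E; exact: (dh i0 (r *: e)).
  by rewrite /derive E.
have ej j : e ord0 j = (j == i0)%:R by rewrite mxE eqxx.
(* Outside [-a, a] the profile is locally zero, hence so are its derivatives. *)
have zG j r : a < `|r| -> G j r = 0.
  elim: j r => [|j IH] r ar.
    apply/eqP/negPn/negP => Gr.
    have /supp/(_ i0) : support_of g (r *: e) by apply: subset_closure.
    by rewrite mxE ej eqxx mulr1 -ler_norml leNgt ar.
  have [_ <-] := dG j r.
  have H : is_derive r 1 (fun=> 0 : R) (0 : R) := is_derive_cst' 0 r.
  have [_ //] : is_derive r 1 (G j) 0.
  apply: (near_eq_is_derive _ H); apply/nbhs_normP.
  exists (`|r| - a); rewrite /= ?subr_gt0// => u /= ur; rewrite IH//.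
  by have := lerB_dist r (r - u); rewrite subKr; move: ur; lra.
have en r : enorm (r *: e) = `|r|.
  rewrite /enorm (bigD1 i0)//= mxE ej eqxx mulr1 big1 ?addr0 ?sqrtr_sqr//.
  by move=> j /negbTE ji; rewrite mxE ej ji mulr0 expr0n.
exists G; split=> //.
- move=> j; have aa : - a <= a by lra.
  have cG : {within `[- a, a], continuous (fun r => `|G j r|)}.
    apply: continuous_subspaceT => r.
    apply: (@continuous_comp _ _ _ (G j) (fun x => `|x|)).
      exact: is_derive_continuous (dG j r).
    exact: norm_continuous.
  have [c _ Hc] := EVT_max aa cG.
  exists `|G j c| => r; have [ra|ar] := lerP `|r| a.
    by apply: Hc; rewrite in_itv/= -ler_norml.
  by rewrite zG// normr0.
- move=> x; rewrite /G /h/= !gG; congr G0.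
  by rewrite -/(e) en ger0_norm// sqrtr_ge0.
- by rewrite /G scale0r.
Qed.

Section Chain.
Variables (a : R) (G : nat -> R -> R) (M : nat -> R).
Hypothesis a0 : 0 < a.
Hypothesis dG : forall j (r : R), is_derive r 1 (G j) (G j.+1 r).
Hypothesis zG : forall j r, a < `|r| -> G j r = 0.
Hypothesis bG : forall j r, `|G j r| <= M j.
Hypothesis G0 : G 0%N 0 = 1.

(** The terms r^i G^(i) (r) at r = c sqrt t stay bounded uniformly in c, since
    G is supported in [-a, a]. *)
Definition dilate (c : R) (i : nat) (t : R) : R :=
  (c * Num.sqrt t) ^+ i * G i (c * Num.sqrt t).

Lemma euler_dilate c : euler_chain (dilate c).
Proof.
move=> i t t0.
have st : 0 < Num.sqrt t by rewrite sqrtr_gt0.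
have d1 : is_derive t 1 (fun t => c * Num.sqrt t) (c * (2 * Num.sqrt t)^-1).
  apply: (is_derive_eq (is_derive_mul' (is_derive_cst' c t) (is_derive1_sqrt t0))).
  by rewrite mul0r add0r.
apply: (is_derive_eq (is_derive_mul' (is_derive_comp' (is_derive_exp' i _) d1)
                                     (is_derive_comp' (dG i _) d1))).
have tE : t^-1 = (Num.sqrt t ^+ 2)^-1 by rewrite sqr_sqrtr// ltW.
have cE : c * (2 * Num.sqrt t)^-1 = (c * Num.sqrt t) * (2 * Num.sqrt t ^+ 2)^-1.
  by field; exact: lt0r_neq0.
rewrite /dilate tE cE; move: (c * Num.sqrt t) (lt0r_neq0 st) => r sn0.
case: i => [|i]; first by rewrite /= !expr0 expr1; field.
by rewrite succnK !exprS; field.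
Qed.

Lemma dilate_bound c i t : 0 <= c -> `|dilate c i t| <= a ^+ i * M i.
Proof.
move=> c0; have M0 : 0 <= M i by exact: le_trans (bG i 0).
have r0 : 0 <= c * Num.sqrt t by rewrite mulr_ge0// sqrtr_ge0.
have [ra|ar] := lerP `|c * Num.sqrt t| a; last first.
  by rewrite /dilate zG// mulr0 normr0 mulr_ge0// exprn_ge0// ltW.
by rewrite /dilate normrM ler_pM// normrX lerXn2r ?nnegrE// ltW.
Qed.

Lemma dilate_zero c i t T : 0 < c -> a <= c * Num.sqrt T -> 0 <= T -> T < t -> dilate c i t = 0.
Proof.
move=> c0 aT T0 Tt; rewrite /dilate zG ?mulr0//.
have st : Num.sqrt T < Num.sqrt t by rewrite ltr_sqrt//; exact: le_lt_trans Tt.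
rewrite ger0_norm ?mulr_ge0 ?sqrtr_ge0 ?(ltW c0)//.
by apply: le_lt_trans aT _; rewrite ltr_pM2l.
Qed.

Lemma measurable_dilate c i : measurable_fun (setT : set (measurableTypeR R)) (dilate c i).
Proof.
have ms : measurable_fun (setT : set (measurableTypeR R)) (fun t : R => c * Num.sqrt t).
  apply: measurable_funM => //.
  by apply: continuous_measurable_fun; exact: sqrt_continuous.
apply: measurable_funM; first exact: measurable_funX.
apply: measurableT_comp => //; apply: continuous_measurable_fun => r.
exact: is_derive_continuous (dG i r).
Qed.

Lemma dilate_lim (c : nat -> R) i t : c n @[n --> \oo] --> 0 ->
  dilate (c n) i t @[n --> \oo] --> @const_chain R i t.
Proof.
move=> c0.
have r0 : c n * Num.sqrt t @[n --> \oo] --> 0.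
  by rewrite -(mul0r (Num.sqrt t)); apply: cvgMl.
have Gc : G i (c n * Num.sqrt t) @[n --> \oo] --> G i 0.
  have cG : {for 0, continuous (G i)} := is_derive_continuous (dG i 0).
  exact: (cvg_comp _ _ r0 cG).
have rX : (c n * Num.sqrt t) ^+ i @[n --> \oo] --> ((i == 0%N)%:R : R).
  elim: (i) => [|j IH]; first by under eq_fun do rewrite expr0; exact: cvg_cst.
  under eq_fun do rewrite exprS.
  rewrite (_ : (j.+1 == 0%N)%:R = 0 * (j == 0%N)%:R :> R); last by rewrite mul0r.
  exact: cvgM.
rewrite /const_chain (_ : (i == 0%N)%:R = (i == 0%N)%:R * G i 0 :> R); last first.
  by case: (i) => [|j]; rewrite ?G0 ?mulr1 ?mul0r.
exact: cvgM.
Qed.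

End Chain.
End Profile.

(** * The punctured lattice and the origin *)

Section Lattice.
Variables (R : realType) (d : nat).
Notation normc := (@Normc.normc R).
Local Notation cnt := (@counting nat R).

(** Sums over the punctured lattice become integrals for the counting measure
    on the naturals, to which Fubini applies. *)
Lemma enum_Zd0 : (1 <= d)%N -> exists e : nat -> 'rV[int]_d, set_bij setT (@Zd0 d) e.
Proof.
move=> d1; pose i0 : 'I_d := Ordinal d1.
pose f (n : nat) : 'rV[int]_d := const_mx (n.+1%:Z).
have fi : {in [set: nat] &, injective f}.
  by move=> m n _ _ /rowP/(_ i0); rewrite !mxE => -[].
have fZ : f @` [set: nat] `<=` @Zd0 d.
  move=> _ [n _ <-]; apply/negP => /eqP/rowP/(_ i0); by rewrite !mxE.
have inf : ~ finite_set (@Zd0 d).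
  move=> /(sub_finite_set fZ) H; apply: infinite_nat.
  by rewrite -(eq_finite_set (inj_card_eq fi)).
have H : (@Zd0 d #= [set: nat])%card by apply: eq_card_nat => //; exact: countableP.
have /pcard_eqP[f'] := H; have [_ inj_f' surj_f'] : set_bij (@Zd0 d) setT f' := bij.
have /choice[e He] : forall n : nat, exists i, Zd0 i /\ f' i = n.
  by move=> n; have [i Zi <-] := surj_f' n I; exists i.
exists e; split.
- by move=> n _; case: (He n).
- by move=> m n _ _ emn; have [_ <-] := He m; have [_ <-] := He n; rewrite emn.
- move=> i Zi; exists (f' i) => //; have [Ze fe] := He (f' i).
  by apply: inj_f'; rewrite ?inE.
Qed.

Variable e : nat -> 'rV[int]_d.
Hypothesis bije : set_bij setT (@Zd0 d) e.

Lemma integral_enum (u : 'rV[int]_d -> \bar R) : (forall i, 0 <= u i)%E ->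
  (\int[cnt]_j u (e j) = \esum_(i in @Zd0 d) u i)%E.
Proof.
move=> u0; rewrite ge0_integral_count// nneseries_esumT//.
by rewrite (reindex_esum _ _ _ _ bije).
Qed.

Lemma csum_cint (u : 'rV[int]_d -> Cplx R) :
  csum (@Zd0 d) u = cint cnt setT (u \o e).
Proof.
have key (v : 'rV[int]_d -> R) : rsum (@Zd0 d) v = Rintegral cnt setT (v \o e).
  rewrite /rsum /Rintegral; congr fine; rewrite integralE; congr (_ - _)%E.
    rewrite -(@integral_enum ((EFin \o v)^\+)%E)//.
    by apply: eq_integral => j _; rewrite !funeposE.
  rewrite -(@integral_enum ((EFin \o v)^\-)%E)//.
  by apply: eq_integral => j _; rewrite !funenegE.
by rewrite /csum /cint !key.
Qed.

Lemma csummable_cintble (u : 'rV[int]_d -> Cplx R) :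
  cintble cnt setT (u \o e) -> csummable (@Zd0 d) u.
Proof.
move=> /(cintble_norm measurableT)/integrableP[_].
by rewrite /csummable /summable -(@integral_enum (fun i => `|(normc (u i))%:E|%E)).
Qed.

End Lattice.

Section LatticeMean.
Variables (R : realType) (d : nat) (al : 'I_d -> nat) (k : nat).

Lemma lnorm2_0 : lnorm2 R (0 : 'rV[int]_d) = 0.
Proof. by rewrite /lnorm2 big1// => j _; rewrite mxE expr0n. Qed.

Lemma lweight0_le1 : lweight R al 0 <= 1.
Proof.
apply: prodr_ile1 => j _; rewrite mxE expr0n; by case: eqP; rewrite ?lexx ?ler01.
Qed.

Lemma lnorm2_ge1 (i : 'rV[int]_d) : i != 0 -> 1 <= lnorm2 R i.
Proof.
move=> i0; have [j ij] : exists j, i ord0 j != 0.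
  apply/existsP; apply: contraNT i0; rewrite negb_exists => /forallP H.
  by apply/eqP/rowP => j; rewrite mxE; apply/eqP; have := H j; rewrite negbK.
rewrite /lnorm2 (bigD1 j)//= ler_wpDr ?sumr_ge0// => [l _|]; first exact: sqr_ge0.
have : (1 <= i ord0 j ^+ 2)%R by nia.
by rewrite -(ler_int R) rmorphXn.
Qed.

Lemma esum_Zd0 (b : R -> R) (t : R) :
  (\esum_(i in setT) (lweight R al i * truncpow k%:R (t - lnorm2 R i))%:E = (b t)%:E)%E ->
  (\esum_(i in @Zd0 d) (lweight R al i * truncpow k%:R (t - lnorm2 R i))%:E =
    (b t - lweight R al 0 * truncpow k%:R t)%:E)%E.
Proof.
move=> Hb; pose u i := (lweight R al i * truncpow k%:R (t - lnorm2 R i))%:E.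
have u0 i : (0 <= u i)%E by rewrite lee_fin mulr_ge0 ?lweight_ge0 ?truncpow_ge0.
have := esumID [set 0] setT u (fun i _ => u0 i).
rewrite Hb !setTI esum_set1// {1}/u lnorm2_0 subr0.
rewrite (_ : ~` [set 0] = @Zd0 d); last first.
  by apply/seteqP; split=> i /= => [/eqP|/eqP].
by move=> H; rewrite EFinB H addeAC subee// add0e.
Qed.

End LatticeMean.

Section TupleMean.
Variables (R : realType) (d : nat) (al : 'I_d -> nat) (k : R).

(** The weight is switched off at the origin, where the kernel is singular. *)
Definition tweight_off0 (x : d.-tuple (measurableTypeR R)) : R :=
  if tnorm2 x == 0 then 0 else tweight al x.

Lemma tweight_off0_ge0 x : 0 <= tweight_off0 x.
Proof. by rewrite /tweight_off0; case: ifP => // _; exact: tweight_ge0. Qed.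

Lemma measurable_tweight_off0 : measurable_fun setT tweight_off0.
Proof.
apply: measurable_fun_ifT => //; last exact: measurable_tweight.
apply: measurable_fun_eqr => //; exact: measurable_tnorm2.
Qed.

End TupleMean.

(** The origin is a null set: along the first coordinate the correction is
    supported at the single point 0. *)
Lemma integral_tweight_off0 (R : realType) d (al : 'I_d -> nat) (k t : R) : (1 <= d)%N ->
  (\int[@lebesgue_tuple R d]_x (tweight_off0 al x * truncpow k (t - tnorm2 x))%:E =
   \int[@lebesgue_tuple R d]_x (tweight al x * truncpow k (t - tnorm2 x))%:E)%E.
Proof.
case: d al => // d al _.
pose z (x : d.+1.-tuple (measurableTypeR R)) : R :=
  if tnorm2 x == 0 then tweight al x else 0.
have mz : measurable_fun setT z.
  apply: measurable_fun_ifT => //; first by apply: measurable_fun_eqr => //; exact: measurable_tnorm2.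
  exact: measurable_tweight.
have z0 x : 0 <= z x by rewrite /z; case: ifP => // _; exact: tweight_ge0.
have mp : measurable_fun setT (fun x : d.+1.-tuple (measurableTypeR R) => truncpow k (t - tnorm2 x)).
  apply: measurableT_comp; first exact: measurable_truncpow.
  by apply: measurable_funB => //; exact: measurable_tnorm2.
have mzp : measurable_fun setT (fun x => (z x * truncpow k (t - tnorm2 x))%:E).
  by apply/measurable_EFinP; exact: measurable_funM.
have -> : (\int[@lebesgue_tuple R d.+1]_x (tweight al x * truncpow k (t - tnorm2 x))%:E =
  \int[@lebesgue_tuple R d.+1]_x ((tweight_off0 al x * truncpow k (t - tnorm2 x))%:E + (z x * truncpow k (t - tnorm2 x))%:E))%E.
  apply: eq_integral => x _; rewrite -EFinD -mulrDl /tweight_off0 /z.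
  by case: ifP => _; rewrite ?add0r ?addr0.
rewrite ge0_integralD//; last 3 first.
- by move=> x _; rewrite lee_fin mulr_ge0 ?tweight_off0_ge0 ?truncpow_ge0.
- by apply/measurable_EFinP; apply: measurable_funM => //; exact: measurable_tweight_off0.
- by move=> x _; rewrite lee_fin mulr_ge0 ?truncpow_ge0.
rewrite [X in (_ + X)%E](_ : _ = 0%E) ?adde0//.
rewrite integral_tuple_cons//; last by move=> x; rewrite lee_fin mulr_ge0 ?truncpow_ge0.
set g := fun u => _.
have g0 u : u != 0 -> g u = 0%E.
  move=> u0; rewrite /g; under eq_integral => x _.
    rewrite /z (_ : (tnorm2 _ == 0) = false) ?mul0r; last first.
      rewrite tnorm2_cons gt_eqF// ltr_wpDr ?tnorm2_ge0// lt_neqAle sqr_ge0 andbT eq_sym.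
      by rewrite expf_eq0/=.
    over.
  by rewrite integral0.
have mS : measurable ([set: measurableTypeR R] `\ (0 : R)) by apply: measurableD.
rewrite -(@integral_setD1 R g 0 setT)//.
  rewrite -[RHS](@integral0 _ (measurableTypeR R) R (@lebesgue_measure R) (setT `\ (0 : R))).
  apply: eq_integral => u; rewrite inE /= => -[_ u0]; rewrite g0//; exact/eqP.
apply: (eq_measurable_fun (fun=> 0%E)) => // u.
by rewrite inE /= => -[_ u0]; rewrite g0//; exact/eqP.
Qed.

(** * The truncated difference and its continuation *)

HB.instance Definition _ (R : realType) :=
  Measure_isSigmaFinite.Build _ _ _ (@counting nat R) (sigma_finite_counting R).

Section Assembly.
Variables (R : realType) (d : nat) (al : 'I_d -> nat).
Hypothesis d1 : (1 <= d)%N.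
Notation mu := (@lebesgue_measure R).
Notation normc := (@Normc.normc R).
Notation Re := (@complex.Re R).
Notation Im := (@complex.Im R).
Local Notation cnt := (@counting nat R).
Local Notation Dpos := ([set t : R | 0 < t] : set (measurableTypeR R)).
Local Notation K := (d + 2 * mdeg al)%N.
Local Notation k := K.+1.
Local Notation S := (K%:R : R).
Local Notation kappa := (k%:R + S / 2).

Definition sqn (x : 'rV[R]_d) : R := \sum_j x ord0 j ^+ 2.

Lemma cpow_sqrt (n : R) (s : Cplx R) : 0 < n -> cpow (Num.sqrt n) s = tpow (s / 2) n.
Proof.
move=> n0; rewrite tpow_cpow ?sqrtr_gt0// /tpow -powR12_sqrt ?ltW// ln_powR.
by rewrite rmorphM/= real_halfC; congr cexp; ring.
Qed.

Lemma hom_kernelE (s : Cplx R) (x : 'rV[R]_d) : 0 < sqn x ->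
  hom_kernel al s x = (monomial x (fun j => 2 * al j)%N)%:C%C * tpow (- (s / 2)) (sqn x).
Proof. by move=> x0; rewrite /hom_kernel /enorm -/(sqn x) cpow_sqrt// tpowN. Qed.

(** By the convention 1/0 = 0 the kernel is 0 at the origin, in accordance with
    the weight being switched off there. *)
Lemma hom_kernel_origin (s : Cplx R) (x : 'rV[R]_d) : 0 < Re s -> sqn x = 0 ->
  hom_kernel al s x = 0.
Proof.
move=> s0 x0; rewrite /hom_kernel /enorm -/(sqn x) x0 sqrtr0 /cpow powR0 ?gt_eqF//.
by rewrite !mul0r -[(0 +i* 0)%C]/(0 : Cplx R) invr0 mulr0.
Qed.

Lemma sqn_row (x : d.-tuple (measurableTypeR R)) : sqn (row_of_tuple x) = tnorm2 x.
Proof. by rewrite /sqn /tnorm2; apply: eq_bigr => j _; rewrite mxE. Qed.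
Lemma monomial_row (x : d.-tuple (measurableTypeR R)) :
  monomial (row_of_tuple x) (fun j => 2 * al j)%N = tweight al x.
Proof. by rewrite /monomial /tweight; apply: eq_bigr => j _; rewrite mxE. Qed.
Lemma sqn_lattice (i : 'rV[int]_d) : sqn (map_mx intr i) = lnorm2 R i.
Proof. by rewrite /sqn /lnorm2; apply: eq_bigr => j _; rewrite mxE. Qed.
Lemma monomial_lattice (i : 'rV[int]_d) :
  monomial (map_mx intr i : 'rV[R]_d) (fun j => 2 * al j)%N = lweight R al i.
Proof. by rewrite /monomial /lweight; apply: eq_bigr => j _; rewrite mxE. Qed.

Lemma riesz_exp_natE : riesz_exp k%:R al = kappa :> R.
Proof.
rewrite /riesz_exp big_split/= sumr_const card_ord -mulr_natl /mdeg natrD natrM natr_sum.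
by congr (_ + _); field.
Qed.

(** With K = S the asymptotics has error O((1 + t)^k). Leaving out the origin
    changes the mean by at most t^k, which is of the same order, and makes it
    vanish for t <= 1; this is why the error can be stated as t^k for t >= 1. *)
Lemma lattice_mean : exists C cB : R, exists B : R -> R, [/\ 0 <= C, 0 <= cB,
  measurable_fun (setT : set (measurableTypeR R)) B,
  (forall t, t <= 1 -> B t = 0) /\
  (forall t, 1 <= t -> `|B t - C * t `^ kappa| <= cB * t `^ k%:R) &
  (forall t, \int[@lebesgue_tuple R d]_x (tweight_off0 al x * truncpow k%:R (t - tnorm2 x))%:E =
             (C * truncpow kappa t)%:E)%E /\
  (forall t, \esum_(i in @Zd0 d) (lweight R al i * truncpow k%:R (t - lnorm2 R i))%:E = (B t)%:E)%E].
Proof.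
have K1 : (1 <= K)%N by rewrite addn_gt0 d1.
have Kk : S < k%:R by rewrite ltr_nat.
have [C [c [b [C0 c0 I1 S1 E1]]]] := riesz_mean_asymptotic K1 Kk al.
pose B t := b t - lweight R al 0 * truncpow k%:R t.
have HB t : (\esum_(i in @Zd0 d) (lweight R al i * truncpow k%:R (t - lnorm2 R i))%:E = (B t)%:E)%E.
  exact: esum_Zd0.
have l0 := lweight_ge0 R al 0.
have l1 := lweight0_le1 R al.
exists C, (c * 2 `^ k%:R + 1), B; split=> //.
- by rewrite addr_ge0// mulr_ge0 ?powR_ge0.
- have [e bije] := enum_Zd0 d1.
  apply/measurable_EFinP.
  pose f (z : nat * measurableTypeR R) : \bar R :=
    (lweight R al (e z.1) * truncpow k%:R (z.2 - lnorm2 R (e z.1)))%:E.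
  have mf : measurable_fun setT f.
    apply/measurable_EFinP; apply: measurable_funM.
      exact: (@measurableT_comp _ _ _ _ _ _ (fun n => lweight R al (e n)) _ fst).
    apply: measurableT_comp; first exact: measurable_truncpow.
    apply: measurable_funB => //.
    exact: (@measurableT_comp _ _ _ _ _ _ (fun n => lnorm2 R (e n)) _ fst).
  have f0 z : (0 <= f z)%E by rewrite lee_fin mulr_ge0 ?lweight_ge0 ?truncpow_ge0.
  have := @measurable_fun_fubini_tonelli_G _ _ nat (measurableTypeR R) R cnt f mf f0.
  apply: eq_measurable_fun => t _.
  rewrite /fubini_G /f/= -HB -(integral_enum bije)// => i.
  by rewrite lee_fin mulr_ge0 ?lweight_ge0 ?truncpow_ge0.
- split=> t t1.
    apply: EFin_inj; rewrite -HB esum1// => i Zi.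
    by rewrite truncpow_neg ?mulr0// subr_le0 (le_trans t1)// lnorm2_ge1.
  have t0 : 0 < t by exact: lt_le_trans t1.
  rewrite /B addrAC (le_trans (ler_normB _ _))// mulrDl mul1r lerD//.
    have := E1 t (ltW t0); rewrite riesz_exp_natE truncpow_pos// => /le_trans; apply.
    rewrite addrK -mulrA ler_wpM2l// -powRM ?(ltW t0)//.
    by apply: ge0_ler_powR; rewrite ?nnegrE//; lra.
  rewrite ger0_norm ?mulr_ge0 ?truncpow_ge0// truncpow_pos//.
  by rewrite ler_piMl ?powR_ge0.
- split=> // t; rewrite integral_tweight_off0// I1 riesz_exp_natE//.
Qed.

Lemma eq_csum_Zd0 (u v : 'rV[int]_d -> Cplx R) :
  (forall i, Zd0 i -> u i = v i) ->
  (csummable (@Zd0 d) u -> csummable (@Zd0 d) v) /\ csum (@Zd0 d) u = csum (@Zd0 d) v.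
Proof.
move=> uv; split.
  rewrite /csummable /summable; have -> // : (\esum_(i in @Zd0 d) `|(normc (v i))%:E|)%E =
    (\esum_(i in @Zd0 d) `|(normc (u i))%:E|)%E.
  by apply: eq_esum => i /uv ->.
have key (f : Cplx R -> R) : rsum (@Zd0 d) (f \o u) = rsum (@Zd0 d) (f \o v).
  rewrite /rsum; congr fine; congr (_ - _)%E; apply: eq_esum => i Zi.
    by rewrite !funeposE /= uv.
  by rewrite !funenegE /= uv.
by rewrite /csum (key Re) (key Im).
Qed.

Section WithProfile.
Variables (a : R) (g : 'rV[R]_d -> R) (G : nat -> R -> R) (M : nat -> R).
Hypothesis a0 : 0 < a.
Hypothesis dG : forall j (r : R), is_derive r 1 (G j) (G j.+1 r).
Hypothesis zG : forall j r, a < `|r| -> G j r = 0.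
Hypothesis bG : forall j r, `|G j r| <= M j.
Hypothesis gG : forall x, g x = G 0%N (enorm x).
Hypothesis G0 : G 0%N 0 = 1.
Variables (C cB : R) (B : R -> R).
Hypotheses (C0 : 0 <= C) (cB0 : 0 <= cB).
Hypothesis mB : measurable_fun (setT : set (measurableTypeR R)) B.
Hypothesis B1 : forall t, t <= 1 -> B t = 0.
Hypothesis B2 : forall t, 1 <= t -> `|B t - C * t `^ kappa| <= cB * t `^ k%:R.
Hypothesis HT : forall t, (\int[@lebesgue_tuple R d]_x (tweight_off0 al x * truncpow k%:R (t - tnorm2 x))%:E =
             (C * truncpow kappa t)%:E)%E.
Hypothesis HL : forall t, (\esum_(i in @Zd0 d) (lweight R al i * truncpow k%:R (t - lnorm2 R i))%:E = (B t)%:E)%E.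

Let S0 : 0 < S.
Proof. by rewrite ltr0n addn_gt0 d1. Qed.

Lemma cut_kernelE (N : nat) (s : Cplx R) (x : 'rV[R]_d) : 0 < sqn x ->
  cut_kernel g a al N s x = (monomial x (fun j => 2 * al j)%N)%:C%C *
    ((dilate G (a / N%:R) 0 (sqn x))%:C%C * tpow (- (s / 2)) (sqn x)).
Proof.
move=> x0; rewrite /cut_kernel hom_kernelE// mulrCA; congr (_ * (_%:C%C * _)).
rewrite gG /dilate expr0 mul1r; congr (G _ _).
rewrite /enorm (eq_bigr (fun j => (a / N%:R) ^+ 2 * x ord0 j ^+ 2)); last first.
  by move=> j _; rewrite mxE exprMn.
by rewrite -mulr_sumr sqrtrM ?sqr_ge0// sqrtr_sqr ger0_norm// divr_ge0// ltW.
Qed.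


Section Kernel.
Variables (E : nat -> R -> R) (Ms : nat -> R) (s : Cplx R).
Hypothesis chE : euler_chain E.
Hypothesis bE : forall i t, 0 < t -> `|E i t| <= Ms i.
Hypothesis mE : forall i, measurable_fun (setT : set (measurableTypeR R)) (E i).
Hypothesis s0 : 0 < Re s.

Let phi (t : R) : Cplx R := (E 0%N t)%:C%C * tpow (- (s / 2)) t.

Let tay n (n0 : 0 < n) := taylor_kernelE (k := k) isT chE bE s0 n0 mE.

Let mPsi : cmeas (setT : set (measurableTypeR R)) (taylor_kernel k E s).
Proof. exact: cmeas_taylor_kernel. Qed.

Lemma kernel_integral :
  cintble mu Dpos (fun t => (C * truncpow kappa t)%:C%C * taylor_kernel k E s t) ->
  let f x := (tweight_off0 al x)%:C%C * phi (tnorm2 x) in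
  cintble (@lebesgue_tuple R d) setT f /\
  cint (@lebesgue_tuple R d) setT f =
    cint mu Dpos (fun t => (C * truncpow kappa t)%:C%C * taylor_kernel k E s t).
Proof.
move=> iC f.
have pos x : tweight_off0 al x != 0 -> 0 < tnorm2 x.
  by rewrite /tweight_off0; case: ifPn => [_|x0 _]; rewrite ?eqxx// lt_neqAle eq_sym x0 tnorm2_ge0.
have [||||||F1 F2] := @fubini_kernel _ _ R (@power_measure _ _ R mu d) (tweight_off0 al) (@tnorm2 R d)
  k%:R (fun t => C * truncpow kappa t) _ _ _ _ (taylor_kernel k E s) mPsi.
- exact: measurable_tweight_off0.
- exact: measurable_tnorm2.
- exact: tweight_off0_ge0.
- exact: HT.
- exact: iC.
- by move=> x /pos x0; have [] := tay x0.
have fE x : setT x -> (tweight_off0 al x)%:C%C *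
      cint mu Dpos (fun t => (truncpow k%:R (t - tnorm2 x))%:C%C * taylor_kernel k E s t) = f x.
  move=> _; rewrite /f; have [->|/pos x0] := eqVneq (tweight_off0 al x) 0; first by rewrite !mul0r.
  by have [_ ->] := tay x0.
split; first exact: (eq_cintble measurableT fE F1).
by rewrite -F2; apply/esym/eq_cint.
Qed.

Lemma kernel_sum :
  cintble mu Dpos (fun t => (B t)%:C%C * taylor_kernel k E s t) ->
  let u i := (lweight R al i)%:C%C * phi (lnorm2 R i) in
  csummable (@Zd0 d) u /\
  csum (@Zd0 d) u = cint mu Dpos (fun t => (B t)%:C%C * taylor_kernel k E s t).
Proof.
move=> iB u; have [e bije] := enum_Zd0 d1.
have pos n : 0 < lnorm2 R (e n).
  have [H _ _] := bije; apply: (lt_le_trans ltr01); apply: lnorm2_ge1.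
  exact: H.
have [||||||F1 F2] := @fubini_kernel _ nat R (@counting nat R) (fun n => lweight R al (e n))
  (fun n => lnorm2 R (e n)) k%:R B _ _ _ _ (taylor_kernel k E s) mPsi.
- by [].
- by [].
- by move=> n; exact: lweight_ge0.
- move=> t; rewrite -HL -(integral_enum bije)// => i.
  by rewrite lee_fin mulr_ge0 ?lweight_ge0 ?truncpow_ge0.
- exact: iB.
- by move=> n _; have [] := tay (pos n).
have fE n : setT n -> (lweight R al (e n))%:C%C *
      cint mu Dpos (fun t => (truncpow k%:R (t - lnorm2 R (e n)))%:C%C * taylor_kernel k E s t) = u (e n).
  by move=> _; rewrite /u; have [_ ->] := tay (pos n).
have iu : cintble cnt setT (u \o e) by exact: (eq_cintble measurableT fE F1).
split; first exact: (csummable_cintble bije iu).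
by rewrite (csum_cint bije) -F2; apply/esym/eq_cint.
Qed.

End Kernel.

Let Fc := mellin_defect k S C B.

(** Because of the cut-off the sum and the integral can be treated separately,
    each by Taylor's formula and Fubini. *)
Lemma trap_defectE (s : Cplx R) (N : nat) : 0 < Re s < S -> (0 < N)%N ->
  [/\ cintegrable (cut_kernel g a al N s),
      csummable (@Zd0 d) (lattice (cut_kernel g a al N s)) &
      trap_defect g a al s N =
      cint mu Dpos (fun t => (C * truncpow kappa t - B t)%:C%C * taylor_kernel k (dilate G (a / N%:R)) s t)].
Proof.
move=> /andP[s0 sS] N0.
have c0 : 0 < a / N%:R by rewrite divr_gt0 ?ltr0n.
pose E := dilate G (a / N%:R).
have chE : euler_chain E := euler_dilate dG _.
have bE i t : 0 < t -> `|E i t| <= a ^+ i * M i.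
  by move=> _; apply: (dilate_bound a0 zG bG); exact: ltW.
have mE i := measurable_dilate dG (a / N%:R) i.
have zE i t : N%:R ^+ 2 < t -> E i t = 0.
  move=> Nt; apply: (dilate_zero zG i c0 _ (sqr_ge0 N%:R) Nt).
  by rewrite sqrtr_sqr ger0_norm// divfK// pnatr_eq0 -lt0n.
have T1 : 1 <= N%:R ^+ 2 :> R by rewrite -natrX ler1n expn_gt0 N0.
have iB : cintble mu Dpos (fun t => (B t)%:C%C * taylor_kernel k E s t).
  apply: (taylor_kernel_compact (ch := C + cB) bE mE zE T1 sS mB).
  by move=> t t0; exact: (mean_le S0 C0 cB0 B1 B2).
have mppk : measurable_fun (setT : set (measurableTypeR R)) (fun t => C * truncpow kappa t).
  by apply: measurable_funM => //; exact: measurable_truncpow.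
have iC : cintble mu Dpos (fun t => (C * truncpow kappa t)%:C%C * taylor_kernel k E s t).
  apply: (taylor_kernel_compact (ch := C) bE mE zE T1 sS mppk).
  by move=> t t0; rewrite truncpow_pos// ger0_norm ?mulr_ge0 ?powR_ge0.
have [T2 T3] := kernel_integral chE bE mE s0 iC.
have [L2 L3] := kernel_sum chE bE mE s0 iB.
have eT x : setT x -> (tweight_off0 al x)%:C%C * ((E 0%N (tnorm2 x))%:C%C * tpow (- (s / 2)) (tnorm2 x)) =
    cut_kernel g a al N s (row_of_tuple x).
  move=> _; rewrite /tweight_off0; case: ifPn => [/eqP x0|x0].
    by rewrite mul0r /cut_kernel hom_kernel_origin ?sqn_row// mulr0.
  have {}x0 : 0 < sqn (row_of_tuple x) by rewrite sqn_row lt_neqAle eq_sym x0 tnorm2_ge0.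
  by rewrite cut_kernelE// monomial_row sqn_row.
have eL i : Zd0 i -> (lweight R al i)%:C%C * ((E 0%N (lnorm2 R i))%:C%C * tpow (- (s / 2)) (lnorm2 R i)) =
    lattice (cut_kernel g a al N s) i.
  move=> i0; rewrite /lattice cut_kernelE ?monomial_lattice ?sqn_lattice//.
  by apply: (lt_le_trans ltr01); exact: lnorm2_ge1.
have [sumL csumL] := eq_csum_Zd0 eL.
split.
- exact: (eq_cintble measurableT eT T2).
- exact: sumL.
rewrite /trap_defect -csumL L3 (_ : cintegral _ =
    cint mu Dpos (fun t => (C * truncpow kappa t)%:C%C * taylor_kernel k E s t)).
  have mD : measurable Dpos by exact: measurable_Dpos.
  have iB' := cintbleZ mD (-1) iB.
  rewrite -[RHS](_ : cint mu Dpos (fun t =>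
      (C * truncpow kappa t)%:C%C * taylor_kernel k E s t + (-1) * ((B t)%:C%C * taylor_kernel k E s t)) = _).
    by rewrite cintD// cintZ// mulN1r.
  by apply: eq_cint => t _; rewrite mulN1r rmorphB/= mulrBl.
rewrite -T3; apply/esym; exact: eq_cint eT.
Qed.

Lemma trap_defect_cvg (s : Cplx R) : 0 < Re s < S ->
  trap_defect g a al s @ \oo --> Fc s.
Proof.
move=> sS; rewrite -cvg_shiftS.
have -> : [sequence trap_defect g a al s n.+1]_n = (fun n => cint mu Dpos (fun t =>
    (C * truncpow kappa t - B t)%:C%C * taylor_kernel k (dilate G (a / n.+1%:R)) s t)).
  by apply/funext => n /=; have [] := trap_defectE sS (ltn0Sn n).
apply: (defect_kernel_cvg (E := fun n => dilate G (a / n.+1%:R)) (Ms := fun i => a ^+ i * M i)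
  C0 cB0 mB B1 B2 sS).
- move=> n i t _; apply: (dilate_bound a0 zG bG).
  by rewrite divr_ge0 ?(ltW a0).
- by move=> n i; exact: (measurable_dilate dG).
- move=> i t _; apply: (dilate_lim dG G0).
  rewrite -(mulr0 a); apply: cvgMr.
  exact: cvg_harmonic.
Qed.

(** Absolute convergence of the series is part of what Fubini delivers, from the
    integrability of B against the density. *)
Lemma hom_kernel_sum (s : Cplx R) : S < Re s ->
  csummable (@Zd0 d) (lattice (hom_kernel al s)) /\
  - csum (@Zd0 d) (lattice (hom_kernel al s)) = Fc s.
Proof.
move=> Ss; have s0 : 0 < Re s by exact: lt_trans Ss.
have [iB eB] := mean_kernel_const S0 C0 cB0 mB B1 B2 Ss.
have [L2 L3] := kernel_sum (@euler_const_chain R) (fun i t _ => @const_chain_bound R i t)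
  (@measurable_const_chain R) s0 iB.
have eL i : Zd0 i -> (lweight R al i)%:C%C * ((@const_chain R 0%N (lnorm2 R i))%:C%C * tpow (- (s / 2)) (lnorm2 R i)) =
    lattice (hom_kernel al s) i.
  move=> i0; rewrite /lattice hom_kernelE ?monomial_lattice ?sqn_lattice ?mul1r//.
  by apply: (lt_le_trans ltr01); exact: lnorm2_ge1.
have [sumL csumL] := eq_csum_Zd0 eL.
by split; [exact: sumL|rewrite -csumL L3 eB opprK].
Qed.

End WithProfile.
End Assembly.

Theorem corollary2p10 (R : realType) (d p : nat) (a : R) (g : 'rV[R]_d -> R)
    (alpha : 'I_d -> nat)
    (d_ge1 : (1 <= d)%N) (a_gt0 : 0 < a)
    (g_Cc : Cc_infty g) (g_radial : radial g)
    (g_supp : support_of g `<=` box a)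
    (g0 : g 0 = 1)
    (g_flat : forall beta : 'I_d -> nat,
       (1 <= mdeg beta <= 2 * p + 1)%N -> mpderive beta g 0 = 0)
    (alpha_le : (mdeg alpha <= p)%N) :
  let sa : R := (d + 2 * mdeg alpha)%N%:R in
  let D1 := strip 0 sa in
  let D3 := strip sa (sa + 1) in
  let Omega := strip 0 (sa + 1) `\ (sa%:C)%C in
  let bD1 := trap_limit g a alpha in
  let bD3 := continuation Omega D1 D3 bD1 in
  let negsum := fun s : Cplx R => - csum (@Zd0 d) (lattice (hom_kernel alpha s)) in
  [/\ (* the limit defining bD1 makes sense and exists on D1 *)
      forall s, D1 s ->
        (forall N : nat, (0 < N)%N ->
           cintegrable (cut_kernel g a alpha N s) /\
           csummable (@Zd0 d) (lattice (cut_kernel g a alpha N s))) /\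
        cvg (trap_defect g a alpha s @ \oo),
      (* the series converges absolutely on D3 *)
      forall s, D3 s -> csummable (@Zd0 d) (lattice (hom_kernel alpha s)),
      (* the three analytic continuations are defined *)
      [/\ continuable Omega D1 D3 bD1, continuable Omega D3 D1 bD3
        & continuable Omega D3 D1 negsum]
    & forall s, D1 s ->
        bD1 s = continuation Omega D3 D1 bD3 s /\
        continuation Omega D3 D1 bD3 s = continuation Omega D3 D1 negsum s].
Proof.
move=> sa D1 D3 Omega bD1 bD3 negsum.
have [G [dG zG bG gG G0]] := radial_profile d_ge1 a_gt0 g_Cc g_radial g_supp g0.
have [M {}bG] := choice bG.
have [C [cB [B [C0 cB0 mB [B1 B2] [HT HL]]]]] := lattice_mean R alpha d_ge1.
pose F := mellin_defect (d + 2 * mdeg alpha).+1 sa C B.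
have sa0 : 0 < sa by rewrite ltr0n addn_gt0 d_ge1.
have defectE s N := trap_defectE d_ge1 a_gt0 dG zG bG gG C0 cB0 mB B1 B2 HT HL (s := s) (N := N).
have defect_cvg s : D1 s -> trap_defect g a alpha s @ \oo --> F s.
  exact: (trap_defect_cvg d_ge1 a_gt0 dG zG bG gG G0 C0 cB0 mB B1 B2 HT HL).
have hom_sum s : D3 s -> csummable (@Zd0 d) (lattice (hom_kernel alpha s)) /\ negsum s = F s.
  move=> /andP[s1 _]; exact: (hom_kernel_sum d_ge1 C0 cB0 mB B1 B2 HL).
have bD1E s : D1 s -> F s = bD1 s.
  by move=> /defect_cvg sF; apply/esym; apply: cvg_lim sF.
have aF : analytic_on Omega F.
  move=> s [/andP[s1 _] /= s2]; apply: (mellin_defect_analytic (cB := cB)) => //.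
  exact/eqP.
have oO : open Omega by exact: punctured_strip_open.
have cO : connected Omega by exact: punctured_strip_connected.
have oD1 : open D1 by exact: open_strip.
have oD3 : open D3 by exact: open_strip.
have D1O : D1 `<=` Omega.
  move=> s /andP[s0 s1]; split; first by rewrite /strip/= s0/= (lt_trans s1)// ltrDl.
  by move=> /= sE; move: s1; rewrite sE /= ltxx.
have D3O : D3 `<=` Omega.
  move=> s /andP[s0 s1]; split; first by rewrite /strip/= s1 andbT (lt_trans sa0).
  by move=> /= sE; move: s0; rewrite sE /= ltxx.
have D1n : D1 !=set0.
  by exists ((sa / 2)%:C)%C; rewrite /D1 /strip/= divr_gt0//=; lra.
have D3n : D3 !=set0.
  by exists ((sa + 1 / 2)%:C)%C; rewrite /D3 /strip/=; apply/andP; split; lra.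
(* bD3 is itself obtained by continuation, hence equals F by uniqueness. *)
have bD3E s : D3 s -> F s = bD3 s.
  move=> Ds; apply/esym.
  exact: (continuationE oO cO oD1 D1n D1O D3O aF bD1E).
have negsumE s : D3 s -> F s = negsum s by move=> /hom_sum[_ ->].
split.
- move=> s Ds; split; last by apply/cvg_ex; exists (F s); exact: defect_cvg.
  by move=> N N0; have [] := defectE s N Ds N0.
- by move=> s /hom_sum[].
- split; [exact: (continuableE oO cO oD1 D1O D3O aF bD1E)
         |exact: (continuableE oO cO oD3 D3O D1O aF bD3E)
         |exact: (continuableE oO cO oD3 D3O D1O aF negsumE)].
move=> s Ds; rewrite (continuationE oO cO oD3 D3n D3O D1O aF bD3E Ds).
by rewrite (continuationE oO cO oD3 D3n D3O D1O aF negsumE Ds) bD1E.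
Qed.
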